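(* Let $n,N\ge 1$ and let $\phi_{ij}:[0,1]\to(0,+\infty)$, $1\le i,j\le N$, be Lipschitz continuous with $\phi_{ij}=\phi_{ji}$. Consider the system in $\mathbb{R}^{nN}$ $$\dot x_i=\sum_{j=1}^N a_{ij}(\|x_i-x_j\|)(x_j-x_i),\quad i=1,\dots,N,\qquad a_{ij}(r)=\begin{cases}\phi_{ij}(r)& r\in[0,1),\\ 0& r\in[1,+\infty),\end{cases}$$ and the properties P1), P2), P3) defined in the context. Then: (a) Classical solutions satisfy P1), P2), P3). (b) Caratheodory, Filippov, Krasovskii and CLSS solutions satisfy P1) and P2) but, in general, not P3). (c) Stratified solutions satisfy P1), P2), P3) for a fixed stratification, but the asymptotic state $x^\infty$ in P3) depends on the stratification.
   Context: Properties of solutions (of a given type, defined for all $t\ge0$): P1) The barycenter $\bar x=\frac1N\sum_i x_i$ is invariant (constant in time) along trajectories. P2) (Clustering) Every solution $x(t)$ converges as $t\to\infty$ to some $x^\infty=(x_1^\infty,\dots,x_N^\infty)\in\mathbb{R}^{nN}$ such that for every $1\le i,j\le N$ either $x_i^\infty=x_j^\infty$ or $\|x_i^\infty-x_j^\infty\|\ge1$. The number of clusters is the number of distinct points among the $x_i^\infty$. P3) The asymptotic state $x^\infty$ of P2) depends only on the initial datum of the trajectory (in particular so does the number of clusters). ''In general not P3)'' means that there are choices of $n,N,\phi_{ij}$ and an initial datum with two solutions of that type having different asymptotic states. Write the system as $\dot x=f(x)$ on $\mathbb{R}^m$, $m=nN$, $x=(x_1,\dots,x_N)$, $x_i\in\mathbb{R}^n$.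 Filippov multifunction: $F(x)=\bigcap_{\delta>0}\bigcap_{\lambda^m(Z)=0}\overline{co}\{f(y):y\in B(x,\delta)\setminus Z\}$, with $\lambda^m$ the Lebesgue measure and $\overline{co}$ the closed convex hull. Krasovskii multifunction: $K(x)=\bigcap_{\delta>0}\overline{co}\{f(y):y\in B(x,\delta)\}$. Stratified set: $\Gamma=\bigcup_{i=1}^{m_\Gamma}M_i\subset\mathbb{R}^m$, $m_\Gamma\in\mathbb{N}\cup\{+\infty\}$, with $M_i$ $C^1$ embedded manifolds of dimension $n_i\le m$, such that each compact set meets only finitely many $M_i$; $M_i\cap M_j=\emptyset$ for $i\ne j$; and if $M_i\cap\partial M_j\neq\emptyset$, $i\ne j$, then $M_i\subset\partial M_j$ and $n_i<n_j$ ($\partial$ is the topological boundary of the embedded manifold). Stratification for $\dot x=f(x)$: a quadruplet $S=(\Gamma,N_1,N_2,\Sigma)$ with $\Gamma=\mathbb{R}^m=\bigcup_i M_i$ stratified, $N_1\cup N_2=\{1,\dots,m_\Gamma\}$, $N_1\cap N_2=\emptyset$, $\Sigma:N_2\to N_1$, such that: if $i\in N_1$ (type I cell), then $f(x)\in T_xM_i$ for every $x\in M_i$ and $f|_{M_i}$ is smooth; if $j\in N_2$ (type II cell), then for every $x\in M_j$ there exist $\epsilon>0$ and a unique absolutely continuous curve $\xi_x:[0,\epsilon)\to\mathbb{R}^m$ with $\xi_x(0)=x$, and $\xi_x(t)\in M_{\Sigma(j)}$, $\dot\xi_x(t)=f(\xi_x(t))$ for every $t\in(0,\epsilon)$. Solutions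 on $[0,T]$: - Classical: $x:[0,T]\to\mathbb{R}^m$ differentiable with $\dot x(t)=f(x(t))$ at every $t\in[0,T]$ (one-sided derivatives at the endpoints). - Caratheodory: absolutely continuous, $\dot x(t)=f(x(t))$ for a.e. $t$. - Filippov (resp. Krasovskii): absolutely continuous with $\dot x(t)\in F(x(t))$ (resp. $\dot x(t)\in K(x(t))$) for a.e. $t$. - CLSS (limit of sample-and-hold): a continuous $x$ which is the uniform limit of continuous piecewise smooth functions $x_\nu$ with $x_\nu(0)=x(0)$, for which there are $0=t^0_\nu<\dots<t^{m_\nu}_\nu=T$ with $\dot x_\nu(t)=f(x_\nu(t^j_\nu))$ on $[t^j_\nu,t^{j+1}_\nu)$ and $\max_j(t^{j+1}_\nu-t^j_\nu)\to0$ as $\nu\to\infty$. - Stratified (generated by $S$): continuous, piecewise smooth $x$ for which there are $0=t_0<\dots<t_\ell=T$ and indices $i_0,\dots,i_{\ell-1}$ such that, for $k=0,\dots,\ell-1$: if $i_k\in N_1$ then $x$ is a classical solution on $[t_k,t_{k+1})$ contained in $M_{i_k}$; if $i_k\in N_2$ then $x(t_k)\in M_{i_k}$ and $x$ is a classical solution on $(t_k,t_{k+1})$ contained in $M_{\Sigma(i_k)}$. A global solution is a function on $[0,+\infty)$ whose restriction to each $[0,T]$ is a solution.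
   Formalization: For a type II cell, the unique curve $\xi_x$ on $[0,\epsilon)$ is also required to be the only such curve on every shorter interval $[0,\epsilon')$, $\epsilon'\le\epsilon$; with uniqueness on $[0,\epsilon)$ alone, solutions can branch and P3 in (c) fails. *)

(* Defs.v *)
(* Agents are indexed by 'I_N, opinions live in 'rV[R]_n,
   and the state space R^(nN) is 'M[R]_(N, n), agent i being row i.  The
   library topology of 'M[R]_(N, n) comes from the sup norm, hence is the usual
   one; distances between opinions use the Euclidean norm [enorm] below.
   A function on a real interval is a total function on R of which only the
   values on that interval are used. *)
From HB Require Import structures.
From mathcomp Require Import all_boot all_order all_algebra.
From mathcomp Require Import all_classical all_reals all_analysis.

Set Implicit Arguments.
Unset Strict Implicit.
Unset Printing Implicit Defensive.

Import Order.TTheory GRing.Theory Num.Theory.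
Import numFieldNormedType.Exports.

Local Open Scope classical_set_scope.
Local Open Scope ring_scope.

Section euclidean_space.
Variables (R : realType) (p q : nat).
Local Notation V := 'M[R]_(p, q).

Definition enorm (x : V) : R := Num.sqrt (\sum_i \sum_j x i j ^+ 2).

Definition eball (x : V) (r : R) : set V := [set y | enorm (y - x) < r].

Definition closed_convex_hull (A : set V) : set V :=
  smallest [set C : set V | closed C /\ @convex_set R V C] A.

Definition box (a b : V) : set V :=
  [set y | forall i j, a i j <= y i j <= b i j].

Definition box_volume (a b : V) : R := \prod_i \prod_j (b i j - a i j).

(* Lebesgue outer measure on R^(pq), by countable covers with boxes; a set of
   outer measure 0 is Lebesgue measurable, of measure 0. *)
Definition lebesgue_outer (Z : set V) : \bar R :=
  ereal_inf [set s : \bar R | exists a b : nat -> V,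
    [/\ forall k i j, a k i j <= b k i j,
        Z `<=` \bigcup_k box (a k) (b k) &
        s = (\sum_(0 <= k <oo) (box_volume (a k) (b k))%:E)%E]].

Definition lebesgue_null (Z : set V) : Prop := lebesgue_outer Z = 0%E.

End euclidean_space.

Section smoothness.
Variables (R : realType).

(* C^k maps on an open subset A of a finite-dimensional space U, by iterated
   directional derivatives. *)
Fixpoint Ck_on (U W : normedModType R) (k : nat) (A : set U) (g : U -> W)
  : Prop :=
  match k with
  | 0 => forall x, A x -> {for x, continuous g}
  | k'.+1 => forall v, (forall x, A x -> derivable g x v) /\
                       Ck_on k' A (fun x => 'D_v g x)
  end.

Definition smooth_on (U W : normedModType R) (A : set U) (g : U -> W) : Prop :=
  forall k, Ck_on k A g.

End smoothness.

Section submanifolds.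
Variables (R : realType) (p q : nat).
Local Notation V := 'M[R]_(p, q).

(* The subspace R^d x {0} of R^(pq), coordinates being numbered by [mxvec]. *)
Definition slice (d : nat) : set V :=
  [set y | forall k : 'I_(p * q), (d <= k)%N -> mxvec y 0 k = 0].

(* Near each of its points, M is straightened to R^d x {0} by a C^1
   diffeomorphism Phi : U -> U' between open sets, with inverse Psi. *)
Definition C1_embedded_manifold (d : nat) (M : set V) : Prop :=
  (d <= p * q)%N /\
  forall x, M x -> exists (U U' : set V) (Phi Psi : V -> V),
    [/\ open U, U x & open U'] /\
    [/\ Ck_on 1 U Phi, Ck_on 1 U' Psi,
        forall y, U y -> U' (Phi y) /\ Psi (Phi y) = y,
        forall z, U' z -> U (Psi z) /\ Phi (Psi z) = z &
        forall y, U y -> (M y <-> slice d (Phi y))].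

(* Velocities at x of C^1 curves drawn on M. *)
Definition tangent_space (M : set V) (x : V) : set V :=
  [set v | exists2 e : R, 0 < e & exists gamma : R -> V,
    [/\ Ck_on 1 `]- e, e[ gamma, gamma 0 = x,
        forall t, t \in `]- e, e[ -> M (gamma t) &
        is_derive (0 : R) (1 : R) gamma v]].

Definition smooth_restriction (M : set V) (f : V -> V) : Prop :=
  forall x, M x -> exists (U : set V) (g : V -> V),
    [/\ open U, U x, smooth_on U g & forall y, U y -> M y -> g y = f y].

Definition boundary (M : set V) : set V := closure M `\` interior M.

End submanifolds.

Section solutions.
Variables (R : realType) (p q : nat).
Local Notation V := 'M[R]_(p, q).

(* v is the derivative at t of x restricted to A (one-sided when t is an
   endpoint of the interval A). *)
Definition has_deriv_in (A : set R) (x : R -> V) (t : R) (v : V) : Prop :=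
  (fun s => (s - t)^-1 *: (x s - x t)) @ within A (dnbhs t) --> v.

(* m pairwise non-overlapping intervals [a i, b i] inside the interval A. *)
Definition abs_continuous_on (A : set R) (x : R -> V) : Prop :=
  forall e : R, 0 < e -> exists2 d : R, 0 < d &
    forall (m : nat) (a b : 'I_m -> R),
      (forall i, [/\ A (a i), A (b i) & a i <= b i]) ->
      (forall i j, i != j -> b i <= a j \/ b j <= a i) ->
      \sum_i (b i - a i) < d ->
      \sum_i `|x (b i) - x (a i)| < e.

Definition grid (T : R) (l : nat) (t : nat -> R) : Prop :=
  [/\ t 0%N = 0, t l = T & forall k, (k < l)%N -> t k < t k.+1].

Definition piecewise_smooth (T : R) (x : R -> V) : Prop :=
  exists (l : nat) (s : nat -> R), grid T l s /\
    forall k, (k < l)%N -> smooth_on `]s k, s k.+1[ x.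

Section field.
Variable f : V -> V.

Definition filippov (x : V) : set V :=
  \bigcap_(d in [set d : R | 0 < d])
    \bigcap_(Z in [set Z : set V | lebesgue_null Z])
      closed_convex_hull (f @` (eball x d `\` Z)).

Definition krasovskii (x : V) : set V :=
  \bigcap_(d in [set d : R | 0 < d]) closed_convex_hull (f @` eball x d).

Definition classical_on (A : set R) (x : R -> V) : Prop :=
  forall t, A t -> has_deriv_in A x t (f (x t)).

Definition classical_sol (T : R) (x : R -> V) : Prop :=
  classical_on `[0, T] x.

Definition caratheodory_sol (T : R) (x : R -> V) : Prop :=
  abs_continuous_on `[0, T] x /\
  {ae (@lebesgue_measure R), forall t, t \in `[0, T] ->
     has_deriv_in `[0, T] x t (f (x t))}.

Definition inclusion_sol (G : V -> set V) (T : R) (x : R -> V) : Prop :=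
  abs_continuous_on `[0, T] x /\
  {ae (@lebesgue_measure R), forall t, t \in `[0, T] ->
     exists2 v, has_deriv_in `[0, T] x t v & G (x t) v}.

Definition filippov_sol : R -> (R -> V) -> Prop := inclusion_sol filippov.

Definition krasovskii_sol : R -> (R -> V) -> Prop := inclusion_sol krasovskii.

Definition clss_sol (T : R) (x : R -> V) : Prop :=
  {within `[0, T], continuous x} /\
  exists (y : nat -> R -> V) (m : nat -> nat) (t : nat -> nat -> R),
    [/\ forall nu, [/\ {within `[0, T], continuous (y nu)},
                       piecewise_smooth T (y nu) & y nu 0 = x 0],
        forall nu, grid T (m nu) (t nu),
        forall nu j, (j < m nu)%N -> forall s, s \in `[t nu j, t nu j.+1[ ->
          has_deriv_in `[t nu j, t nu j.+1[ (y nu) s (f (y nu (t nu j))),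
        (fun nu => \big[Num.max/0]_(j < m nu) (t nu j.+1 - t nu j)) @ \oo
          --> (0 : R) &
        {uniform `[0, T], y @ \oo --> x}].

(* Cells are numbered from 0; [ncells = None] stands for m_Gamma = +oo. *)
Record stratification_data := StratificationData {
  ncells : option nat;
  cell : nat -> set V;
  cell_dim : nat -> nat;
  typeI : set nat;
  typeII : set nat;
  next_cell : nat -> nat }.

Definition cells (S : stratification_data) : set nat :=
  [set i | if ncells S is Some m then (i < m)%N else True].

Definition stratified_set (S : stratification_data) : Prop :=
  [/\ forall i, cells S i -> C1_embedded_manifold (cell_dim S i) (cell S i),
      forall K : set V, compact K ->
        finite_set [set i | cells S i /\ K `&` cell S i !=set0],
      forall i j, cells S i -> cells S j -> i <> j ->
        cell S i `&` cell S j = set0 &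
      forall i j, cells S i -> cells S j -> i <> j ->
        cell S i `&` boundary (cell S j) !=set0 ->
        cell S i `<=` boundary (cell S j) /\ (cell_dim S i < cell_dim S j)%N].

Definition entering_curve (M : set V) (x : V) (e : R) (xi : R -> V) : Prop :=
  [/\ abs_continuous_on `[0, e[ xi, xi 0 = x,
      forall t, t \in `]0, e[ -> M (xi t) & classical_on `]0, e[ xi].

(* The curve [xi] issued from a point of a type II cell is unique as a germ:
   it is the only one on [0, e) and on every shorter interval [0, e').
   Uniqueness on [0, e) alone would allow a second curve that enters the next
   cell and leaves it before time e, hence a branching of the flow. *)
Definition is_stratification (S : stratification_data) : Prop :=
  [/\ stratified_set S,
      \bigcup_(i in cells S) cell S i = [set: V],
      typeI S `|` typeII S = cells S /\ typeI S `&` typeII S = set0,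
      forall i, typeI S i ->
        (forall x, cell S i x -> tangent_space (cell S i) x (f x)) /\
        smooth_restriction (cell S i) f &
      forall j, typeII S j -> typeI S (next_cell S j) /\
        forall x, cell S j x -> exists (e : R) (xi : R -> V),
          [/\ 0 < e, entering_curve (cell S (next_cell S j)) x e xi &
              forall e' (eta : R -> V), 0 < e' <= e ->
                entering_curve (cell S (next_cell S j)) x e' eta ->
                forall t, t \in `[0, e'[ -> eta t = xi t]].

(* [piecewise_smooth] asks for no regularity at the switching times. *)
Definition stratified_sol (S : stratification_data) (T : R) (x : R -> V)
  : Prop :=
  [/\ {within `[0, T], continuous x}, piecewise_smooth T x &
      exists (l : nat) (t : nat -> R) (i : nat -> nat), grid T l t /\
        forall k, (k < l)%N ->
          [/\ cells S (i k),
              typeI S (i k) ->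
                classical_on `[t k, t k.+1[ x /\
                forall s, s \in `[t k, t k.+1[ -> cell S (i k) (x s) &
              typeII S (i k) ->
                [/\ cell S (i k) (x (t k)), classical_on `]t k, t k.+1[ x &
                    forall s, s \in `]t k, t k.+1[ ->
                      cell S (next_cell S (i k)) (x s)]]].

End field.

Definition global (sol : R -> (R -> V) -> Prop) (x : R -> V) : Prop :=
  forall T, 0 < T -> sol T x.

End solutions.

Section opinion_dynamics.
Variables (R : realType).

(* Only the values on [0, 1] of the interaction functions are relevant. *)
Definition interaction (N : nat) (phi : 'I_N -> 'I_N -> R -> R) : Prop :=
  forall i j,
    [/\ [lipschitz phi i j r | r in `[0, 1]%classic],
        forall r, r \in `[0, 1] -> 0 < phi i j r &
        forall r, r \in `[0, 1] -> phi i j r = phi j i r].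

Definition cutoff (phi : R -> R) (r : R) : R := if r < 1 then phi r else 0.

Variables (n N : nat).
Local Notation V := 'M[R]_(N, n).

Definition opinion_field (phi : 'I_N -> 'I_N -> R -> R) (x : V) : V :=
  \matrix_(i < N) \sum_(j < N)
     cutoff (phi i j) (enorm (row i x - row j x)) *: (row j x - row i x).

Definition barycenter (x : V) : 'rV[R]_n := N%:R^-1 *: \sum_(i < N) row i x.

Definition tends_to (x : R -> V) (xoo : V) : Prop := x t @[t --> +oo] --> xoo.

Definition P1 (x : R -> V) : Prop :=
  forall t, 0 <= t -> barycenter (x t) = barycenter (x 0).

Definition P2 (x : R -> V) : Prop :=
  exists2 xoo, tends_to x xoo &
    forall i j, row i xoo = row j xoo \/ 1 <= enorm (row i xoo - row j xoo).

Definition P3 (sol : (R -> V) -> Prop) : Prop :=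
  forall x y xoo yoo, sol x -> sol y -> x 0 = y 0 ->
    tends_to x xoo -> tends_to y yoo -> xoo = yoo.

Definition P1_P2 (sol : (R -> V) -> Prop) : Prop :=
  forall x, sol x -> P1 x /\ P2 x.

Definition distinct_asymptotics (sol sol' : (R -> V) -> Prop) : Prop :=
  exists x y xoo yoo, [/\ sol x, sol' y & x 0 = y 0] /\
    [/\ tends_to x xoo, tends_to y yoo & xoo <> yoo].

End opinion_dynamics.

(* A type of solutions, for all vector fields on all spaces of states. *)
Definition solution_concept (R : realType) :=
  forall p q : nat, ('M[R]_(p, q) -> 'M[R]_(p, q)) ->
    R -> (R -> 'M[R]_(p, q)) -> Prop.

Definition always_P1_P2 (R : realType) (sol : solution_concept R) : Prop :=
  forall (n N : nat) (phi : 'I_N -> 'I_N -> R -> R),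
    (0 < n)%N -> (0 < N)%N -> interaction phi ->
    P1_P2 (global (sol N n (opinion_field (n := n) phi))).

Definition in_general_not_P3 (R : realType) (sol : solution_concept R) : Prop :=
  exists (n N : nat) (phi : 'I_N -> 'I_N -> R -> R),
    [/\ (0 < n)%N, (0 < N)%N & interaction phi] /\
    distinct_asymptotics (global (sol N n (opinion_field (n := n) phi)))
                         (global (sol N n (opinion_field (n := n) phi))).

(* Main.v *)
Require Import Defs.
From mathcomp Require Import all_boot all_order all_algebra.
From mathcomp Require Import all_classical all_reals all_analysis.
From mathcomp Require Import ring lra zify.

(** Everything about P1) and P2) rests on one property of a trajectory,
[mean_value_sol]: no linear functional of the state grows faster than the
supremum of its value on the field near the trajectory.  It holds for the
notions of solution considered.  Krasovskii velocities lie in the closed convex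
hull of nearby values of the field, hence satisfy every linear bound that these
values satisfy ([krasovskii_mean_value], through the growth bound [ac_growth]
for absolutely continuous curves), and Caratheodory and Filippov solutions are
Krasovskii solutions.  Classical and stratified solutions are differentiable
between finitely many times ([piecewise_classical_mean_value]).  Limits of
sample-and-hold solutions inherit the property from the approximations
([clss_mean_value]).

P1) The weights are symmetric, so every coordinate of the field sums to zero
over the agents; the sum and its opposite both have slope at most 0.

P2) For a coordinate c and a level h, the sum over the agents of the positive
parts of x_ic - h does not increase ([excess_nonincreasing]): an agent above h is
pulled up only by other agents above h, and these contributions cancel.  So all
these sums converge, and so does their second difference in h, which measures
how many agents are close to h.  If a coordinate oscillated between a < b for
ever, it would keep visiting N + 1 disjoint windows between a and b, each window
would have to contain an agent at one common late time, and there are only N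
agents ([coord_converges]).  Let xoo be the limit.  Near xoo the scalar product
of xoo and the field is minus a sum of nonnegative terms, one for each pair; if
two limit opinions were distinct and closer than 1, one of these terms would stay
away from 0 and the scalar product of xoo and x would tend to minus infinity
([dissipation_near]).

P3) for classical solutions.  A derivative has the intermediate value property
([darboux]).  If a pair at distance 1 or more came within range, the derivative
of the scalar product with the present state would have to jump, because the
interaction does not vanish at distance 1 ([near_interactions]).  Hence the graph
of interacting pairs is constant along the solution, on a fixed graph the field
is Lipschitz, and the solution is determined by its initial state.

P3) for a fixed stratification.  Two solutions that agree up to some time are in
the same cell then, the cells being disjoint.  They leave it alike: in a cell of
type I the field is the restriction of a smooth map, and from a cell of type II
there is only one entering curve ([stratified_unique]).

Failure of P3).  Two agents on the line at distance exactly 1 may rest, or may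
start to attract each other: both motions are Caratheodory solutions, and both
are Filippov and Krasovskii solutions since each velocity is a limit of values of
the field on open sets that approach the state.  The states at distance 1 form a
cell that can be declared of type I or of type II, whence two stratifications with
different limits ([stratification_dependence]).

Euler polygons that start from two agents at distance 1 do not move, and limits
of sample-and-hold solutions need another example: four agents in the plane.
Agents 0 and 1 move apart and reach distance 1 at time 1/2, exactly when agent 0
reaches distance 1 from agent 2.  With a node at time 1/2 agent 0 stops there, out
of range of everyone, and agents 0 and 2 rest.  When the nodes miss time 1/2,
agent 0 drifts on until the next node, and is then within range of agent 2 and
merges with it.  Both behaviours survive as the step tends to 0 ([clss_not_P3]). *)

Set Implicit Arguments.
Unset Strict Implicit.
Unset Printing Implicit Defensive.

Import Order.TTheory GRing.Theory Num.Theory.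
Import numFieldNormedType.Exports.

Local Open Scope classical_set_scope.
Local Open Scope ring_scope.

(** Linear arithmetic slows down with every hypothesis about vectors, sets or
    functions, so only scalar comparisons and equations are kept for it. *)
Ltac keep_comparisons := repeat match goal with
  | H : ?T |- _ => lazymatch T with
    | is_true (@Order.le _ _ _ _) => fail
    | is_true (@Order.lt _ _ _ _) => fail
    | is_true (_ && _) => fail
    | @eq (matrix _ _ _) _ _ => clear H
    | @eq _ _ _ => fail
    | Real.type => fail
    | _ => clear H
    end
  end.

Ltac linear := keep_comparisons; lra.
Ltac nonlinear := keep_comparisons; nra.

(** * From short intervals to an interval *)

Section cousin.
Variable R : realType.

(** The supremum c of the points that are reached from a is itself reached, as Q
    holds on short intervals around c, and then it is b.  This stands for the
    extraction of a finite subdivision. *)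
Lemma cousin (Q : R -> R -> Prop) (a b : R) : a <= b ->
  (forall t, a <= t -> t <= b -> exists2 eta : R, 0 < eta &
     forall s u, a <= s -> s <= t -> t <= u -> u <= b -> u - s < eta -> Q s u) ->
  (forall s t u, a <= s -> s <= t -> t <= u -> u <= b -> Q s t -> Q t u -> Q s u) ->
  Q a b.
Proof.
move=> ab loc add.
pose S := [set t | [/\ a <= t, t <= b & Q a t]].
have Sa : S a.
  by split=> //; have [eta e0 H] := loc a (lexx _) ab; apply: H; rewrite ?subrr.
have hS : has_sup S by split; [exists a | exists b => t []].
have ac : a <= sup S by apply: sup_upper_bound.
have cb : sup S <= b by apply: ge_sup; [exists a | move=> t []].
set c := sup S in ac cb.
have [eta e0 H] := loc c ac cb.
have Qc : Q a c.
  have [t [at_ tb Qt] ct] := sup_adherent e0 hS.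
  have tc : t <= c by apply: sup_upper_bound.
  apply: (add a t c) => //; apply: H => //; rewrite -/c in ct; linear.
have [cltb|] := ltP c b; last first.
  by move=> bc; have -> : b = c by apply/eqP; rewrite eq_le bc cb.
pose u := Num.min b (c + eta / 2).
have cu : c < u by rewrite lt_min cltb /=; linear.
have ub : u <= b by rewrite ge_min lexx.
have ue : u <= c + eta / 2 by rewrite ge_min lexx orbT.
have Su : S u.
  split=> //; first by linear.
  by apply: (add a c u) => //; [linear | apply: H => //; linear].
have := sup_upper_bound hS Su; rewrite -/c; linear.
Qed.

(** The majorant W need not be linear: a jump of W at a point leaves room there
    for an increment that no slope bound controls. *)
Lemma creep (g W : R -> R) (a b : R) : a <= b ->
  (forall t, a <= t -> t <= b -> exists2 eta : R, 0 < eta &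
     forall s u, a <= s -> s <= t -> t <= u -> u <= b -> u - s < eta ->
       g u - g s <= W u - W s) ->
  g b - g a <= W b - W a.
Proof.
move=> ab loc; apply: (cousin (Q := fun s u => g u - g s <= W u - W s)) => //.
by move=> s t u *; linear.
Qed.

End cousin.

(** * Linear functionals and the maximum norm *)

Section matrix_norm.
Variables (R : realType) (p q : nat).
Local Notation V := 'M[R]_(p, q).

Lemma coord_le_norm (v : V) i j : `|v i j| <= `|v|.
Proof.
rewrite [leRHS]/Num.Def.normr /= mx_normrE.
exact: (le_bigmax 0 (fun ij => `|v ij.1 ij.2|) (i, j)).
Qed.

Lemma norm_le_coord (v : V) e : 0 <= e -> (forall i j, `|v i j| <= e) -> `|v| <= e.
Proof.
move=> e0 H; rewrite /Num.Def.normr /= mx_normrE; by apply/bigmax_leP; split=> // -[i j] _; exact: H.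
Qed.

(** Every linear functional on matrices has this form, so that functionals are
    encoded by matrices. *)
Definition pairing (w v : V) : R := \sum_i \sum_j w i j * v i j.

Lemma pairingD w v v' : pairing w (v + v') = pairing w v + pairing w v'.
Proof.
rewrite /pairing -big_split /=; apply: eq_bigr => i _.
by rewrite -big_split /=; apply: eq_bigr => j _; rewrite mxE mulrDr.
Qed.

Lemma pairingZ w a v : pairing w (a *: v) = a * pairing w v.
Proof.
rewrite /pairing mulr_sumr; apply: eq_bigr => i _.
by rewrite mulr_sumr; apply: eq_bigr => j _; rewrite mxE mulrCA.
Qed.

Lemma pairingB w v v' : pairing w (v - v') = pairing w v - pairing w v'.
Proof. by rewrite -scaleN1r pairingD pairingZ mulN1r. Qed.

Lemma pairingNl w v : pairing (- w) v = - pairing w v.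
Proof.
rewrite /pairing -sumrN; apply: eq_bigr => i _; rewrite -sumrN.
by apply: eq_bigr => j _; rewrite mxE mulNr.
Qed.

Lemma pairingNr w v : pairing w (- v) = - pairing w v.
Proof. by rewrite -sub0r pairingB -[X in pairing _ X](scale0r 0) pairingZ mul0r sub0r. Qed.

(** The operator norm of the functional for the maximum norm on states. *)
Definition mass (w : V) : R := \sum_i \sum_j `|w i j|.

Lemma mass_ge0 w : 0 <= mass w.
Proof. by apply: sumr_ge0 => i _; apply: sumr_ge0 => j _. Qed.

Lemma pairing_le w v : `|pairing w v| <= mass w * `|v|.
Proof.
rewrite /pairing /mass mulr_suml (le_trans (ler_norm_sum _ _ _)) //.
apply: ler_sum => i _; rewrite mulr_suml (le_trans (ler_norm_sum _ _ _)) //.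
by apply: ler_sum => j _; rewrite normrM ler_wpM2l // coord_le_norm.
Qed.

Lemma pairing_delta i j v : pairing (delta_mx i j) v = v i j.
Proof.
rewrite /pairing (bigD1 i) //= (bigD1 j) //= !mxE !eqxx mul1r.
rewrite big1 ?addr0 => [|k /negPf kj]; last by rewrite mxE kj andbF mul0r.
rewrite big1 ?addr0 // => k /negPf ki; apply: big1 => l _.
by rewrite mxE ki mul0r.
Qed.

(** The coordinates and their opposites are functionals of norm 1; stated for
    all functionals of norm at most 1 because growth bounds are uniform in them. *)
Lemma norm_le_pairing v (c : R) : 0 <= c ->
  (forall w, (forall z, pairing w z <= `|z|) -> pairing w v <= c) -> `|v| <= c.
Proof.
move=> c0 H; apply: norm_le_coord => // i j.
have h1 : pairing (delta_mx i j) v <= c.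
  by apply: H => z; rewrite pairing_delta (le_trans (ler_norm _)) // coord_le_norm.
have h2 : pairing (- delta_mx i j) v <= c.
  apply: H => z; rewrite pairingNl pairing_delta.
  by rewrite (le_trans (ler_norm _)) // normrN coord_le_norm.
by move: h1 h2; rewrite pairingNl !pairing_delta ler_norml => ? ?; linear.
Qed.

End matrix_norm.

(** * Derivatives, continuity and limits with explicit bounds *)

Section epsilon_delta.
Variables (R : realType).

Lemma has_deriv_inP (p q : nat) (A : set R) (x : R -> 'M[R]_(p, q)) (t : R) v :
  has_deriv_in A x t v <->
  forall e : R, 0 < e -> exists2 eta : R, 0 < eta & forall s, A s -> `|s - t| < eta ->
    `|x s - x t - (s - t) *: v| <= e * `|s - t|.
Proof.
split.
- move=> /cvgrPdist_le H e e0.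
  have [eta /= eta0 {}H] := H e e0; exists eta => // s As st.
  have [->|sNt] := eqVneq s t; first by rewrite !subrr scale0r subr0 !normr0 mulr0.
  have := H s; rewrite /= distrC => /(_ st sNt As) H1.
  have st0 : s - t != 0 by rewrite subr_eq0.
  have -> : x s - x t - (s - t) *: v = - (s - t) *: (v - (s - t)^-1 *: (x s - x t)).
    by rewrite scalerBr scalerA mulNr mulfV // scaleN1r opprK scaleNr addrC.
  by rewrite normrZ normrN mulrC ler_wpM2r.
- move=> H; apply/cvgrPdist_le => e e0.
  have [eta eta0 {}H] := H e e0; exists eta => //= s /=; rewrite distrC => st sNt As.
  have {}H := H s As st.
  have st0 : s - t != 0 by rewrite subr_eq0.
  have -> : v - (s - t)^-1 *: (x s - x t) =
     - (s - t)^-1 *: (x s - x t - (s - t) *: v).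
    by rewrite [RHS]scalerBr scalerA mulNr mulVf // scaleN1r opprK scaleNr addrC.
  rewrite normrZ normrN normfV -ler_pdivlMl ?invr_gt0 ?normr_gt0 //.
  by rewrite invrK mulrC.
Qed.

Lemma within_continuousE (p q : nat) (A : set R) (x : R -> 'M[R]_(p, q)) :
  {within A, continuous x} <->
  forall t, A t -> forall e : R, 0 < e -> exists2 eta : R, 0 < eta & forall s, A s ->
    `|s - t| < eta -> `|x s - x t| < e.
Proof.
split.
- move=> /subspace_continuousP H t At e e0.
  have /cvgrPdist_lt /(_ e e0) [eta /= eta0 {}H] := H t At; exists eta => // s As st.
  by rewrite distrC; apply: H => //=; rewrite distrC.
- move=> H; apply/subspace_continuousP => t At; apply/cvgrPdist_lt => e e0.
  have [eta eta0 {}H] := H t At e e0; exists eta => //= s /=; rewrite distrC => st As.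
  by rewrite distrC; apply: H.
Qed.

Lemma tends_toP (n N : nat) (x : R -> 'M[R]_(N, n)) xoo :
  tends_to x xoo <->
  forall e : R, 0 < e -> exists2 T : R, 0 <= T & forall t, T <= t -> `|x t - xoo| < e.
Proof.
split.
- move=> /cvgrPdist_lt H e e0; have [M [_ {}H]] := H e e0.
  exists (Num.max 0 (M + 1)); first by rewrite le_max lexx.
  move=> t; rewrite ge_max => /andP[_ Mt]; rewrite distrC; apply: H.
  by apply: lt_le_trans Mt; rewrite ltrDl.
- move=> H; apply/cvgrPdist_lt => e e0; have [T T0 {}H] := H e e0.
  exists T; split; first exact: num_real.
  by move=> t /ltW /H; rewrite distrC.
Qed.

End epsilon_delta.

(** * The Euclidean norm *)

Section euclidean_norm.
Variables (R : realType) (p q : nat).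
Local Notation V := 'M[R]_(p, q).
Implicit Types u v : V.

Lemma enorm_ge0 v : 0 <= enorm v. Proof. exact: sqrtr_ge0. Qed.

Lemma pairingC u v : pairing u v = pairing v u.
Proof. by apply: eq_bigr => i _; apply: eq_bigr => j _; rewrite mulrC. Qed.

Lemma pairing_ge0 v : 0 <= pairing v v.
Proof. by apply: sumr_ge0 => i _; apply: sumr_ge0 => j _; rewrite -expr2 sqr_ge0. Qed.

Lemma enormE v : enorm v = Num.sqrt (pairing v v).
Proof.
congr Num.sqrt; apply: eq_bigr => i _; apply: eq_bigr => j _; exact: expr2.
Qed.

Lemma enorm_sqr v : enorm v ^+ 2 = pairing v v.
Proof. by rewrite enormE sqr_sqrtr // pairing_ge0. Qed.

Lemma pairingDl u v w : pairing (u + v) w = pairing u w + pairing v w.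
Proof. by rewrite pairingC pairingD !(pairingC w). Qed.

Lemma cauchy_schwarz u v : pairing u v <= enorm u * enorm v.
Proof.
have [v0|v0] := eqVneq (enorm v) 0.
  have H t : 0 <= pairing u u - t * pairing u v *+ 2.
    have := pairing_ge0 (u - t *: v).
    rewrite pairingB pairingZ 2!(pairingC (u - _)) !pairingB !pairingZ.
    by rewrite -(enorm_sqr v) v0 (pairingC v u) -mulr_natr; linear.
  rewrite v0 mulr0 leNgt; apply/negP => uv.
  have := H ((pairing u u + 1) / pairing u v); rewrite divfK ?gt_eqF //.
  have := pairing_ge0 u; rewrite -mulr_natr; linear.
have v1 : 0 < enorm v by rewrite lt_neqAle eq_sym v0 enorm_ge0.
have [u0|u0] := eqVneq (enorm u) 0.
  have H t : 0 <= pairing v v - t * pairing u v *+ 2.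
    have := pairing_ge0 (v - t *: u).
    rewrite pairingB pairingZ 2!(pairingC (v - _)) !pairingB !pairingZ.
    by rewrite -(enorm_sqr u) u0 (pairingC v u) -mulr_natr; linear.
  rewrite u0 mul0r leNgt; apply/negP => uv.
  have := H ((pairing v v + 1) / pairing u v); rewrite divfK ?gt_eqF //.
  have := pairing_ge0 v; rewrite -mulr_natr; linear.
have u1 : 0 < enorm u by rewrite lt_neqAle eq_sym u0 enorm_ge0.
have := pairing_ge0 (enorm v *: u - enorm u *: v).
rewrite pairingB !pairingZ 2!(pairingC (_ - _)) !pairingB !pairingZ.
rewrite -!enorm_sqr (pairingC v u) => H.
have uv0 : 0 < enorm u * enorm v by rewrite mulr_gt0.
rewrite -(ler_pM2l uv0); nonlinear.
Qed.

Lemma enormD u v : enorm (u + v) <= enorm u + enorm v.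
Proof.
rewrite -(@ler_pXn2r _ 2) ?nnegrE ?addr_ge0 ?enorm_ge0 //.
rewrite enorm_sqr pairingD !pairingDl (pairingC v u) -!enorm_sqr.
have := cauchy_schwarz u v; nonlinear.
Qed.

Lemma enormN v : enorm (- v) = enorm v.
Proof.
rewrite !enormE pairingNl pairingC pairingNl opprK //.
Qed.

Lemma enorm_dist u v : `|enorm u - enorm v| <= enorm (u - v).
Proof.
have := enormD (u - v) v; have := enormD (v - u) u; rewrite !subrK -(enormN (v - u)) opprB.
by move=> ? ?; rewrite ler_norml; linear.
Qed.

Lemma coord_le_enorm v i j : `|v i j| <= enorm v.
Proof.
rewrite -sqrtr_sqr; apply: ler_wsqrtr; rewrite (bigD1 i) //= (bigD1 j) //=.
rewrite -addrA lerDl addr_ge0 //.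
  by apply: sumr_ge0 => k _; rewrite sqr_ge0.
by apply: sumr_ge0 => k _; apply: sumr_ge0 => l _; rewrite sqr_ge0.
Qed.

Lemma norm_le_enorm v : `|v| <= enorm v.
Proof. by apply: norm_le_coord => *; [exact: enorm_ge0 | exact: coord_le_enorm]. Qed.

Lemma enorm_eq0 v : enorm v = 0 -> v = 0.
Proof.
move=> v0; apply/matrixP => i j; rewrite mxE; apply/eqP.
by rewrite -normr_le0 -v0 coord_le_enorm.
Qed.

Lemma enorm_le_norm v : enorm v <= (p * q)%:R * `|v|.
Proof.
rewrite -(@ler_pXn2r _ 2) ?nnegrE ?mulr_ge0 ?enorm_ge0 //.
rewrite enorm_sqr (le_trans (ler_norm _)) // (le_trans (pairing_le _ _)) //.
rewrite expr2 mulrA ler_wpM2r //.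
apply: (@le_trans _ _ (\sum_(i < p) \sum_(j < q) `|v|)).
  by apply: ler_sum => i _; apply: ler_sum => j _; exact: coord_le_norm.
rewrite !sumr_const !card_ord -mulrnA -[X in X <= _]mulr_natl mulnC.
have [->|] := posnP (p * q)%N; first by rewrite !mul0r.
move=> pq; rewrite -[leLHS]mulr1 ler_wpM2l ?mulr_ge0 //.
by rewrite ler1n.
Qed.

End euclidean_norm.

(** * The opinion field *)

Section opinion_field.
Variables (R : realType) (n N : nat) (phi : 'I_N -> 'I_N -> R -> R).
Hypothesis phiP : interaction phi.
Local Notation V := 'M[R]_(N, n).
Implicit Types x y w : V.

(** There are finitely many pairs, and a Lipschitz function on a segment is
    bounded. *)
Lemma interaction_bounds : exists2 L : R, 0 < L &
  forall i j (r : R), 0 <= r <= 1 -> 0 < phi i j r <= L /\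
    forall s : R, 0 <= s <= 1 -> `|phi i j r - phi i j s| <= L * `|r - s|.
Proof.
have H i j : exists L, 0 < L /\ forall r, 0 <= r <= 1 -> 0 < phi i j r <= L /\
    forall s : R, 0 <= s <= 1 -> `|phi i j r - phi i j s| <= L * `|r - s|.
  have [[M [_ lip]] pos _] := phiP i j.
  pose K := Num.max 0 M + 1.
  have K0 : 0 < K by rewrite ltr_wpDl // le_max lexx.
  have MK : M < K by rewrite (@le_lt_trans _ _ (Num.max 0 M)) ?le_max ?lexx ?orbT ?ltrDl.
  have lipK r s : 0 <= r <= 1 -> 0 <= s <= 1 -> `|phi i j r - phi i j s| <= K * `|r - s|.
    by move=> r01 s01; apply: (lip K MK (r, s)); split; rewrite /= in_itv.
  have p0 : 0 < phi i j 0 by apply: pos; rewrite in_itv /= lexx ler01.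
  exists (K + phi i j 0); split; first by rewrite addr_gt0.
  move=> r r01; split.
    rewrite pos ?in_itv //=.
    have := lipK r 0 r01; rewrite lexx ler01 => /(_ isT).
    move/(le_trans (ler_norm _)); rewrite subr0 ger0_norm; last by case/andP: r01.
    by case/andP: r01 => r0 r1; nonlinear.
  move=> s s01; apply: le_trans (lipK r s r01 s01) _.
  by rewrite ler_wpM2r // lerDl ltW.
have {H} /choice[L H] : forall ij : 'I_N * 'I_N, exists L, 0 < L /\
    forall r, 0 <= r <= 1 -> 0 < phi ij.1 ij.2 r <= L /\
    forall s, 0 <= s <= 1 -> `|phi ij.1 ij.2 r - phi ij.1 ij.2 s| <= L * `|r - s|.
  by move=> [i j]; exact: H.
have Lle ij : L ij <= 1 + \sum_ij L ij.
  rewrite (bigD1 ij) //= addrCA lerDl addr_ge0 // sumr_ge0 // => kl _.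
  by apply: ltW; have [] := H kl.
exists (1 + \sum_ij L ij).
  by rewrite ltr_pwDl // sumr_ge0 // => kl _; apply: ltW; have [] := H kl.
move=> i j r r01; have [_ /(_ r r01) [/andP[p0 pL] lip]] := H (i, j).
split; first by rewrite p0 (le_trans pL).
by move=> s s01; apply: le_trans (lip s s01) _; rewrite ler_wpM2r.
Qed.

Lemma row_distC x i j : enorm (row j x - row i x) = enorm (row i x - row j x).
Proof. by rewrite -enormN opprB. Qed.

Definition weight x (i j : 'I_N) : R :=
  cutoff (phi i j) (enorm (row i x - row j x)).

Lemma weightC x i j : weight x i j = weight x j i.
Proof.
rewrite /weight /cutoff row_distC; case: ifPn => // r1.
by have [_ _ ->] := phiP i j; rewrite // in_itv /= enorm_ge0 ltW.
Qed.

Lemma weight_ge0 x i j : 0 <= weight x i j.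
Proof.
rewrite /weight /cutoff; case: ifPn => // r1; apply: ltW.
by have [_ + _] := phiP i j; apply; rewrite // in_itv /= enorm_ge0 ltW.
Qed.

Lemma opinion_fieldE x i c :
  opinion_field phi x i c = \sum_j weight x i j * (x j c - x i c).
Proof. by rewrite !mxE summxE; apply: eq_bigr => j _; rewrite !mxE. Qed.

(** Exchange i and j in the double sum and average: as the weights are
    symmetric, only differences of rows of w remain.  With w constant over the
    agents it gives P1), with w the indicator of a set of agents the decay of the
    excesses, and with w the limit state the dissipation. *)
Lemma pairing_field w x : pairing w (opinion_field phi x) *+ 2 =
  \sum_i \sum_j weight x i j * pairing (row i w - row j w) (row j x - row i x).
Proof.
have -> : pairing w (opinion_field phi x) =
    \sum_i \sum_j weight x i j * pairing (row i w) (row j x - row i x).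
  apply: eq_bigr => i _.
  transitivity (\sum_c \sum_j weight x i j * (w i c * (x j c - x i c))).
    apply: eq_bigr => c _; rewrite opinion_fieldE mulr_sumr.
    by apply: eq_bigr => j _; rewrite mulrCA.
  rewrite exchange_big /=; apply: eq_bigr => j _; rewrite -mulr_sumr; congr (_ * _).
  by rewrite /pairing big_ord1; apply: eq_bigr => c _; rewrite !mxE.
rewrite mulr2n {2}exchange_big /= -big_split /=; apply: eq_bigr => i _.
rewrite -big_split /=; apply: eq_bigr => j _.
rewrite (weightC x j i) -mulrDr; congr (_ * _).
by rewrite pairingDl pairingNl -(opprB (row j x)) -[X in _ + pairing _ X]scaleN1r pairingZ mulN1r.
Qed.

(** Interacting agents are at distance less than 1, and the others have weight
    0. *)
Lemma weight_move_le L : (forall i j r, 0 <= r <= 1 -> 0 < phi i j r <= L) ->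
  forall x i j c, `|weight x i j * (x j c - x i c)| <= L.
Proof.
move=> HL x i j c; rewrite /weight /cutoff; case: ifPn => [r1|_]; last first.
  rewrite mul0r normr0; have /andP[h0 h1] : 0 < phi i j 0 <= L by apply: HL; rewrite lexx ler01.
  exact: le_trans (ltW h0) h1.
have r01 : 0 <= enorm (row i x - row j x) <= 1 by rewrite enorm_ge0 ltW.
have /andP[p0 pL] := HL i j _ r01; rewrite normrM gtr0_norm //.
rewrite -[leRHS]mulr1; apply: ler_pM => //; first exact: ltW.
rewrite -row_distC in r1; apply: le_trans (ltW r1).
by have := coord_le_enorm (row j x - row i x) 0 c; rewrite !mxE.
Qed.

Lemma opinion_field_bounded : exists2 C : R, 0 < C & forall x, `|opinion_field phi x| <= C.
Proof.
have [L L0 HL] := interaction_bounds.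
exists (N%:R * L + 1) => [|x]; first by rewrite ltr_wpDl // mulr_ge0 // ltW.
apply: norm_le_coord => [|i c]; first by rewrite addr_ge0 // mulr_ge0 // ltW.
rewrite opinion_fieldE (le_trans (ler_norm_sum _ _ _)) //.
apply: (@le_trans _ _ (\sum_(j < N) L)).
  by apply: ler_sum => j _; apply: weight_move_le => k l r r01; have [] := HL k l r r01.
by rewrite sumr_const card_ord -[X in X <= _]mulr_natl lerDl.
Qed.

End opinion_field.

(** * The mean value property *)

Section mean_value.
Variables (R : realType).

(** The only consequence of the equation that the asymptotic analysis uses.
    The bound on the field is asked on a neighbourhood of the trajectory, not
    only along it: this is what passes to closed convex hulls and to limits. *)
Definition mean_value_sol (p q : nat) (f : 'M[R]_(p, q) -> 'M[R]_(p, q))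
    (x : R -> 'M[R]_(p, q)) : Prop :=
  forall (w : 'M[R]_(p, q)) (s t M d : R), 0 <= s -> s <= t -> 0 < d ->
    (forall r y, s <= r -> r <= t -> `|y - x r| < d -> pairing w (f y) <= M) ->
    pairing w (x t) - pairing w (x s) <= M * (t - s).

Lemma mean_value_lipschitz p q (f : 'M[R]_(p, q) -> 'M[R]_(p, q)) x C :
  (forall y, `|f y| <= C) -> mean_value_sol f x ->
  forall s t, 0 <= s -> s <= t -> `|x t - x s| <= C * (t - s).
Proof.
move=> fC xP s t s0 st.
have C0 : 0 <= C by exact: le_trans (fC 0).
apply: norm_le_pairing => [|w wP]; first by rewrite mulr_ge0 // subr_ge0.
rewrite pairingB; apply: (xP _ _ _ _ 1) => // r y _ _ _.
by apply: le_trans (wP _) _.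
Qed.

End mean_value.

(** * Limits at infinity of real functions *)

Section real_asymptotics.
Variable R : realType.

Lemma nonincreasing_limit (h : R -> R) :
  (forall s t, 0 <= s -> s <= t -> h t <= h s) -> (forall t, 0 <= t -> 0 <= h t) ->
  exists l, forall e, 0 < e -> exists2 T, 0 <= T & forall t, T <= t -> `|h t - l| < e.
Proof.
move=> dec pos.
pose S := [set h t | t in [set t | 0 <= t]].
have hS : has_inf S by split; [exists (h 0), 0; rewrite //= | exists 0 => _ [t /= t0 <-]; exact: pos].
exists (inf S) => e e0; have [_ [T /= T0 <-] hT] := inf_adherent e0 hS.
exists T => // t Tt.
have H1 : inf S <= h t by apply: ge_inf; [case: hS | exists t => //=; exact: le_trans Tt].
have H2 := dec _ _ T0 Tt.
by rewrite ltr_norml; linear.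
Qed.

Lemma eventually_forall (I : finType) (P : I -> R -> Prop) :
  (forall k, exists2 T, 0 <= T & forall t, T <= t -> P k t) ->
  exists2 T, 0 <= T & forall t, T <= t -> forall k, P k t.
Proof.
move=> H.
have /choice[T HT] : forall k, exists T, 0 <= T /\ forall t, T <= t -> P k t.
  by move=> k; have [T T0 HT] := H k; exists T.
have T0 k : 0 <= T k by have [] := HT k.
exists (\sum_k T k) => [|t Tt k]; first by rewrite sumr_ge0.
have [_] := HT k; apply; apply: le_trans Tt.
by rewrite (bigD1 k) //= lerDl sumr_ge0.
Qed.

(** The limit is the supremum of the numbers that stay eventually below g: if
    g exceeded it infinitely often by e, it would oscillate across the upper half
    of that gap. *)
Lemma limit_of_no_oscillation (g : R -> R) B :
  (forall t, 0 <= t -> `|g t| <= B) ->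
  (forall a b, a < b -> ~ ((forall T, exists2 t, T <= t & g t <= a) /\
                          (forall T, exists2 t, T <= t & b <= g t))) ->
  exists l, forall e, 0 < e -> exists2 T, 0 <= T & forall t, T <= t -> `|g t - l| < e.
Proof.
move=> gB osc.
pose S := [set a | exists2 T, 0 <= T & forall t, T <= t -> a <= g t].
have SB a : S a -> a <= B.
  by move=> [T T0 H]; apply: le_trans (H T (lexx _)) _; apply: le_trans (ler_norm _) (gB _ T0).
have hS : has_sup S.
  split; last by exists B => a; exact: SB.
  by exists (- B), 0 => // t t0; have := gB t t0; rewrite ler_norml => /andP[].
exists (sup S) => e e0.
have [a [T1 T10 H1] aS] := sup_adherent e0 hS.
have [T2 H2] : exists T, forall t, T <= t -> g t < sup S + e.
  apply: contrapT => nH; apply: (osc (sup S + e / 2) (sup S + e)); first by linear.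
  split=> T.
    apply: contrapT => nT.
    have : S (sup S + e / 2).
      exists (Num.max 0 T) => [|t]; first by rewrite le_max lexx.
      rewrite ge_max => /andP[_ Tt]; rewrite leNgt; apply/negP => gt.
      by apply: nT; exists t => //; exact: ltW.
    by move=> /(sup_upper_bound hS); linear.
  apply: contrapT => nT; apply: nH; exists T => t Tt; rewrite ltNge; apply/negP => gt.
  by apply: nT; exists t.
exists (Num.max T1 T2) => [|t]; first by rewrite le_max T10.
rewrite ge_max => /andP[/H1 h1 /H2 h2].
by rewrite ltr_norml; linear.
Qed.

Lemma intermediate_value (g : R -> R) C s t c : 0 <= s -> s <= t ->
  (forall u v, 0 <= u -> u <= v -> `|g v - g u| <= C * (v - u)) ->
  g s <= c <= g t \/ g t <= c <= g s -> exists2 r, s <= r <= t & g r = c.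
Proof.
move=> s0 st lip gc.
have [] : exists2 r, r \in `[s, t] & g r = c; last by move=> r; rewrite in_itv /=; exists r.
apply: (@IVT _ g s t c st); last first.
  by rewrite ge_min le_max; case: gc => /andP[-> ->]; rewrite ?orbT.
apply/subspace_continuousP => u /=; rewrite in_itv /= => /andP[su ut].
apply/cvgrPdist_lt => e e0.
have C1 : 0 < `|C| + 1 by rewrite ltr_wpDl.
exists (e / (`|C| + 1)) => /=; first by rewrite divr_gt0.
move=> v /= uv; rewrite in_itv /= => /andP[sv vt].
have lip' a b : 0 <= a -> 0 <= b -> `|g a - g b| <= (`|C| + 1) * `|a - b|.
  move=> a0 b0; wlog ab : a b a0 b0 / b <= a.
    by move=> W; have [/W|/ltW /W] := leP b a; [exact | rewrite distrC (distrC b); exact].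
  apply: le_trans (lip _ _ b0 ab) _; rewrite (ger0_norm (_ : 0 <= a - b)) ?subr_ge0 //.
  by rewrite ler_wpM2r ?subr_ge0 // (le_trans (ler_norm _)) // lerDl.
apply: le_lt_trans (lip' _ _ _ _) _; [exact: le_trans su | exact: le_trans sv|].
by rewrite mulrC -ltr_pdivlMr.
Qed.

End real_asymptotics.

(** * Invariant sums and decreasing excesses *)

Section consensus.
Variables (R : realType) (n N : nat) (phi : 'I_N -> 'I_N -> R -> R).
Hypothesis phiP : interaction phi.
Local Notation V := 'M[R]_(N, n).
Variable x : R -> V.
Hypothesis xP : mean_value_sol (opinion_field phi) x.

Definition column_mask (A : {set 'I_N}) (c : 'I_n) : V :=
  \matrix_(i, k) ((i \in A) && (k == c))%:R.

Lemma pairing_column_mask A c v : pairing (column_mask A c) v = \sum_(i in A) v i c.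
Proof.
rewrite /pairing [RHS]big_mkcond /=; apply: eq_bigr => i _.
rewrite (bigD1 c) //= !mxE eqxx andbT big1 => [|k /negPf kc]; last by rewrite mxE kc andbF mul0r.
by rewrite addr0; case: (i \in A); rewrite ?mul1r ?mul0r.
Qed.

Lemma pairing_field_mask A c y :
  pairing (column_mask A c) (opinion_field phi y) *+ 2 =
  \sum_i \sum_j weight phi y i j * (((i \in A)%:R - (j \in A)%:R) * (y j c - y i c)).
Proof.
rewrite (pairing_field phiP); apply: eq_bigr => i _; apply: eq_bigr => j _.
congr (_ * _); rewrite /pairing big_ord1 (bigD1 c) //= !mxE eqxx !andbT.
rewrite big1 ?addr0 // => k /negPf kc; by rewrite !mxE kc !andbF subrr mul0r.
Qed.

(** The rows of the mask of all agents are equal, so the functional vanishes on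
    the field; both it and its opposite have slope at most 0. *)
Lemma column_sum_invariant c t : 0 <= t -> \sum_i x t i c = \sum_i x 0 i c.
Proof.
move=> t0.
have F0 y : pairing (column_mask [set: 'I_N] c) (opinion_field phi y) = 0.
  have : pairing (column_mask [set: 'I_N] c) (opinion_field phi y) *+ 2 = 0.
    rewrite pairing_field_mask big1 // => i _; rewrite big1 // => j _.
    by rewrite !inE subrr mul0r mulr0.
  by move/eqP; rewrite mulrn_eq0 => /eqP.
have E v : pairing (column_mask [set: 'I_N] c) v = \sum_i v i c.
  by rewrite pairing_column_mask; apply: eq_bigl => i; rewrite inE.
have le1 : \sum_i x t i c - \sum_i x 0 i c <= 0 * (t - 0).
  rewrite -!E; by apply: (@xP _ 0 t 0 1) => // r y _ _ _; rewrite F0.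
have le2 : - \sum_i x t i c - - \sum_i x 0 i c <= 0 * (t - 0).
  rewrite -!E -(pairingNl _ (x t)) -(pairingNl _ (x 0)); apply: (@xP _ 0 t 0 1) => // r y _ _ _.
  by rewrite pairingNl F0 oppr0.
linear.
Qed.

Lemma mean_value_P1 : P1 x.
Proof.
move=> t t0; congr (_ *: _); apply/rowP => c; rewrite !summxE.
under eq_bigr do rewrite mxE; under [RHS]eq_bigr do rewrite mxE.
exact: column_sum_invariant.
Qed.

(** A Lyapunov function for each level h.  Positive parts are chosen because
    their second differences in h are localised near h. *)
Definition excess (c : 'I_n) (h : R) (y : V) : R := \sum_i Num.max 0 (y i c - h).

Lemma excess_ge0 c h y : 0 <= excess c h y.
Proof. by apply: sumr_ge0 => i _; rewrite le_max lexx. Qed.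

(** Over a short interval [a, b], the increase of the excess is at most that
    of the linear functional which sums over the set A of agents above h at time
    b.  During the interval an agent of A is not below h - k, and an agent outside
    A is not above h + k, so that each pair contributes little to the growth of
    this functional. *)
Lemma excess_nonincreasing c h (s t : R) : 0 <= s -> s <= t ->
  excess c h (x t) <= excess c h (x s).
Proof.
move=> s0 st.
have [L L0 HL] := interaction_bounds phiP.
have HL' i j r : 0 <= r <= 1 -> phi i j r <= L.
  by move=> r01; have [/andP[_]] := HL i j r r01.
have [C C0 fC] := opinion_field_bounded n phiP.
have lip := mean_value_lipschitz fC xP.
have W_le y i j : weight phi y i j <= L.
  rewrite /weight /cutoff; case: ifPn => r1; last exact: ltW.
  by apply: HL'; rewrite enorm_ge0 ltW.
apply/ler_addgt0Pr => e e0; rewrite -lerBlDl.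
pose e' := e / (t - s + 1).
have ts1 : 0 < t - s + 1 by linear.
have e'0 : 0 < e' by rewrite divr_gt0.
suff H : excess c h (x t) - excess c h (x s) <= e' * t - e' * s.
  apply: le_trans H _; rewrite -mulrBr /e' mulrAC ler_pdivrMr //.
  by rewrite ler_wpM2l ?ltW //; linear.
pose D := (N * N)%:R * L + 1.
have D0 : 0 < D by rewrite ltr_wpDl // mulr_ge0 // ltW.
pose k := e' / D.
have k0 : 0 < k by rewrite divr_gt0.
have Dk : D * k = e' by rewrite mulrC divfK // gt_eqF.
apply: (creep (g := fun r => excess c h (x r)) (W := fun r => e' * r) st) => r sr rt.
exists (k / 2 / C) => [|a b sa ar rb bt ab /=]; first by rewrite !divr_gt0.
have ab' : a <= b by exact: le_trans rb.
have a0 : 0 <= a by exact: le_trans sa.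
pose A := [set i | h <= x b i c]%SET.
have eb : excess c h (x b) = \sum_(i in A) (x b i c - h).
  rewrite [RHS]big_mkcond; apply: eq_bigr => i _; rewrite inE.
  by case: ifPn => [hi|]; [rewrite max_r // subr_ge0 | rewrite -ltNge => hi; rewrite max_l // subr_le0 ltW].
have ea : \sum_(i in A) (x a i c - h) <= excess c h (x a).
  rewrite big_mkcond; apply: ler_sum => i _; case: ifP => _; rewrite le_max ?lexx ?orbT //.
apply: le_trans (_ : \sum_(i in A) x b i c - \sum_(i in A) x a i c <= _).
  by rewrite eb; apply: le_trans (lerB (lexx _) ea) _; rewrite -!sumrB ler_sum // => i _; linear.
rewrite -!pairing_column_mask -mulrBr.
apply: (@xP _ a b e' (k / 2)) => //; first by rewrite divr_gt0.
move=> u y au ub yu.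
have yb i : `|y i c - x b i c| <= k.
  have -> : y i c - x b i c = (y - x u) i c - (x b - x u) i c by rewrite !mxE; linear.
  apply: le_trans (ler_normB _ _) _.
  have u0 : 0 <= u by exact: le_trans au.
  have := lip _ _ u0 ub; have := coord_le_norm (x b - x u) i c; have := coord_le_norm (y - x u) i c.
  have : C * (b - a) < k / 2 by rewrite mulrC -ltr_pdivlMr.
  have : C * (b - u) <= C * (b - a) by rewrite ler_pM2l //; linear.
  by move: yu; linear.
have k20 : 0 <= k *+ 2 by rewrite mulrn_wge0 // ltW.
have : pairing (column_mask A c) (opinion_field phi y) *+ 2 <= e' *+ 2.
  rewrite pairing_field_mask.
  apply: (@le_trans _ _ (\sum_(i < N) \sum_(j < N) L * (k *+ 2))); last first.
    rewrite !sumr_const !card_ord -mulrnA -[X in X <= _]mulr_natl.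
    rewrite !mulr2n -Dk /D -subr_ge0.
    have -> : forall m l z : R, (m * l + 1) * z + (m * l + 1) * z - m * (l * (z + z)) = z + z by move=> *; ring.
    by rewrite addr_ge0 // ltW.
  apply: ler_sum => i _; apply: ler_sum => j _.
  apply: (@le_trans _ _ (weight phi y i j * (k *+ 2))); last by rewrite ler_wpM2r.
  rewrite ler_wpM2l ?weight_ge0 // !inE.
  have := yb i; have := yb j; rewrite !ler_norml => /andP[j1 j2] /andP[i1 i2].
  case: (leP h (x b i c)) => hi; case: (leP h (x b j c)) => hj;  rewrite /= ?subrr ?mul0r // ?subr0 ?sub0r ?mul1r ?mulN1r; rewrite mulr2n; linear.
by rewrite lerMn2r.
Qed.

End consensus.

(** * Convergence of the opinions *)

Section clustering.
Variables (R : realType) (n N : nat) (phi : 'I_N -> 'I_N -> R -> R).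
Hypothesis phiP : interaction phi.
Local Notation V := 'M[R]_(N, n).
Variable x : R -> V.
Hypothesis xP : mean_value_sol (opinion_field phi) x.

Lemma coord_lipschitz : exists2 C : R, 0 < C & forall i c s t, 0 <= s -> s <= t ->
  `|x t i c - x s i c| <= C * (t - s).
Proof.
have [C C0 fC] := opinion_field_bounded n phiP; exists C => // i c s t s0 st.
apply: le_trans (mean_value_lipschitz fC xP s0 st).
by have := coord_le_norm (x t - x s) i c; rewrite !mxE.
Qed.

(** No opinion exceeds the initial excess above 0; with the constant sum this
    bounds the opinions from below. *)
Lemma coord_bounded i c : exists B, forall t, 0 <= t -> `|x t i c| <= B.
Proof.
pose B := excess c 0 (x 0); pose S := \sum_j x 0 j c.
have up j t : 0 <= t -> x t j c <= B.
  move=> t0; apply: le_trans (excess_nonincreasing phiP xP c 0 (lexx 0) t0).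
  rewrite /excess (bigD1 j) //= subr0.
  apply: (@le_trans _ _ (Num.max 0 (x t j c))); first by rewrite le_max lexx orbT.
  by rewrite lerDl sumr_ge0 // => k _; rewrite le_max lexx.
exists (`|S| + N.+1%:R * B) => t t0.
have B0 : 0 <= B := excess_ge0 _ _ _.
have low : S - N%:R * B <= x t i c.
  have := column_sum_invariant phiP xP c t0; rewrite -/S (bigD1 i) //= => <-.
  rewrite lerBlDl addrC lerD2r.
  apply: (@le_trans _ _ (\sum_(j < N | j != i) B)); first by apply: ler_sum => j _; exact: up.
  rewrite sumr_const -[leLHS]mulr_natl ler_wpM2r // ler_nat.
  by rewrite (leq_trans (max_card _)) // card_ord.
have := up i t t0; have := ler_norm (- S); have := ler_norm S; rewrite normrN.
rewrite -natr1 ler_norml mulrDl mul1r => ? ? ?.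
have : 0 <= N%:R * B by rewrite mulr_ge0.
by move=> ?; linear.
Qed.

(** The second difference in h of a positive part is a tent centred at h. *)
Lemma tent_of_excess c (h e : R) (y : V) : 0 < e ->
  excess c (h - e) y - excess c h y *+ 2 + excess c (h + e) y =
  \sum_i Num.max 0 (e - `|y i c - h|).
Proof.
move=> e0; rewrite /excess -sumrMnl -sumrB -big_split /=; apply: eq_bigr => i _.
rewrite mulr2n; set z := y i c.
case: (lerP (z - (h - e)) 0) => h1; case: (lerP (z - h) 0) => h2;
  case: (lerP (z - (h + e)) 0) => h3; try linear;
  case: (lerP (e - `|z - h|) 0) => h4; move: h4;
  first [rewrite (ler0_norm h2) | rewrite (gtr0_norm h2)]; move=> h4; linear.
Qed.

(** A coordinate that oscillates between a and b crosses N + 1 levels h k with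
    disjoint e-neighbourhoods, each at arbitrarily late times.  The tents around a
    level sum to at least e when it is crossed, and vary by less than e after time
    T; so at time T every level has an agent in its neighbourhood, which is too
    many agents. *)
Lemma coord_converges i c : exists l, forall e : R, 0 < e ->
  exists2 T, 0 <= T & forall t, T <= t -> `|x t i c - l| < e.
Proof.
have [B xB] := coord_bounded i c; apply: (limit_of_no_oscillation xB).
move=> a b ab [lo hi].
have [C C0 lip] := coord_lipschitz.
pose K := N.+1.
pose e := (b - a) / (2 * K)%:R.
have K0 : (0 : R) < (2 * K)%:R by rewrite ltr0n.
have e0 : 0 < e by rewrite divr_gt0 // subr_gt0.
have eK : e * (2 * K)%:R = b - a by rewrite /e divfK // gt_eqF.
pose h (k : 'I_K) := a + (2 * k + 1)%:R * e.
have hab k : a < h k < b.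
  rewrite /h ltrDl mulr_gt0 ?ltr0n ?addn1 //= -ltrBrDl -eK mulrC ltr_pM2l // ltr_nat.
  have := ltn_ord k; rewrite -(leq_pmul2l (_ : 0 < 2)%N) //.
  by rewrite mulnS.
have visit k T : exists2 t, T <= t /\ 0 <= t & x t i c = h k.
  have [t1] := lo (Num.max 0 T); rewrite ge_max => /andP[t10 Tt1] la.
  have [t2] := hi t1 => t12 hb.
  have /andP[ah hb'] := hab k.
  have [|t /andP[t1t _] <-] := intermediate_value (g := fun t => x t i c) (c := h k) t10 t12 (lip i c).
    by left; apply/andP; split; [exact: le_trans la (ltW ah) | exact: le_trans (ltW hb') hb].
  by exists t => //; split; apply: le_trans t1t.
(* The three levels of the tent around h k. *)
pose lev (kb : 'I_K * 'I_3) := h kb.1 + (kb.2%:R - 1) * e.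
have /choice[l lP] : forall kb, exists l, exists2 T, 0 <= T &
    forall t, T <= t -> `|excess c (lev kb) (x t) - l| < e / 8.
  move=> kb.
  have [l H] := nonincreasing_limit (fun s t => excess_nonincreasing phiP xP c (lev kb) (s := s) (t := t))
     (fun t _ => excess_ge0 c (lev kb) (x t)).
  by exists l; apply: H; rewrite divr_gt0.
have [T T0 HT] := eventually_forall lP.
pose tent k t := \sum_j Num.max 0 (e - `|x t j c - h k|).
have tent_stable k t : T <= t -> tent k t < tent k T + e.
  move=> Tt; rewrite /tent -!tent_of_excess //.
  have E0 : h k - e = lev (k, inord 0) by rewrite /lev /= inordK // sub0r mulN1r.
  have E1 : h k = lev (k, inord 1) by rewrite /lev /= inordK // subrr mul0r addr0.
  have E2 : h k + e = lev (k, inord 2) by rewrite /lev /= inordK //; linear.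
  rewrite E0 E2 E1.
  have := HT t Tt (k, inord 0); have := HT t Tt (k, inord 1); have := HT t Tt (k, inord 2).
  have := HT T (lexx _) (k, inord 0); have := HT T (lexx _) (k, inord 1); have := HT T (lexx _) (k, inord 2).
  rewrite !ltr_norml !mulr2n; linear.
have tent_pos k : 0 < tent k T.
  have [t [Tt _] xh] := visit k T.
  have := tent_stable k t Tt; suff : e <= tent k t by linear.
  rewrite /tent (bigD1 i) //= xh subrr normr0 subr0 (max_r (ltW e0)) lerDl.
  by apply: sumr_ge0 => j _; rewrite le_max lexx.
have /choice[f fP] : forall k, exists j, `|x T j c - h k| < e.
  move=> k; apply: contrapT => nj; have := tent_pos k; rewrite /tent big1 ?ltxx // => j _.
  rewrite max_l // subr_le0 leNgt; apply/negP => hj; apply: nj; by exists j.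
have finj : injective f.
  move=> k k' ff; have := fP k; have := fP k'; rewrite -ff => h1 h2.
  apply/val_inj/eqP; rewrite eqn_leq; apply/andP; split; rewrite leqNgt; apply/negP => kk.
    have : h k' + 2 * e <= h k.
      rewrite /h -addrA lerD2l -mulrDl ler_pM2r // -natrD ler_nat.
      by rewrite addnAC leq_add2r addnC -mulnS leq_pmul2l.
    by move: h1 h2; rewrite !ltr_norml; linear.
  have : h k + 2 * e <= h k'.
    rewrite /h -addrA lerD2l -mulrDl ler_pM2r // -natrD ler_nat.
    by rewrite addnAC leq_add2r addnC -mulnS leq_pmul2l.
  by move: h1 h2; rewrite !ltr_norml; linear.
by have := leq_card f finj; rewrite !card_ord ltnn.
Qed.

End clustering.

(** * Separation of the limit opinions *)

Section clustered_limit.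
Variables (R : realType) (n N : nat) (phi : 'I_N -> 'I_N -> R -> R).
Hypothesis phiP : interaction phi.
Local Notation V := 'M[R]_(N, n).
Variable x : R -> V.
Hypothesis xP : mean_value_sol (opinion_field phi) x.

Lemma opinions_converge : exists xoo, tends_to x xoo.
Proof.
have /choice[l lP] : forall ic : 'I_N * 'I_n, exists l, forall e : R, 0 < e ->
  exists2 T, 0 <= T & forall t, T <= t -> `|x t ic.1 ic.2 - l| < e.
  by move=> [i c] /=; exact: (coord_converges phiP xP i c).
exists (\matrix_(i, c) l (i, c)); apply/tends_toP => e e0.
have [T T0 HT] := eventually_forall (fun ic => lP ic (e / 2) (divr_gt0 e0 (ltr0n _ 2))).
exists T => // t Tt; apply: (@le_lt_trans _ _ (e / 2)); last by linear.
apply: norm_le_coord => [|i c]; first by linear.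
by rewrite !mxE; apply: ltW; exact: HT t Tt (i, c).
Qed.

Lemma pairing_continuous (p q : nat) (w y : 'M[R]_(p, q)) e : 0 < e ->
  \forall z \near y, `|pairing w z - pairing w y| < e.
Proof.
move=> e0; have m0 : 0 < mass w + 1 by rewrite ltr_wpDl // mass_ge0.
apply/nbhs_normP; exists (e / (mass w + 1)) => /=; first by rewrite divr_gt0.
move=> z /=; rewrite distrC -pairingB => yz; apply: le_lt_trans (pairing_le _ _) _.
apply: (@le_lt_trans _ _ ((mass w + 1) * `|z - y|)).
  by rewrite ler_wpM2r // lerDl.
by rewrite mulrC -ltr_pdivlMr.
Qed.

Lemma row_diff_le i j (y z : V) :
  `|row i z - row j z - (row i y - row j y)| <= 2 * `|z - y|.
Proof.
apply: norm_le_coord => [|k c]; first by rewrite mulr_ge0.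
rewrite !mxE.
have := coord_le_norm (z - y) i c; have := coord_le_norm (z - y) j c; rewrite !mxE.
have -> : z i c - z j c - (y i c - y j c) = (z i c - y i c) - (z j c - y j c) by ring.
by have := ler_normB (z i c - y i c) (z j c - y j c); linear.
Qed.

Lemma row_enorm_continuous i j (y : V) (e : R) : 0 < e ->
  \forall z \near y, `|enorm (row i z - row j z) - enorm (row i y - row j y)| < e.
Proof.
move=> e0; pose K : R := (1 * n)%:R * 2 + 1.
have K0 : 0 < K by rewrite ltr_wpDl // mulr_ge0.
apply/nbhs_normP; exists (e / K) => /=; first by rewrite divr_gt0.
move=> z /=; rewrite distrC ltr_pdivlMr // => yz.
apply: le_lt_trans (enorm_dist _ _) _; apply: le_lt_trans (enorm_le_norm _) _.
apply: le_lt_trans yz; have := row_diff_le i j y z.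
have : (0 : R) <= (1 * n)%:R by [].
have := normr_ge0 (z - y); rewrite /K; nonlinear.
Qed.

Lemma row_pairing_continuous (u : 'rV[R]_n) k l (y : V) (e : R) : 0 < e ->
  \forall z \near y,
    `|pairing u (row k z - row l z) - pairing u (row k y - row l y)| < e.
Proof.
move=> e0; have m0 := mass_ge0 u; pose K := 2 * mass u + 1.
have K0 : 0 < K by rewrite ltr_wpDl // mulr_ge0.
apply/nbhs_normP; exists (e / K) => /=; first by rewrite divr_gt0.
move=> z /=; rewrite distrC ltr_pdivlMr // => yz; apply: le_lt_trans yz.
rewrite -pairingB; apply: le_trans (pairing_le _ _) _.
have := row_diff_le k l y z; have := normr_ge0 (z - y); rewrite /K; nonlinear.
Qed.

(** In the symmetrised scalar product of xoo and the field, each pair (k, l)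
    contributes minus a weight times the scalar product of the differences x_k -
    x_l in xoo and in y.  The latter is 0 for pairs that coincide in xoo and, close
    to xoo, positive for the others.  The pair (i, j) also has a weight that stays
    away from 0. *)
Lemma dissipation_near (xoo : V) i j : row i xoo <> row j xoo ->
  enorm (row i xoo - row j xoo) < 1 ->
  exists2 c, 0 < c & \forall y \near xoo, pairing xoo (opinion_field phi y) <= - c.
Proof.
move=> ij r1; set r := enorm _ in r1.
have r0 : 0 < r.
  rewrite lt_neqAle enorm_ge0 andbT; apply/eqP => /esym/enorm_eq0/eqP.
  by rewrite subr_eq0 => /eqP.
have [L L0 HL] := interaction_bounds phiP.
have r01 : 0 <= r <= 1 by rewrite !ltW.
have [/andP[p0 _] lip] := HL i j r r01.
pose p := phi i j r; rewrite -/p in p0.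
pose g k l (y : V) := pairing (row k xoo - row l xoo) (row k y - row l y).
have gE k l : g k l xoo = enorm (row k xoo - row l xoo) ^+ 2 by rewrite enorm_sqr.
have g_near k l (e : R) : 0 < e -> \forall y \near xoo, `|g k l y - g k l xoo| < e.
  by move=> e0; exact: row_pairing_continuous.
exists (p / 2 * (r ^+ 2 / 2) / 2); first by rewrite !(divr_gt0, mulr_gt0, exprn_gt0).
have e1 : 0 < Num.min (1 - r) (p / (2 * L)).
  by rewrite lt_min subr_gt0 r1 divr_gt0 ?mulr_gt0.
have e2 : 0 < r ^+ 2 / 2 by rewrite divr_gt0 ?exprn_gt0.
have gpos : \forall y \near xoo, forall kl : 'I_N * 'I_N, 0 <= g kl.1 kl.2 y.
  apply: (@filter_forall _ _ (fun kl y => 0 <= g kl.1 kl.2 y) _ (nbhs_filter xoo)) => -[k l] /=.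
  have [kl|kl] := eqVneq (row k xoo) (row l xoo).
    by near=> y; rewrite /g kl subrr /pairing big_ord1 big1 // => c _; rewrite mxE mul0r.
  have g0 : 0 < g k l xoo.
    rewrite gE exprn_gt0 // lt_neqAle enorm_ge0 andbT; apply/eqP => /esym/enorm_eq0/eqP.
    by rewrite subr_eq0; exact/negP.
  near=> y; have : `|g k l y - g k l xoo| < g k l xoo by near: y; exact: g_near.
  by rewrite ltr_norml; linear.
near=> y.
have gy k l : 0 <= g k l y.
  suff H : forall kl : 'I_N * 'I_N, 0 <= g kl.1 kl.2 y by exact: H (k, l).
  by near: y.
have gij : r ^+ 2 / 2 <= g i j y.
  have : `|g i j y - g i j xoo| < r ^+ 2 / 2 by near: y; exact: g_near.
  by rewrite gE -/r ltr_norml; linear.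
have wij : p / 2 <= weight phi y i j.
  have : `|enorm (row i y - row j y) - r| < Num.min (1 - r) (p / (2 * L)).
    by near: y; exact: row_enorm_continuous.
  rewrite lt_min => /andP[h1 h2].
  have s1 : enorm (row i y - row j y) < 1 by move: h1; rewrite ltr_norml; linear.
  rewrite /weight /cutoff s1.
  have := lip (enorm (row i y - row j y)); rewrite enorm_ge0 (ltW s1) => /(_ isT).
  have : L * `|enorm (row i y - row j y) - r| < p / 2.
    rewrite mulrC -ltr_pdivlMr // -mulrA -invfM //.
  by rewrite distrC -/p => h3 h4; have := le_lt_trans h4 h3; rewrite ltr_norml; linear.
have := pairing_field phiP xoo y.
have -> : \sum_k \sum_l weight phi y k l * pairing (row k xoo - row l xoo) (row l y - row k y)
  = - \sum_k \sum_l weight phi y k l * g k l y.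
  rewrite -sumrN; apply: eq_bigr => k _; rewrite -sumrN; apply: eq_bigr => l _.
  by rewrite -(opprB (row k y)) pairingNr mulrN.
have : p / 2 * (r ^+ 2 / 2) <= \sum_k \sum_l weight phi y k l * g k l y.
  rewrite (bigD1 i) //= (bigD1 j) //= -addrA.
  apply: (@le_trans _ _ (weight phi y i j * g i j y)).
    by apply: ler_pM => //; apply: ltW; rewrite // divr_gt0.
  rewrite lerDl addr_ge0 //.
    by apply: sumr_ge0 => l _; rewrite mulr_ge0 // weight_ge0.
  by apply: sumr_ge0 => k _; apply: sumr_ge0 => l _; rewrite mulr_ge0 // weight_ge0.
rewrite (mulr2n (pairing _ _)); linear.
Unshelve. all: by end_near. Qed.

(** Otherwise the scalar product with the limit would decrease at a fixed rate
    for ever, although the trajectory converges. *)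
Lemma mean_value_P2 : P2 x.
Proof.
have [xoo xlim] := opinions_converge; exists xoo => // i j.
have [->|ij] := eqVneq (row i xoo) (row j xoo); first by left.
right; rewrite leNgt; apply/negP => r1.
have [c c0 /nbhs_normP[d /= d0 Hd]] := dissipation_near (elimN eqP ij) r1.
have [T T0 HT] := (tends_toP _ _).1 xlim (d / 2) (divr_gt0 d0 (ltr0n _ 2)).
pose t := T + (mass xoo * d + 1) / c.
have m0 := mass_ge0 xoo.
have Tt : T <= t by rewrite lerDl divr_ge0 ?ltW // ltr_wpDl // mulr_ge0 // ltW.
have d20 : 0 < d / 2 by rewrite divr_gt0.
have : pairing xoo (x t) - pairing xoo (x T) <= - c * (t - T).
  apply: (@xP _ T t (- c) (d / 2)) => // r y Tr rt yr; apply: Hd => /=.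
  have := HT r Tr; have := ler_normD (y - x r) (x r - xoo).
  by rewrite addrA subrK distrC; linear.
rewrite {2}/t addrAC subrr add0r mulNr mulrC divfK ?gt_eqF // -pairingB.
have := pairing_le xoo (x t - x T); rewrite ler_norml => /andP[h1 _] h2.
have h3 : `|x t - x T| <= d.
  have := HT t Tt; have := HT T (lexx _); have := ler_normB (x t - xoo) (x T - xoo).
  have -> : x t - xoo - (x T - xoo) = x t - x T by rewrite opprB addrA subrK.
  linear.
have : mass xoo * `|x t - x T| <= mass xoo * d by rewrite ler_wpM2l.
linear.
Qed.

End clustered_limit.

(** * Growth of absolutely continuous curves *)

Section growth.
Variables (R : realType) (p q : nat).
Local Notation V := 'M[R]_(p, q).
Local Notation mu := (@lebesgue_measure R).

(** The derivative at r controls the intervals that contain r, not only those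
    that start at r. *)
Lemma deriv_growth (A : set R) (x : R -> V) r v (w : V) M :
  has_deriv_in A x r v -> pairing w v <= M ->
  forall e : R, 0 < e -> exists2 eta : R, 0 < eta & forall a b, A a -> A b ->
    a <= r -> r <= b -> b - a < eta ->
    pairing w (x b) - pairing w (x a) <= (M + e) * (b - a).
Proof.
move=> /has_deriv_inP xr wM e e0.
have m0 := mass_ge0 w; have m1 : 0 < mass w + 1 by linear.
have [eta eta0 H] := xr (e / (mass w + 1)) (divr_gt0 e0 m1).
exists eta => // a b Aa Ab ar rb ba.
have aux c : A c -> `|c - r| < eta ->
    `|pairing w (x c) - pairing w (x r) - (c - r) * pairing w v| <= e * `|c - r|.
  move=> Ac cr; rewrite -pairingZ -!pairingB; apply: le_trans (pairing_le _ _) _.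
  apply: (@le_trans _ _ ((mass w + 1) * (e / (mass w + 1) * `|c - r|))).
    apply: ler_pM => //; first by rewrite lerDl.
    exact: H.
  by rewrite mulrA [_ * (e / _)]mulrC divfK ?gt_eqF.
have := aux b Ab; have := aux a Aa.
rewrite (ger0_norm (_ : 0 <= b - r)) ?subr_ge0 // (ler0_norm (_ : a - r <= 0)) ?subr_le0 //.
have la : - (a - r) < eta by linear.
have lb : b - r < eta by linear.
move=> /(_ la) + /(_ lb); rewrite !ler_norml => /andP[h1 _] /andP[_ h2].
have h3 : (b - r) * pairing w v <= (b - r) * M by rewrite ler_wpM2l // subr_ge0.
have h4 : (r - a) * pairing w v <= (r - a) * M by rewrite ler_wpM2l // subr_ge0.
nonlinear.
Qed.

Definition nonoverlapping (l : seq (R * R)) : bool :=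
  pairwise (fun I J => I.2 <= J.1) l.

Definition total_length (l : seq (R * R)) : R := \sum_(I <- l) (I.2 - I.1).

(** By induction from the left: the first interval is disjoint from the part
    of U beyond its right end. *)
Lemma total_length_le_measure (U : set R) l : open U -> nonoverlapping l ->
  (forall I, I \in l -> I.1 <= I.2 /\ `[I.1, I.2]%classic `<=` U) ->
  ((total_length l)%:E <= mu U)%E.
Proof.
move=> oU; have mU := measurable_realfun.open_measurable oU => lP lU.
suff H a : all (fun I => a <= I.1) l -> ((total_length l)%:E <= mu (U `&` `]a, +oo[))%E.
  have [a aP] : exists a, all (fun I => a <= I.1) l.
    elim: l {lP lU H} => [|I l [a aP]]; first by exists 0.
    exists (Num.min a I.1); rewrite /= ge_min lexx orbT /=.
    by apply: sub_all aP => J; rewrite ge_min => ->.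
  apply: le_trans (H a aP) _.
  by apply: le_measure; rewrite ?inE //; apply: measurableI.
elim: l a lP lU => [|I l IH] a; first by rewrite /total_length big_nil measure_ge0.
rewrite /nonoverlapping /= => /andP[Il lP] lU /andP[aI _].
have [I12 IU] := lU I (mem_head _ _).
rewrite /total_length big_cons EFinD.
have <- : mu `]I.1, I.2] = (I.2 - I.1)%:E.
  rewrite lebesgue_measure_itv /= lte_fin; case: ltP => // h.
  have -> : I.2 = I.1 by apply/eqP; rewrite eq_le I12 h.
  by rewrite subrr.
apply: (@le_trans _ _ (mu `]I.1, I.2] + mu (U `&` `]I.2, +oo[))%E).
  rewrite leeD2l //; apply: IH => //.
  by move=> J Jl; apply: lU; rewrite inE Jl orbT.
rewrite -measureU //; last first.
- by rewrite -subset0 => z [] /=; rewrite !in_itv /= andbT => /andP[_ z1] [_]; rewrite ltNge z1.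
- exact: measurableI.
apply: le_measure; rewrite ?inE; [apply: measurableU => // | |].
- exact: measurableI.
- exact: measurableI.
move=> z [/=|[Uz /=]]; rewrite !in_itv /= ?andbT => zI.
  split; first by apply: IU; rewrite /= in_itv /=; case/andP: zI => /ltW -> ->.
  by rewrite (le_lt_trans aI) //; case/andP: zI.
by split=> //; rewrite (le_lt_trans aI) // (le_lt_trans I12).
Qed.

Lemma abs_continuous_seq (T : R) (x : R -> V) : abs_continuous_on `[0, T] x ->
  forall e : R, 0 < e -> exists2 d : R, 0 < d & forall l, nonoverlapping l ->
    (forall I, I \in l -> [/\ 0 <= I.1, I.1 <= I.2 & I.2 <= T]) ->
    total_length l < d -> \sum_(I <- l) `|x I.2 - x I.1| < e.
Proof.
move=> xac e e0; have [d d0 H] := xac e e0; exists d => // l lP lT ld.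
pose z : R * R := (0, 0).
have nl (i : 'I_(size l)) : nth z l i \in l by exact: mem_nth.
rewrite (big_nth z) big_mkord.
apply: (H _ (fun i => (nth z l i).1) (fun i => (nth z l i).2)).
- move=> i; have [h1 h2 h3] := lT _ (nl i); rewrite /= !in_itv /= h1 h3 h2.
  by rewrite (le_trans h1 h2) (le_trans h2 h3).
- move=> i j ij; have /(pairwiseP z) hp := lP.
  have [ij'|ij'|/val_inj E] := ltngtP i j; last by rewrite E eqxx in ij.
  + by left; apply: hp; rewrite ?inE.
  + by right; apply: hp; rewrite ?inE.
- by move: ld; rewrite /total_length (big_nth z) big_mkord.
Qed.

(** The exceptional set is covered by an open set U of small measure.  By
    [cousin], [s, t] splits into intervals on which the slope is at most M + e and
    intervals inside U; on the latter absolute continuity makes the total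
    increment small. *)
Lemma ac_growth (T : R) (x : R -> V) (w : V) (E : set R) M s t :
  abs_continuous_on `[0, T] x -> mu.-negligible E ->
  0 <= s -> s <= t -> t <= T ->
  (forall r, s <= r -> r <= t -> ~ E r ->
    exists2 v, has_deriv_in `[0, T] x r v & pairing w v <= M) ->
  pairing w (x t) - pairing w (x s) <= M * (t - s).
Proof.
move=> xac [A [mA A0 EA]] s0 st tT xr.
apply/ler_addgt0Pr => e' e'0.
pose e := e' / (t - s + 2).
have ts1 : 0 < t - s + 2 by linear.
have e0 : 0 < e by rewrite divr_gt0.
have m0 := mass_ge0 w; have m1 : 0 < mass w + 1 by linear.
have [d1 d10 acd] := abs_continuous_seq xac (divr_gt0 e0 m1).
(* Intervals inside U are charged K per unit length, which also makes up for a
   negative slope bound. *)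
pose K := `|M + e| + 1; have K0 : 0 < K by rewrite ltr_wpDl.
pose d := Num.min d1 (e / K).
have d0 : 0 < d by rewrite lt_min d10 divr_gt0.
have muA : (mu A < +oo)%E by rewrite A0 ltry.
have [U [oU AU UA]] := lebesgue_regularity_outer mA muA d0.
have mU := measurable_realfun.open_measurable oU.
have Ud : (mu U < d%:E)%E.
  apply: le_lt_trans UA.
  have -> : mu U = mu (A `|` (U `\` A)) by rewrite setDUK.
  rewrite measureU //; [|exact: measurableD|exact: setDIK].
  by rewrite [X in (X + _)%E](_ : _ = 0%E) ?add0e.
pose var l := \sum_(I <- l) `|pairing w (x I.2) - pairing w (x I.1)| + K * total_length l.
pose Q a b := exists l, [/\ nonoverlapping l,
  forall I, I \in l -> [/\ a <= I.1, I.1 <= I.2 & I.2 <= b],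
  forall I, I \in l -> `[I.1, I.2]%classic `<=` U &
  pairing w (x b) - pairing w (x a) <= (M + e) * (b - a) + var l].
have [l [l1 l2 l3 l4]] : Q s t.
  apply: (cousin st) => [r sr rt|a b c sa ab bc ct [k [k1 k2 k3 k4]] [l [l1 l2 l3 l4]]]; last first.
    exists (k ++ l); split.
    - rewrite /nonoverlapping pairwise_cat -/(nonoverlapping k) -/(nonoverlapping l) k1 l1 !andbT.
      apply/allrelP => I J /k2[_ _ h1] /l2[h2 _ _]; exact: le_trans h1 h2.
    - move=> I; rewrite mem_cat => /orP[/k2[h1 h2 h3]|/l2[h1 h2 h3]]; split=> //.
        exact: le_trans bc.
      exact: le_trans ab h1.
    - by move=> I; rewrite mem_cat => /orP[/k3|/l3].
    - by move: k4 l4; rewrite /var /total_length !big_cat /= mulrDr; linear.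
  have [Er|nEr] := pselect (A r).
    have [eta /= eta0 etaU] : nbhs_ball r U by apply/nbhs_ballP; apply: open_nbhs_nbhs; split=> //; exact: AU.
    exists eta => // a b sa ar rb bt ab; exists [:: (a, b)]; split=> //.
    - by move=> I; rewrite inE => /eqP -> /=; split=> //; exact: le_trans rb.
    - move=> I; rewrite inE => /eqP -> /= z; rewrite /= in_itv /= => /andP[az zb].
      by apply: etaU; rewrite /ball /= ltr_norml; linear.
    - rewrite /var /total_length !big_seq1 /=.
      have := ler_norm (pairing w (x b) - pairing w (x a)).
      have := ler_norm (- (M + e)); rewrite normrN /K; nonlinear.
  have [v xv wv] := xr r sr rt (fun h => nEr (EA _ h)).
  have [eta eta0 H] := deriv_growth xv wv e0.
  exists eta => // a b sa ar rb bt ab; exists [::]; split=> //.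
  rewrite /var /total_length !big_nil mulr0 !addr0; apply: H => //=; rewrite in_itv /=; linear.
have ld : total_length l < d.
  rewrite -lte_fin; apply: le_lt_trans Ud; apply: total_length_le_measure => // I Il.
  by have [_ h _] := l2 I Il; split=> //; exact: l3.
have lT I : I \in l -> [/\ 0 <= I.1, I.1 <= I.2 & I.2 <= T].
  by move=> /l2[h1 h2 h3]; split=> //; [exact: le_trans h1 | exact: le_trans tT].
have lv : var l <= 2 * e.
  rewrite mulr2n mulrDl mul1r lerD //; last first.
    by rewrite mulrC -ler_pdivlMr // ltW // (lt_le_trans ld) // ge_min lexx orbT.
  have := acd l l1 lT (lt_le_trans ld _); rewrite ge_min lexx => /(_ isT); rewrite ltr_pdivlMr // => h.
  apply: le_trans (ltW h); rewrite mulr_suml ler_sum // => I _.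
  rewrite -pairingB (le_trans (pairing_le _ _)) // mulrC ler_wpM2l //; linear.
have : e * (t - s + 2) = e' by rewrite /e divfK // gt_eqF.
linear.
Qed.

End growth.

(** * Krasovskii, Filippov and Caratheodory solutions *)

Section inclusions.
Variables (R : realType) (p q : nat).
Local Notation V := 'M[R]_(p, q).
Local Notation mu := (@lebesgue_measure R).
Variable f : V -> V.

(** Half-spaces are convex and closed. *)
Lemma hull_le (A : set V) (w : V) (M : R) : (forall v, A v -> pairing w v <= M) ->
  forall v, closed_convex_hull A v -> pairing w v <= M.
Proof.
move=> AM v /(_ [set v : V | pairing w v <= M]); apply; split; last exact: AM; split.
  move=> z clz /=; rewrite leNgt; apply/negP => Mz.
  have e0 : 0 < pairing w z - M by rewrite subr_gt0.
  have [y [/= yM]] := clz _ (pairing_continuous w z e0).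
  by rewrite ltr_norml; linear.
move=> a b l; rewrite !inE /= => aM bM.
have -> : conv l a b = l%:num *: (a : V) + (1 - l%:num) *: (b : V) by [].
rewrite pairingD !pairingZ.
have l0 : 0 <= l%:num by [].
have l1 : l%:num <= 1 by [].
nonlinear.
Qed.

Lemma hull_sub (A : set V) v : A v -> closed_convex_hull A v.
Proof. by move=> Av C [_]; apply. Qed.

Lemma krasovskii_le x v (w : V) (d M : R) : 0 < d ->
  (forall y, `|y - x| < d -> pairing w (f y) <= M) ->
  krasovskii f x v -> pairing w v <= M.
Proof.
move=> d0 H /(_ d d0); apply: hull_le => _ [y /= yx <-]; apply: H.
exact: le_lt_trans (norm_le_enorm _) yx.
Qed.

Lemma krasovskii_mean_value x : global (krasovskii_sol f) x -> mean_value_sol f x.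
Proof.
move=> xP w s t M d s0 st d0 H.
have T0 : 0 < t + 1 by rewrite ltr_wpDl // (le_trans s0).
have [xac xae] := xP (t + 1) T0.
apply: (ac_growth xac xae s0 st); first by rewrite lerDl.
move=> r sr rt /notP hr.
have [|v xv Kv] := hr; first by rewrite in_itv /= (le_trans s0) //= (le_trans rt) // lerDl.
exists v => //; apply: krasovskii_le d0 _ Kv => y; exact: H.
Qed.

Lemma krasovskii_self x : krasovskii f x (f x).
Proof.
move=> d d0; apply: hull_sub; exists x => //=.
by rewrite /eball /= subrr -[0](scale0r 0) enormE pairingZ mul0r sqrtr0.
Qed.

Lemma caratheodory_krasovskii T x : caratheodory_sol f T x -> krasovskii_sol f T x.
Proof.
move=> [xac xae]; split=> //; apply: negligibleS xae => t; apply: contra_not => H tT.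
by exists (f (x t)); [exact: H | exact: krasovskii_self].
Qed.

(** Degenerate boxes have volume 0 in positive dimension; in dimension 0 the
    empty product gives every box volume 1. *)
Lemma lebesgue_null0 : (0 < p)%N -> (0 < q)%N -> lebesgue_null (set0 : set V).
Proof.
move=> p0 q0; apply/eqP; rewrite eq_le; apply/andP; split.
  apply: ereal_inf_lbound; exists (fun=> 0), (fun=> 0); split=> //.
  rewrite eseries0 // => k _ _; congr EFin; apply/esym.
  rewrite /box_volume; case: p p0 => // p' _; rewrite big_ord_recl.
  by case: q q0 => // q' _; rewrite big_ord_recl !mxE subrr !mul0r.
apply/ereal_infP => _ [a [b [ab _ ->]]]; apply: nneseries_ge0 => k _ _.
by rewrite lee_fin; apply: prodr_ge0 => i _; apply: prodr_ge0 => j _; rewrite subr_ge0.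
Qed.

(** Taking the null set empty in the definition of F(x) gives K(x). *)
Lemma filippov_krasovskii T x : (0 < p)%N -> (0 < q)%N ->
  filippov_sol f T x -> krasovskii_sol f T x.
Proof.
move=> p0 q0 [xac xae]; split=> //; apply: negligibleS xae => t; apply: contra_not => H tT.
have [v xv Fv] := H tT; exists v => // d d0.
by have := Fv d d0 set0 (lebesgue_null0 p0 q0); rewrite setD0.
Qed.

End inclusions.

(** * Growth of piecewise differentiable curves *)

Section piecewise.
Variables (R : realType) (p q : nat).
Local Notation V := 'M[R]_(p, q).

Lemma has_deriv_in_sub (A B : set R) (x : R -> V) t v : B `<=` A ->
  has_deriv_in A x t v -> has_deriv_in B x t v.
Proof.
move=> BA /has_deriv_inP H; apply/has_deriv_inP => e e0.
by have [eta eta0 {}H] := H e e0; exists eta => // s Bs; apply: H; exact: BA.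
Qed.

Lemma has_deriv_in_continuous (A : set R) (x : R -> V) t v : has_deriv_in A x t v ->
  forall e : R, 0 < e -> exists2 eta : R, 0 < eta & forall s, A s ->
    `|s - t| < eta -> `|x s - x t| < e.
Proof.
move=> /has_deriv_inP /(_ 1 ltr01)[eta eta0 H] e e0.
have K0 : 0 < 1 + `|v| by rewrite ltr_pwDl.
exists (Num.min eta (e / (1 + `|v|))); first by rewrite lt_min eta0 divr_gt0.
move=> s As; rewrite lt_min ltr_pdivlMr // => /andP[se sK].
apply: le_lt_trans sK; rewrite mulrDr mulr1.
have := H s As se; rewrite mul1r; have := ler_normD (x s - x t - (s - t) *: v) ((s - t) *: v).
by rewrite subrK normrZ; linear.
Qed.

Lemma grid_le (T : R) l (tau : nat -> R) : grid T l tau ->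
  forall i j, (i <= j)%N -> (j <= l)%N -> tau i <= tau j.
Proof.
move=> [_ _ H] i j ij; rewrite -(subnKC ij); elim: (j - i)%N => [|k IH]; first by rewrite addn0.
by rewrite addnS => kl; apply: le_trans (IH (ltnW kl)) (ltW (H _ kl)).
Qed.

Lemma grid_locate (T : R) l (tau : nat -> R) r : grid T l tau -> 0 <= r -> r < T ->
  exists2 k, (k < l)%N & tau k <= r < tau k.+1.
Proof.
move=> [t0 tl H] r0 rT.
suff L m : (m <= l)%N -> r < tau m -> exists2 k, (k < l)%N & tau k <= r < tau k.+1.
  by apply: (L l) => //; rewrite tl.
elim: m => [|m IH] ml; first by rewrite t0 ltNge r0.
by have [tr rm|/(IH (ltnW ml))] := leP (tau m) r; [exists m => //; rewrite tr | ].
Qed.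

(** At a point of the grid x is only continuous and no slope bound holds.  The
    step function J jumps there, so that a small multiple of J in the majorant of
    [creep] absorbs the small increment of x around that point. *)
Lemma piecewise_growth T l tau (x : R -> V) w s t M :
  grid T l tau -> {within `[0, T], continuous x} ->
  0 <= s -> s <= t -> t <= T ->
  (forall k r, (k < l)%N -> tau k < r -> r < tau k.+1 -> s <= r -> r <= t ->
     exists2 v, has_deriv_in `]tau k, tau k.+1[ x r v & pairing w v <= M) ->
  pairing w (x t) - pairing w (x s) <= M * (t - s).
Proof.
move=> gr /within_continuousE xc s0 st tT xr.
apply/ler_addgt0Pr => e' e'0.
pose J r : R := \sum_(k < l.+1) ((tau k < r)%R%:R + (tau k <= r)%R%:R).
have Jmono a b : a <= b -> J a <= J b.
  move=> ab; apply: ler_sum => k _; apply: lerD; rewrite ler_nat.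
    by case: ltP => // h; rewrite (lt_le_trans h ab).
  by case: leP => // h; rewrite (le_trans h ab).
have J0 a : 0 <= J a by apply: sumr_ge0 => k _; rewrite addr_ge0.
have JN a : J a <= (l.+1 * 2)%:R.
  apply: (@le_trans _ _ (\sum_(k < l.+1) 2)).
    apply: ler_sum => k _; have -> : 2 = 1 + 1 :> R by [].
    by apply: lerD; rewrite lern1; exact: leq_b1.
  by rewrite sumr_const card_ord mulnC natrM mulr_natr.
(* With both comparisons in J, an interval that has tau k as an end point also
   sees a jump. *)
have Jjump a b k : (k < l.+1)%N -> a <= tau k -> tau k <= b -> a < b -> J a + 1 <= J b.
  move=> kl ak kb ab; rewrite /J (bigD1 (Ordinal kl)) //= [leRHS](bigD1 (Ordinal kl)) //=.
  rewrite addrAC lerD //; last first.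
    apply: ler_sum => m _; apply: lerD; rewrite ler_nat.
      by case: ltP => // h; rewrite (lt_trans h ab).
    by case: leP => // h; rewrite (le_trans h (ltW ab)).
  rewrite kb (ltNge (tau k) a) ak /= add0r.
  case: (ltP (tau k) b) => h; first by rewrite lerD2r lern1 leq_b1.
  have bk : tau k = b by apply/eqP; rewrite eq_le kb h.
  by rewrite bk (leNgt b a) ab add0r.
pose e := e' / (t - s + (l.+1 * 2)%:R).
have D0 : 0 < t - s + (l.+1 * 2)%:R by rewrite ltr_wpDl ?subr_ge0 // ltr0n.
have e0 : 0 < e by rewrite divr_gt0.
have m0 := mass_ge0 w; have m1 : 0 < mass w + 1 by linear.
suff H : pairing w (x t) - pairing w (x s) <=
    ((M + e) * t + e * J t) - ((M + e) * s + e * J s).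
  have E : e * (t - s + (l.+1 * 2)%:R) = e' by rewrite /e divfK // gt_eqF.
  have := JN t; have := J0 s; rewrite -E; nonlinear.
apply: (creep (g := fun r => pairing w (x r)) (W := fun r => (M + e) * r + e * J r) st) => r sr rt /=.
have r0T : `[0, T]%classic r by rewrite /= in_itv /= (le_trans s0 sr) (le_trans rt tT).
have [[k kl rk]|[k kl /andP[kr rk]]] : (exists2 k, (k < l.+1)%N & r = tau k) \/
    (exists2 k, (k < l)%N & tau k < r < tau k.+1).
  have [h|h] := ltP r T.
    have [k kl] := grid_locate gr (le_trans s0 sr) h.
    rewrite le_eqVlt => /andP[/orP[/eqP kr|kr] rk]; last by right; exists k; rewrite ?kr.
    by left; exists k => //; exact: ltnW.
  left; exists l => //; have [_ -> _] := gr.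
  by apply/eqP; rewrite eq_le h (le_trans rt).
- pose K := `|M + e| + 1; have K0 : 0 < K by rewrite ltr_wpDl.
  have e4 : 0 < e / 4 / (mass w + 1) by rewrite !divr_gt0.
  have [eta eta0 H] := xc r r0T _ e4.
  exists (Num.min eta (e / 2 / K)); first by rewrite lt_min eta0 !divr_gt0.
  move=> a b sa ar rb bt; rewrite lt_min => /andP[bae baK].
  have ab : a <= b by exact: le_trans rb.
  move: (ab); rewrite le_eqVlt => /orP[/eqP -> |ab']; first by rewrite !subrr.
  have aux c : s <= c -> c <= t -> `|c - r| < eta -> `|pairing w (x c) - pairing w (x r)| <= e / 4.
    move=> sc ct /H h; rewrite -pairingB (le_trans (pairing_le _ _)) //.
    have /h h' : `[0, T]%classic c by rewrite /= in_itv /= (le_trans s0 sc) (le_trans ct tT).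
    rewrite -[leRHS](divfK (lt0r_neq0 m1)) [leRHS]mulrC.
    by apply: ler_pM => //; [rewrite lerDl | exact: ltW].
  have ha : `|pairing w (x a) - pairing w (x r)| <= e / 4.
    apply: aux => //; first exact: le_trans rt.
    by rewrite ler0_norm ?subr_le0 //; linear.
  have hb : `|pairing w (x b) - pairing w (x r)| <= e / 4.
    apply: aux => //; first exact: le_trans rb.
    by rewrite ger0_norm ?subr_ge0 //; linear.
  have hJ : J a + 1 <= J b by apply: (Jjump a b k) => //; rewrite -rk.
  have : K * (b - a) < e / 2 by rewrite mulrC -ltr_pdivlMr.
  have := ler_norm (- (M + e)); rewrite normrN.
  move: ha hb; rewrite !ler_norml /K => /andP[a1 a2] /andP[b1 b2]; nonlinear.
have [v xv wv] := xr k r kl kr rk sr rt.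
have [eta eta0 H] := deriv_growth xv wv e0.
exists (Num.min eta (Num.min (r - tau k) (tau k.+1 - r))); first by rewrite !lt_min eta0 !subr_gt0 kr.
move=> a b sa ar rb bt; rewrite !lt_min => /andP[ba /andP[bk1 bk2]].
have ab : a <= b by exact: le_trans rb.
have := H a b; rewrite /= !in_itv /=.
have -> : tau k < a < tau k.+1 by linear.
have -> : tau k < b < tau k.+1 by linear.
move=> /(_ isT isT ar rb ba).
have := Jmono a b ab; nonlinear.
Qed.

End piecewise.

(** * Classical, stratified and sample-and-hold solutions *)

Section solution_types.
Variables (R : realType) (p q : nat).
Local Notation V := 'M[R]_(p, q).

Lemma uniform_cvgP (A : set R) (y : nat -> R -> V) (x : R -> V) :
  {uniform A, y @ \oo --> x} <->
  forall e : R, 0 < e -> exists n0, forall n, (n0 <= n)%N -> forall t, A t ->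
    `|y n t - x t| < e.
Proof.
split=> [yx e e0|H P /uniform_nbhs[E [entE EP]]].
  have : nbhs (x : {uniform` A -> V}) [set h | forall t, A t -> `|h t - x t| < e].
    apply/uniform_nbhs; exists [set z | ball z.1 e z.2]; split.
      exact: (entourage_ball _ (PosNum e0)).
    by move=> h /= Eh t At; have := Eh t At; rewrite -ball_normE /= distrC.
  by move=> /yx [n0 _ H]; exists n0 => n nn t At; exact: (H n nn t At).
have [e /= e0 eE] : exists2 e : R, 0 < e & [set z : V * V | ball z.1 e z.2] `<=` E.
  by move: entE; rewrite -entourage_ballE => -[e e0 He]; exists e.
have [n0 Hn] := H e e0; exists n0 => // n /= nn; apply: EP => t At; apply: eE => /=.
by rewrite -ball_normE /= distrC; exact: Hn.
Qed.

Variable f : V -> V.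

(** What classical and stratified solutions share; nothing is asked at the
    points of the grid, where the cells and the one-sided derivatives change. *)
Definition piecewise_classical (T : R) (x : R -> V) : Prop :=
  {within `[0, T], continuous x} /\
  exists (l : nat) (tau : nat -> R), grid T l tau /\
    forall k, (k < l)%N -> classical_on f `]tau k, tau k.+1[ x.

Lemma piecewise_classical_mean_value x :
  global piecewise_classical x -> mean_value_sol f x.
Proof.
move=> xP w s t M d s0 st d0 H.
have T0 : 0 < t + 1 by rewrite ltr_wpDl // (le_trans s0).
have [xc [l [tau [gr xcl]]]] := xP (t + 1) T0.
apply: (piecewise_growth gr xc s0 st) => [|k r kl kr rk sr rt]; first by rewrite lerDl.
exists (f (x r)); first by apply: xcl => //; rewrite /= in_itv /= kr.
by apply: (H r (x r)) => //; rewrite subrr normr0.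
Qed.

Lemma classical_continuous (A : set R) x : classical_on f A x ->
  {within A, continuous x}.
Proof.
move=> xc; apply/within_continuousE => t At.
exact: has_deriv_in_continuous (xc t At).
Qed.

Lemma grid_one (T : R) : 0 < T -> grid T 1 (fun k => if k is 0%N then 0 else T).
Proof. by move=> T0; split=> // -[]. Qed.

Lemma classical_piecewise T x : 0 < T -> classical_sol f T x -> piecewise_classical T x.
Proof.
move=> T0 xc; split; first exact: classical_continuous.
exists 1%N, (fun k => if k is 0%N then 0 else T); split; first exact: grid_one.
move=> [|//] _ t tT /=.
have sub : `]0, T[ `<=` `[0, T] by exact: subset_itv_oo_cc.
by apply: (has_deriv_in_sub sub); apply: xc; exact: sub.
Qed.

Lemma stratified_piecewise S T x : typeI S `|` typeII S = cells S ->
  stratified_sol f S T x -> piecewise_classical T x.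
Proof.
move=> Scells [xc _ [l [tau [i [gr H]]]]]; split=> //; exists l, tau; split=> // k kl t tk.
have [ci HI HII] := H k kl.
move: (ci); rewrite -Scells => -[/HI[xcl _]|/HII[_ xcl _]]; last exact: xcl.
have sub : `]tau k, tau k.+1[ `<=` `[tau k, tau k.+1[ by exact: subset_itv_oo_co.
by apply: (has_deriv_in_sub sub); apply: xcl; exact: sub.
Qed.

(** An approximation moves with the value of the field at a node which, for a
    fine mesh, is close to the limit trajectory; it obeys the growth bound, and the
    bound passes to the uniform limit. *)
Lemma clss_mean_value C x : (forall y, `|f y| <= C) ->
  global (clss_sol f) x -> mean_value_sol f x.
Proof.
move=> fC xP w s t M d s0 st d0 H.
have T0 : 0 < t + 1 by rewrite ltr_wpDl // (le_trans s0).
have tT : t <= t + 1 by rewrite lerDl.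
have C0 : 0 <= C by exact: le_trans (fC 0).
have [_ [y [m [tau [yP gr yd mesh /uniform_cvgP yx]]]]] := xP _ T0.
have m0 := mass_ge0 w.
apply/ler_addgt0Pr => e e0.
pose e1 := Num.min (d / 2) (e / 2 / (mass w + 1)).
have m1 : 0 < mass w + 1 by linear.
have e10 : 0 < e1 by rewrite lt_min !divr_gt0.
have C1 : 0 < d / 2 / (C + 1) by rewrite !divr_gt0 // ltr_wpDl.
have [n0 Hn0] := yx e1 e10.
have /cvgrPdist_lt /(_ _ C1) [n1 _ Hn1] := mesh.
pose nu := maxn n0 n1.
have {}Hn0 := Hn0 nu (leq_maxl _ _).
have {}Hn1 : forall j, (j < m nu)%N -> tau nu j.+1 - tau nu j < d / 2 / (C + 1).
  move=> j jm; have := Hn1 nu (leq_maxr _ _); rewrite /= sub0r normrN => h.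
  apply: le_lt_trans (le_trans _ (ler_norm _)) h.
  exact: (@le_bigmax _ _ _ 0 (fun k : 'I_(m nu) => tau nu k.+1 - tau nu k) (Ordinal jm)).
have [yc _ y0] := yP nu.
have yC a b : 0 <= a -> a <= b -> b <= t + 1 -> `|y nu b - y nu a| <= C * (b - a).
  move=> a0 ab bT; apply: norm_le_pairing => [|v vP]; first by rewrite mulr_ge0 // subr_ge0.
  rewrite pairingB; apply: (piecewise_growth (gr nu) yc a0 ab bT) => k r km kr rk _ _.
  exists (f (y nu (tau nu k))); last by apply: le_trans (vP _) _.
  have sub : `]tau nu k, tau nu k.+1[ `<=` `[tau nu k, tau nu k.+1[ by exact: subset_itv_oo_co.
  apply: (has_deriv_in_sub sub); apply: yd => //.
  by rewrite in_itv /= rk ltW.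
have yg : pairing w (y nu t) - pairing w (y nu s) <= M * (t - s).
  apply: (piecewise_growth (gr nu) yc s0 st tT) => k r km kr rk sr rt.
  exists (f (y nu (tau nu k))).
    have sub : `]tau nu k, tau nu k.+1[ `<=` `[tau nu k, tau nu k.+1[ by exact: subset_itv_oo_co.
    apply: (has_deriv_in_sub sub); apply: yd => //.
    by rewrite in_itv /= rk ltW.
  apply: (H r) => //.
  have k0 : 0 <= tau nu k by have := grid_le (gr nu) (leq0n k) (ltnW km); have [-> _ _] := gr nu.
  have := yC _ _ k0 (ltW kr) (le_trans rt tT).
  have /Hn0 h : `[0, t + 1]%classic r by rewrite /= in_itv /= (le_trans s0 sr) (le_trans rt tT).
  have h2 : `|y nu r - x r| < d / 2 by apply: lt_le_trans h _; rewrite ge_min lexx.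
  have h3 := Hn1 k km.
  have h4 : C * (r - tau nu k) < d / 2.
    apply: (@le_lt_trans _ _ ((C + 1) * (r - tau nu k))).
      by rewrite ler_wpM2r ?lerDl // subr_ge0 ltW.
    rewrite mulrC -ltr_pdivlMr ?ltr_wpDl //; linear.
  have := ler_normD (y nu (tau nu k) - y nu r) (y nu r - x r).
  by rewrite addrA subrK (distrC (y nu (tau nu k)) (y nu r)); linear.
have aux c : 0 <= c -> c <= t + 1 -> `|pairing w (y nu c) - pairing w (x c)| <= e / 2.
  move=> c0 cT; rewrite -pairingB (le_trans (pairing_le _ _)) //.
  rewrite -[leRHS](divfK (lt0r_neq0 m1)) [leRHS]mulrC.
  apply: ler_pM => //; first by rewrite lerDl.
  have /Hn0 h : `[0, t + 1]%classic c by rewrite /= in_itv /= c0.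
  by apply: ltW; apply: lt_le_trans h _; rewrite ge_min lexx orbT.
have := aux t (le_trans s0 st) tT; have := aux s s0 (le_trans st tT).
by rewrite !ler_norml; linear.
Qed.

End solution_types.

(** * Uniqueness under a Lipschitz bound *)

Section uniqueness.
Variables (R : realType) (p q : nat).
Local Notation V := 'M[R]_(p, q).

Lemma has_deriv_in_shift (A : set R) (x : R -> V) a t v :
  has_deriv_in [set r | A (r + a)] (fun r => x (r + a)) t v <-> has_deriv_in A x (t + a) v.
Proof.
split=> /has_deriv_inP H; apply/has_deriv_inP => e e0; have [eta eta0 {}H] := H e e0;
  exists eta => // s As st.
  have := H (s - a); rewrite /= subrK; have -> : s - a - t = s - (t + a) by ring.
  by apply.
have E : s - t = s + a - (t + a) by ring.
by rewrite E; apply: H => //; rewrite -E.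
Qed.

(** [piecewise_growth] for a grid of one interval, translated to start at 0. *)
Lemma mean_value_le (a b : R) (x : R -> V) w M : a <= b ->
  {within `[a, b], continuous x} ->
  (forall r, a < r -> r < b -> exists2 v, has_deriv_in `]a, b[ x r v & pairing w v <= M) ->
  pairing w (x b) - pairing w (x a) <= M * (b - a).
Proof.
rewrite le_eqVlt => /orP[/eqP -> _ _|ab xc xr]; first by rewrite !subrr mulr0.
have ba0 : 0 < b - a by rewrite subr_gt0.
have := @piecewise_growth R p q (b - a) 1 (fun k => if k is 0%N then 0 else b - a)
  (fun r => x (r + a)) w 0 (b - a) M (grid_one ba0).
rewrite subrK add0r subr0; apply; [| exact: lexx | exact: ltW | exact: lexx |].
- apply/within_continuousE => t; rewrite /= in_itv /= => /andP[t0 tb] e e0.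
  have tab : `[a, b]%classic (t + a) by rewrite /= in_itv /=; linear.
  have [eta eta0 H] := (within_continuousE _ _).1 xc (t + a) tab e e0.
  exists eta => // s; rewrite /= in_itv /= => /andP[s0 sb] st; apply: H.
    by rewrite /= in_itv /=; linear.
  by have -> : s + a - (t + a) = s - t by ring.
- move=> [|//] r _ r0 rb _ _; have [||v xv wv] := xr (r + a); [linear|linear|].
  exists v => //; apply: has_deriv_in_sub ((has_deriv_in_shift _ _ _ _ _).2 xv) => s.
  by rewrite /= !in_itv /= ; linear.
Qed.

Lemma norm_mean_value_le (a b : R) (x : R -> V) C : a <= b -> 0 <= C ->
  {within `[a, b], continuous x} ->
  (forall r, a < r -> r < b -> exists2 v, has_deriv_in `]a, b[ x r v & `|v| <= C) ->
  `|x b - x a| <= C * (b - a).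
Proof.
move=> ab C0 xc xr.
apply: norm_le_pairing => [|w wP]; first by rewrite mulr_ge0 // subr_ge0.
rewrite pairingB; apply: mean_value_le => // r ar rb; have [v xv vC] := xr r ar rb.
by exists v => //; apply: le_trans (wP v) vC.
Qed.

Lemma within_continuous_sub (A B : set R) (x : R -> V) : B `<=` A ->
  {within A, continuous x} -> {within B, continuous x}.
Proof. exact: continuous_subspaceW. Qed.

Lemma has_deriv_inB (A : set R) (x y : R -> V) t u v :
  has_deriv_in A x t u -> has_deriv_in A y t v ->
  has_deriv_in A (fun r => x r - y r) t (u - v).
Proof.
move=> /has_deriv_inP xu /has_deriv_inP yv; apply/has_deriv_inP => e e0.
have e20 : 0 < e / 2 by rewrite divr_gt0.
have [e1 e10 H1] := xu _ e20; have [e2 e200 H2] := yv _ e20.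
exists (Num.min e1 e2) => [|s As]; first by rewrite lt_min e10.
rewrite lt_min => /andP[/(H1 s As) h1 /(H2 s As) h2].
have -> : x s - y s - (x t - y t) - (s - t) *: (u - v) =
    (x s - x t - (s - t) *: u) - (y s - y t - (s - t) *: v).
  by apply/matrixP => i j; rewrite !mxE; ring.
apply: le_trans (ler_normB _ _) _; linear.
Qed.

Variable f : V -> V.

(** On an interval [s, u] with L (u - s) <= 1/2 that starts from a common
    state, a bound B on the distance of the two solutions improves to B / 2 by
    the mean value inequality, so that the supremum of the distance is 0. *)
Lemma classical_unique (a b C L : R) (x y : R -> V) : 0 <= L ->
  (forall z, `|f z| <= C) ->
  {within `[a, b], continuous x} -> {within `[a, b], continuous y} ->
  classical_on f `]a, b[ x -> classical_on f `]a, b[ y ->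
  (forall r, a < r -> r < b -> `|f (x r) - f (y r)| <= L * `|x r - y r|) ->
  x a = y a -> forall t, a <= t -> t <= b -> x t = y t.
Proof.
move=> L0 fC xc yc xcl ycl lip xya t at_ tb.
have C0 : 0 <= C by exact: le_trans (fC 0).
pose z r := x r - y r.
have zc s u : a <= s -> u <= b -> {within `[s, u], continuous z}.
  move=> as_ ub; have sub : `[s, u] `<=` `[a, b].
    move=> r; rewrite /= !in_itv /= => /andP[sr ru]; linear.
  move/(within_continuous_sub sub)/within_continuousE: xc => xc.
  move/(within_continuous_sub sub)/within_continuousE: yc => yc.
  apply/within_continuousE => r rsu e e0; have e20 : 0 < e / 2 by rewrite divr_gt0.
  have [e1 e10 H1] := xc r rsu _ e20; have [e2 e200 H2] := yc r rsu _ e20.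
  exists (Num.min e1 e2) => [|v vsu]; first by rewrite lt_min e10.
  rewrite lt_min => /andP[/(H1 v vsu) h1 /(H2 v vsu) h2].
  have -> : z v - z r = (x v - x r) - (y v - y r) by apply/matrixP => i j; rewrite !mxE; ring.
  apply: le_lt_trans (ler_normB _ _) _; linear.
have grow s u B : a <= s -> s <= u -> u <= b -> 0 <= B ->
    (forall r, s <= r -> r <= u -> `|f (x r) - f (y r)| <= B \/ r = a \/ r = b) ->
    `|z u - z s| <= B * (u - s).
  move=> as_ su ub B0 HB; apply: norm_mean_value_le => //; first exact: zc.
  move=> r sr ru; exists (f (x r) - f (y r)).
    have sub : `]s, u[ `<=` `]a, b[.
      move=> v; rewrite /= !in_itv /= => /andP[sv vu]; linear.
    have rab : `]a, b[%classic r by apply: sub; rewrite /= in_itv /= sr.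
    by apply: has_deriv_inB; apply: (has_deriv_in_sub sub); [exact: xcl | exact: ycl].
  have [//|[E|E]] := HB r (ltW sr) (ltW ru); linear.
apply: (cousin (Q := fun s u => x s = y s -> x u = y u) (a := a) (b := t)) => //; last first.
  by move=> s r u _ _ _ _ H1 H2 /H1 /H2.
move=> r ar rt; exists (1 / 2 / (L + 1)); first by rewrite !divr_gt0 // ltr_wpDl.
move=> s u as_ sr ru ut us xys.
have su : s <= u by exact: le_trans ru.
have ub : u <= b by exact: le_trans tb.
pose S := [set `|z v| | v in `[s, u]%classic].
have Lus : L * (u - s) <= 1 / 2.
  apply: (@le_trans _ _ ((L + 1) * (u - s))); first by rewrite ler_wpM2r ?lerDl // subr_ge0.
  by rewrite mulrC -ler_pdivlMr ?ltr_wpDl // ltW.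
have z0 : z s = 0 by rewrite /z xys subrr.
have zB v B : s <= v -> v <= u -> 0 <= B ->
    (forall r, s <= r -> r <= v -> `|f (x r) - f (y r)| <= B \/ r = a \/ r = b) -> `|z v| <= B * (u - s).
  move=> sv vu B0 HB; have := grow s v B as_ sv (le_trans vu ub) B0 HB.
  rewrite z0 subr0 => h; apply: le_trans h _; rewrite ler_wpM2l //; linear.
have S0 : S 0 by exists s; rewrite ?z0 ?normr0 //= in_itv /= lexx.
have hS : has_sup S.
  split; first by exists 0.
  exists ((C + C) * (u - s)) => y' [v /=]; rewrite in_itv /= => /andP[sv vu] <-.
  apply: zB => //; first by rewrite addr_ge0.
  by move=> k _ _; left; apply: le_trans (ler_normB _ _) _; rewrite lerD.
have supS0 : 0 <= sup S by exact: sup_upper_bound.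
have half : sup S <= sup S * (1 / 2).
  apply: ge_sup; first by exists 0.
  move=> y' [v /=]; rewrite in_itv /= => /andP[sv vu] <-.
  apply: (@le_trans _ _ (L * sup S * (u - s))).
    apply: zB => //; first by rewrite mulr_ge0.
    move=> k sk kv.
    have [ka|ka] := leP k a; first by right; left; apply/eqP; rewrite eq_le ka (le_trans as_).
    have [kb|kb] := leP b k; first by right; right; apply/eqP; rewrite eq_le kb (le_trans kv) // (le_trans vu).
    left; apply: le_trans (lip k ka kb) _; rewrite ler_wpM2l //.
    by apply: sup_upper_bound => //; exists k => //=; rewrite in_itv /= sk (le_trans kv).
  by rewrite mulrAC [leLHS]mulrC ler_wpM2l.
have : `|z u| <= sup S by apply: sup_upper_bound => //; exists u => //=; rewrite in_itv /= lexx su.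
move=> zu; have : `|z u| <= 0 by linear.
by rewrite normr_le0 subr_eq0 => /eqP.
Qed.

End uniqueness.

(** The supremum of the times up to which P holds is b. *)
Lemma real_induction (R : realType) (P : R -> Prop) (a b : R) :
  P a ->
  (forall t, a <= t -> t < b -> (forall r, a <= r -> r <= t -> P r) ->
     exists2 eta, 0 < eta & forall r, t <= r -> r < t + eta -> P r) ->
  (forall t, a < t -> t <= b -> (forall r, a <= r -> r < t -> P r) -> P t) ->
  forall t, a <= t -> t <= b -> P t.
Proof.
move=> Pa right left t at_ tb.
pose S := [set s | [/\ a <= s, s <= b & forall r, a <= r -> r <= s -> P r]].
have ab : a <= b by exact: le_trans tb.
have Sa : S a.
  by split=> // r ar ra; have -> : r = a by apply/eqP; rewrite eq_le ra ar.
have hS : has_sup S by split; [exists a | exists b => s []].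
have ac : a <= sup S by apply: sup_upper_bound.
have cb : sup S <= b by apply: ge_sup; [exists a | move=> s []].
have below r : a <= r -> r < sup S -> P r.
  move=> ar rc; have [s [as_ sb H] rs] := sup_adherent (etrans (subr_gt0 _ _) rc) hS.
  by apply: H => //; move: rs; rewrite subKr => /ltW.
have upto r : a <= r -> r <= sup S -> P r.
  move=> ar; rewrite le_eqVlt => /orP[/eqP E|]; last exact: below.
  move: ar; rewrite le_eqVlt => /orP[/eqP <- //|ar].
  by apply: left => //; [rewrite E | move=> k ak kr; apply: below => //; rewrite -E].
have [cltb|bc] := ltP (sup S) b; last by apply: upto => //; exact: le_trans tb bc.
have [eta eta0 H] := right _ ac cltb upto.
pose u := Num.min b (sup S + eta / 2).
have cu : sup S < u by rewrite lt_min cltb /=; linear.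
have ub : u <= b by rewrite ge_min lexx.
have ue : u <= sup S + eta / 2 by rewrite ge_min lexx orbT.
have Su : S u.
  split=> //; first by linear.
  move=> r ar ru; have [rc|cr] := leP r (sup S); first exact: upto.
  by apply: H; [exact: ltW | linear].
by have := sup_upper_bound hS Su; linear.
Qed.

(** * C1 maps are locally Lipschitz *)

Section stratified_uniqueness.
Variables (R : realType) (p q : nat).
Local Notation V := 'M[R]_(p, q).

Lemma derivable_line (g : V -> V) (z d : V) (tau : R) (A : set R) :
  derivable g (z + tau *: d) d ->
  has_deriv_in A (fun r => g (z + r *: d)) tau ('D_d g (z + tau *: d)).
Proof.
move=> /cvgrPdist_le H; apply/has_deriv_inP => e e0.
have [eta /= eta0 {}H] := H e e0; exists eta => // s _ st.
have [->|sNt] := eqVneq s tau; first by rewrite !subrr scale0r subr0 !normr0 mulr0.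
have st0 : s - tau != 0 by rewrite subr_eq0.
have := H (s - tau); rewrite /= sub0r normrN => /(_ st st0).
have -> : (s - tau) *: d + (z + tau *: d) = z + s *: d.
  by apply/matrixP => i j; rewrite !mxE; ring.
rewrite -/('D_d g (z + tau *: d)) => h.
have -> : g (z + s *: d) - g (z + tau *: d) - (s - tau) *: 'D_d g (z + tau *: d) =
  - ((s - tau) *: ('D_d g (z + tau *: d) - (s - tau)^-1 *: (g (z + s *: d) - g (z + tau *: d)))).
  by rewrite scalerBr scalerA mulfV // scale1r opprB.
by rewrite normrN normrZ mulrC ler_wpM2r.
Qed.

(** Derivatives are bounded near z only in the finitely many coordinate
    directions.  So one passes from a to b by changing one coordinate at a time,
    without leaving the ball, which is a box for the maximum norm. *)
Lemma C1_locally_lipschitz (U : set V) (g : V -> V) z : open U -> U z -> Ck_on 1 U g ->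
  exists r L : R, [/\ 0 < r, 0 <= L & forall a b, `|a - z| < r -> `|b - z| < r ->
    `|g b - g a| <= L * `|b - a|].
Proof.
move=> oU Uz gC1.
have near_bound (ij : 'I_p * 'I_q) : \forall y \near z,
    `|'D_(delta_mx ij.1 ij.2 : V) g y| <= `|'D_(delta_mx ij.1 ij.2 : V) g z| + 1.
  have [_ cD] := gC1 (delta_mx ij.1 ij.2 : V); have /cvgrPdist_lt /(_ 1 ltr01) := cD z Uz.
  apply: filterS => y /= h.
  have := ler_normB ('D_(delta_mx ij.1 ij.2 : V) g z) ('D_(delta_mx ij.1 ij.2 : V) g z - 'D_(delta_mx ij.1 ij.2 : V) g y).
  by rewrite subKr => /le_trans; apply; rewrite lerD2l ltW.
have := @filter_forall _ _ (fun ij y => `|'D_(delta_mx ij.1 ij.2 : V) g y| <= `|'D_(delta_mx ij.1 ij.2 : V) g z| + 1) _ (nbhs_filter z) near_bound.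
move=> /nbhs_normP[r1 /= r10 H1].
have /nbhs_normP[r2 /= r20 H2] : nbhs z U by exact: open_nbhs_nbhs.
pose r := Num.min r1 r2.
pose K := \sum_(ij : 'I_p * 'I_q) (`|'D_(delta_mx ij.1 ij.2 : V) g z| + 1).
have K0 : 0 <= K by apply: sumr_ge0 => ij _; rewrite addr_ge0.
have DK ij y : `|y - z| < r -> U y /\ `|'D_(delta_mx ij.1 ij.2 : V) g y| <= K.
  rewrite lt_min distrC => /andP[y1 y2]; split; first exact: H2.
  apply: le_trans (H1 y y1 ij) _.
  by rewrite /K (bigD1 ij) //= lerDl sumr_ge0 // => kl _; rewrite addr_ge0.
exists r, (K * #|{: 'I_p * 'I_q}|%:R); split; first by rewrite lt_min r10.
  by rewrite mulr_ge0.
move=> a b az bz.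
(* The entries listed in s are taken from b, the others from a. *)
pose mix (s : seq ('I_p * 'I_q)) : V :=
  \matrix_(i, j) if (i, j) \in s then b i j else a i j.
have ball_coord (y : V) : (forall i j, y i j = a i j \/ y i j = b i j \/
    (exists2 th : R, 0 <= th <= 1 & y i j = a i j + th * (b i j - a i j))) -> `|y - z| < r.
  move=> H; pose m := Num.max `|a - z| `|b - z|.
  apply: (@le_lt_trans _ _ m); last by rewrite gt_max az.
  have am : `|a - z| <= m by rewrite le_max lexx.
  have bm : `|b - z| <= m by rewrite le_max lexx orbT.
  apply: norm_le_coord => [|i j]; first exact: le_trans am.
  have := coord_le_norm (a - z) i j; have := coord_le_norm (b - z) i j; rewrite !mxE.
  case: (H i j) => [->|[->|[th /andP[th0 th1] ->]]]; [linear|linear|].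
  rewrite !ler_norml => /andP[b1 b2] /andP[a1 a2].
  by apply/andP; split; nonlinear.
have step s : `|g (mix s) - g a| <= (size s)%:R * (K * `|b - a|).
  elim: s => [|[i j] s IH].
    by rewrite mul0r (_ : mix [::] = a) ?subrr ?normr0 //; apply/matrixP => k l; rewrite mxE.
  rewrite /= -natr1 mulrDl mul1r.
  suff H : `|g (mix ((i, j) :: s)) - g (mix s)| <= K * `|b - a|.
    have := ler_normD (g (mix s) - g a) (g (mix ((i, j) :: s)) - g (mix s)).
    by rewrite addrC addrA subrK; linear.
  have [ijs|ijs] := boolP ((i, j) \in s).
    have -> : mix ((i, j) :: s) = mix s.
      apply/matrixP => k l; rewrite !mxE inE; case: eqP => [[-> ->]|//].
      by rewrite ijs.
    by rewrite subrr normr0 mulr_ge0.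
  pose d : V := delta_mx i j; pose h := b i j - a i j.
  have mixE : mix ((i, j) :: s) = mix s + h *: d.
    apply/matrixP => k l; rewrite !mxE inE xpair_eqE.
    case: eqP => [->|_] /=; last by rewrite mulr0 addr0.
    case: eqP => [->|_] /=; last by rewrite mulr0 addr0.
    by rewrite (negPf ijs) /h mulr1 addrC subrK.
  have hba : `|h| <= `|b - a| by have := coord_le_norm (b - a) i j; rewrite !mxE.
  pose y (th : R) := mix s + (th * h) *: d.
  have yz th : 0 <= th <= 1 -> `|y th - z| < r.
    move=> th01; apply: ball_coord => k l; rewrite /y !mxE.
    case: eqP => [->|_] /=; last by rewrite mulr0 addr0; case: ifP; auto.
    case: eqP => [->|_] /=; last by rewrite mulr0 addr0; case: ifP; auto.
    by right; right; exists th => //; rewrite (negPf ijs) mulr1.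
  have yd (A : set R) th : 0 <= th <= 1 ->
      has_deriv_in A (fun th => g (y th)) th (h *: 'D_d g (y th)).
    move=> th01; have [Uy _] := DK (i, j) _ (yz th th01).
    have [dg _] := gC1 d; have dgy := dg _ Uy.
    have /has_deriv_inP H := @derivable_line g (mix s) d (th * h) setT dgy.
    apply/has_deriv_inP => e e0.
    have h1 : 0 < `|h| + 1 by rewrite ltr_wpDl.
    have [eta eta0 {}H] := H (e / (`|h| + 1)) (divr_gt0 e0 h1).
    exists (eta / (`|h| + 1)) => [|v _ vth]; first by rewrite divr_gt0.
    have := H (v * h) I; rewrite -mulrBl -(scalerA _ _ ('D_d g _)) => hh.
    apply: le_trans (hh _) _.
      rewrite normrM; apply: (@le_lt_trans _ _ (`|v - th| * (`|h| + 1))); first by rewrite ler_wpM2l ?lerDl.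
      by rewrite -ltr_pdivlMr.
    rewrite normrM [`|v - th| * _]mulrC mulrA ler_wpM2r // mulrAC ler_pdivrMr //.
    by rewrite ler_wpM2l ?lerDl // ltW.
  have := @norm_mean_value_le R p q 0 1 (fun th => g (y th)) (K * `|b - a|) ler01 (mulr_ge0 K0 (normr_ge0 _)).
  rewrite subr0 mulr1 /y mul1r mul0r scale0r addr0 -mixE; apply.
    apply/within_continuousE => th; rewrite /= in_itv /= => th01.
    exact: has_deriv_in_continuous (yd _ th th01).
  move=> th th0 th1; have th01 : 0 <= th <= 1 by rewrite !ltW.
  exists (h *: 'D_d g (y th)); first exact: yd.
  rewrite normrZ mulrC; apply: ler_pM => //.
  by have [_] := DK (i, j) _ (yz th th01).
have := step (enum {: 'I_p * 'I_q}); rewrite -cardE.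
have -> : mix (enum {: 'I_p * 'I_q}) = b by apply/matrixP => i j; rewrite mxE mem_enum.
by rewrite mulrCA mulrA.
Qed.

End stratified_uniqueness.

(** * Uniqueness of stratified solutions *)

Section stratified_P3.
Variables (R : realType) (p q : nat).
Local Notation V := 'M[R]_(p, q).
Variable f : V -> V.

Lemma lipschitz_abs_continuous (A : set R) (x : R -> V) (C : R) : 0 <= C ->
  (forall s t, A s -> A t -> s <= t -> `|x t - x s| <= C * (t - s)) ->
  abs_continuous_on A x.
Proof.
move=> C0 lip e e0; exists (e / (C + 1)); first by rewrite divr_gt0 // ltr_wpDl.
move=> m a b abA _; rewrite ltr_pdivlMr ?ltr_wpDl // => h; apply: le_lt_trans h.
rewrite mulrC mulr_sumr; apply: ler_sum => i _; have [Aa Ab ab] := abA i.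
apply: le_trans (lip _ _ Aa Ab ab) _; rewrite ler_wpM2r ?subr_ge0 //; linear.
Qed.

Lemma classical_lipschitz C (a b : R) x : (forall y, `|f y| <= C) ->
  {within `[a, b], continuous x} -> classical_on f `]a, b[ x ->
  forall s t, a <= s -> s <= t -> t <= b -> `|x t - x s| <= C * (t - s).
Proof.
move=> fC xc xcl s t as_ st tb.
have C0 : 0 <= C by exact: le_trans (fC 0).
have sub : `[s, t] `<=` `[a, b].
  by move=> v; rewrite /= !in_itv /= => /andP[sv vt]; linear.
apply: norm_mean_value_le => //; first exact: within_continuous_sub xc.
move=> r sr rt; exists (f (x r)) => //.
have sub' : `]s, t[ `<=` `]a, b[.
  by move=> v; rewrite /= !in_itv /= => /andP[sv vt]; linear.
by apply: (has_deriv_in_sub sub'); apply: xcl; apply: sub'; rewrite /= in_itv /= sr.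
Qed.

Variable S : stratification_data R p q.
Hypothesis SP : is_stratification f S.

(** The start of a type II piece is the only time of the piece at which the
    state lies in the type II cell; at later times it lies in the type I cell that
    is entered. *)
Lemma stratified_germ x t : global (stratified_sol f S) x -> 0 <= t ->
  exists (eta : R) (i : nat), [/\ 0 < eta, {within `[t, t + eta], continuous x},
    classical_on f `]t, t + eta[ x, cells S i & cell S i (x t) /\
    ((typeI S i /\ forall r, t < r -> r < t + eta -> cell S i (x r)) \/
     (typeII S i /\ forall r, t < r -> r < t + eta -> cell S (next_cell S i) (x r)))].
Proof.
move=> xP t0; have T0 : 0 < t + 1 by rewrite ltr_wpDl.
have [_ _ [UI DI] _ HII] := SP.
have [xc _ [l [tau [i [gr H]]]]] := xP _ T0.
have tT : t < t + 1 by rewrite ltrDl.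
have [k kl /andP[kt tk]] := grid_locate gr t0 tT.
have [ck cI cII] := H k kl.
pose eta := tau k.+1 - t.
have etaE : t + eta = tau k.+1 by rewrite /eta addrC subrK.
have xce : {within `[t, t + eta], continuous x}.
  have kT : tau k.+1 <= t + 1 by have := grid_le gr kl (leqnn l); have [_ -> _] := gr.
  apply: within_continuous_sub xc => r; rewrite /= !in_itv etaE /= => /andP[tr rk].
  by linear.
have sub : `]t, t + eta[ `<=` `]tau k, tau k.+1[.
  by move=> r; rewrite /= !in_itv etaE /= => /andP[tr rk]; linear.
have subI : `]t, t + eta[ `<=` `[tau k, tau k.+1[ by apply: subset_trans sub _; exact: subset_itv_oo_co.
have eta0 : 0 < eta by rewrite subr_gt0.
have [Ik|IIk] : (typeI S `|` typeII S) (i k) by rewrite UI.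
  have [xcl xin] := cI Ik; exists eta, (i k); split=> //.
    by move=> r tr; apply: (has_deriv_in_sub subI); apply: xcl; exact: subI.
  split; first by apply: xin; rewrite in_itv /= kt.
  left; split=> // r tr; rewrite etaE => rk; apply: xin; rewrite in_itv /=; linear.
have [xk xcl xin] := cII IIk.
have xcle : classical_on f `]t, t + eta[ x.
  by move=> r tr; apply: (has_deriv_in_sub sub); apply: xcl; exact: sub.
move: kt; rewrite le_eqVlt => /orP[/eqP kt|kt].
  exists eta, (i k); split=> //; split; first by rewrite -kt.
  by right; split=> // r tr; rewrite etaE => rk; apply: xin; rewrite in_itv /= rk kt tr.
have [nI _] := HII _ IIk.
have cn : cells S (next_cell S (i k)) by rewrite -UI; left.
exists eta, (next_cell S (i k)); split=> //; split; first by apply: xin; rewrite in_itv /= kt.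
by left; split=> // r tr; rewrite etaE => rk; apply: xin; rewrite in_itv /= rk (lt_trans kt).
Qed.

(** In a type I cell the field coincides with a smooth map, which is Lipschitz
    near x t. *)
Lemma typeI_local_unique (C : R) (x y : R -> V) (t eta : R) i : (forall z, `|f z| <= C) -> 0 < eta ->
  {within `[t, t + eta], continuous x} -> {within `[t, t + eta], continuous y} ->
  classical_on f `]t, t + eta[ x -> classical_on f `]t, t + eta[ y ->
  typeI S i -> cell S i (x t) ->
  (forall r, t < r -> r < t + eta -> cell S i (x r)) ->
  (forall r, t < r -> r < t + eta -> cell S i (y r)) ->
  x t = y t -> exists2 eta' : R, 0 < eta' & forall r, t <= r -> r < t + eta' -> x r = y r.
Proof.
move=> fC eta0 xc yc xcl ycl Ii xi xin yin xy.
have [_ _ _ HI _] := SP; have [_ fsmooth] := HI i Ii.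
have [U [g [oU Ux gs gf]]] := fsmooth _ xi.
have [r0 [L [r00 L0 gL]]] := C1_locally_lipschitz oU Ux (gs 1%N).
have /nbhs_normP[r1 /= r10 HU] : nbhs (x t) U by exact: open_nbhs_nbhs.
pose d := Num.min r0 r1.
have d0 : 0 < d by rewrite lt_min r00.
have tin : `[t, t + eta]%classic t by rewrite /= in_itv /= lexx lerDl ltW.
have [e1 e10 H1] := (within_continuousE _ _).1 xc t tin d d0.
have [e2 e20 H2] := (within_continuousE _ _).1 yc t tin d d0.
pose e := Num.min eta (Num.min e1 e2).
have ee : e <= eta by rewrite ge_min lexx.
have e0 : 0 < e by rewrite !lt_min eta0 e10.
have near r : t <= r -> r < t + e -> `|x r - x t| < d /\ `|y r - x t| < d.
  move=> tr re; have rt : `|r - t| < e by rewrite ger0_norm ?subr_ge0 //; linear.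
  have rin : `[t, t + eta]%classic r by rewrite /= in_itv /=; linear.
  move: rt; rewrite {1}/e lt_min [X in _ && X]lt_min => /and3P[_ re1 re2].
  by split; [exact: H1 | rewrite xy; exact: H2].
have sub : `[t, t + e] `<=` `[t, t + eta].
  by move=> r; rewrite /= !in_itv /= ; linear.
have sub' : `]t, t + e[ `<=` `]t, t + eta[.
  by move=> r; rewrite /= !in_itv /= ; linear.
exists e => // r tr rte.
apply: (classical_unique (f := f) (b := t + e) L0 fC
  (within_continuous_sub sub xc) (within_continuous_sub sub yc) _ _ _ xy tr (ltW rte)).
- by move=> s /sub' ts; apply: (has_deriv_in_sub sub'); exact: xcl.
- by move=> s /sub' ts; apply: (has_deriv_in_sub sub'); exact: ycl.
move=> s ts ste; have [xs ys] := near s (ltW ts) ste.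
have se : s < t + eta by linear.
have inU z : `|z - x t| < d -> U z.
  by move=> zt; apply: HU; rewrite /= distrC (lt_le_trans zt) // ge_min lexx orbT.
rewrite -(gf _ (inU _ xs) (xin s ts se)) -(gf _ (inU _ ys) (yin s ts se)).
by apply: gL; [apply: lt_le_trans ys _ | apply: lt_le_trans xs _]; rewrite ge_min lexx.
Qed.

Lemma shifted_entering_curve (C : R) (x : R -> V) (t eta e : R) (M : set V) : (forall z, `|f z| <= C) ->
  0 < e -> e <= eta ->
  {within `[t, t + eta], continuous x} -> classical_on f `]t, t + eta[ x ->
  (forall r, t < r -> r < t + eta -> M (x r)) ->
  entering_curve f M (x t) e (fun r => x (r + t)).
Proof.
move=> fC e0 ee xc xcl xM.
have C0 : 0 <= C by exact: le_trans (fC 0).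
split.
- apply: (lipschitz_abs_continuous C0) => s r; rewrite /= !in_itv /= => /andP[s0 se] /andP[r0 re] sr.
  have -> : r - s = r + t - (s + t) by ring.
  by apply: (classical_lipschitz fC xc xcl); linear.
- by rewrite add0r.
- by move=> r; rewrite in_itv /= => /andP[r0 re]; apply: xM; linear.
- move=> r; rewrite /= in_itv /= => /andP[r0 re].
  have rin : `]t, t + eta[%classic (r + t) by rewrite /= in_itv /=; linear.
  apply: has_deriv_in_sub ((has_deriv_in_shift _ _ _ _ _).2 (xcl _ rin)) => s.
  by rewrite /= !in_itv /= ; linear.
Qed.

(** Two solutions that agree up to time s start from the same cell, since cells
    are disjoint.  If it is of type I they agree a little further by
    [typeI_local_unique], and if it is of type II by the uniqueness of the entering
    curve.  Continuity carries the agreement to limits of times. *)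
Lemma stratified_unique C x y : (forall z, `|f z| <= C) ->
  global (stratified_sol f S) x -> global (stratified_sol f S) y -> x 0 = y 0 ->
  forall t, 0 <= t -> x t = y t.
Proof.
move=> fC xP yP xy0 t t0.
have [[_ _ disj _] _ [UI DI] _ HII] := SP.
have T0 : 0 < t + 1 by rewrite ltr_wpDl.
apply: (real_induction (P := fun t => x t = y t) (a := 0) (b := t + 1)) => //; last 1 first.
- by rewrite lerDl.
- move=> s s0 sT IH.
  have [e1 [i [e10 xc xcl ci [xi Hx]]]] := stratified_germ xP s0.
  have [e2 [j [e20 yc ycl cj [yj Hy]]]] := stratified_germ yP s0.
  have xys : x s = y s by apply: IH.
  have ij : i = j.
    apply: contrapT => nij; have := disj _ _ ci cj nij.
    by rewrite -subset0 => /(_ (x s)); apply; split=> //; rewrite xys.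
  pose e := Num.min e1 e2; have e0 : 0 < e by rewrite lt_min e10.
  have ee1 : e <= e1 by rewrite ge_min lexx.
  have ee2 : e <= e2 by rewrite ge_min lexx orbT.
  have subc (b : R) : e <= b -> `[s, s + e] `<=` `[s, s + b].
    by move=> eb r; rewrite /= !in_itv /= ; linear.
  have subo (b : R) : e <= b -> `]s, s + e[ `<=` `]s, s + b[.
    by move=> eb r; rewrite /= !in_itv /= ; linear.
  have {}xc := within_continuous_sub (subc _ ee1) xc.
  have {}yc := within_continuous_sub (subc _ ee2) yc.
  have {}xcl : classical_on f `]s, s + e[ x.
    by move=> r re; apply: (has_deriv_in_sub (subo _ ee1)); apply: xcl; exact: subo re.
  have {}ycl : classical_on f `]s, s + e[ y.
    by move=> r re; apply: (has_deriv_in_sub (subo _ ee2)); apply: ycl; exact: subo re.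
  subst j.
  have excl : typeI S i -> typeII S i -> False.
    by move=> h1 h2; have : (typeI S `&` typeII S) i by []; rewrite DI.
  case: Hx Hy => [[Ii Hx]|[IIi Hx]] [[Ij Hy]|[IIj Hy]]; [|by case: (excl Ii IIj)|by case: (excl Ij IIi)|].
    apply: (typeI_local_unique fC e0 xc yc xcl ycl Ii xi) => // r sr re.
      by apply: Hx => //; linear.
    by apply: Hy => //; linear.
  have [_ /(_ _ xi)[e3 [xi0 [e30 _ uniq]]]] := HII i IIi.
  pose e' := Num.min e e3; have e'0 : 0 < e' by rewrite lt_min e0.
  have e'e : e' <= e by rewrite ge_min lexx.
  have e'3 : 0 < e' <= e3 by rewrite e'0 ge_min lexx orbT.
  have ex : entering_curve f (cell S (next_cell S i)) (x s) e' (fun r => x (r + s)).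
    by apply: (shifted_entering_curve fC e'0 e'e xc xcl) => r sr re; apply: Hx => //; linear.
  have ey : entering_curve f (cell S (next_cell S i)) (x s) e' (fun r => y (r + s)).
    by rewrite xys; apply: (shifted_entering_curve fC e'0 e'e yc ycl) => r sr re; apply: Hy => //; linear.
  exists e' => // r sr re.
  have rin : r - s \in `[0, e'[ by rewrite in_itv /=; linear.
  by have := uniq e' _ e'3 ex _ rin; have := uniq e' _ e'3 ey _ rin; rewrite subrK => -> ->.
- move=> s s0 sT IH.
  have cont z : global (stratified_sol f S) z -> {within `[0, t + 1], continuous z}.
    by move=> zP; have [] := zP _ T0.
  apply/eqP; rewrite -subr_eq0 -normr_le0; apply/ler_addgt0Pr => e e0; rewrite add0r.
  have e20 : 0 < e / 2 by rewrite divr_gt0.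
  have sin : `[0, t + 1]%classic s by rewrite /= in_itv /= ltW.
  have [e1 e10 H1] := (within_continuousE _ _).1 (cont _ xP) s sin _ e20.
  have [e2 e200 H2] := (within_continuousE _ _).1 (cont _ yP) s sin _ e20.
  pose d := Num.min (s / 2) (Num.min (e1 / 2) (e2 / 2)).
  have d0 : 0 < d by rewrite !lt_min !divr_gt0.
  have [ds d1 d2] : [/\ d <= s / 2, d <= e1 / 2 & d <= e2 / 2].
    by rewrite !ge_min !lexx !orbT.
  have rin : `[0, t + 1]%classic (s - d) by rewrite /= in_itv /=; linear.
  have rd : `|s - d - s| = d by rewrite addrAC subrr add0r normrN gtr0_norm.
  have h1 := H1 _ rin; have h2 := H2 _ rin; rewrite rd in h1 h2.
  have E : x (s - d) = y (s - d) by apply: IH; linear.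
  have -> : x s - y s = (y (s - d) - y s) - (x (s - d) - x s).
    by rewrite E; apply/matrixP => k l; rewrite !mxE; ring.
  apply: le_trans (ler_normB _ _) _.
  have {}h1 := h1 ltac:(linear); have {}h2 := h2 ltac:(linear).
  linear.
Qed.

End stratified_P3.

(** * Derivatives have the intermediate value property *)

Section darboux.
Variables (R : realType) (p q : nat).
Local Notation V := 'M[R]_(p, q).
Variable f : V -> V.

Lemma pairing_within_continuous (A : set R) (x : R -> V) w :
  {within A, continuous x} -> {within A, continuous (fun r => pairing w (x r))}.
Proof.
move=> /within_continuousE xc; apply/subspace_continuousP => t At.
apply/cvgrPdist_lt => e e0.
have m1 : 0 < mass w + 1 by rewrite ltr_wpDl // mass_ge0.
have [eta eta0 H] := xc t At _ (divr_gt0 e0 m1).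
exists eta => //= s /=; rewrite distrC => st As; rewrite distrC -pairingB.
apply: le_lt_trans (pairing_le _ _) _.
have := H s As st; rewrite ltr_pdivlMr //; have := normr_ge0 (x s - x t); linear.
Qed.

(** The value m is reached at a minimum of <w, x r> - m r on [a, b], which is
    interior because of the signs of its slopes at the end points. *)
Lemma darboux (a b m : R) (x : R -> V) w : a < b -> classical_on f `[a, b] x ->
  pairing w (f (x a)) < m -> m < pairing w (f (x b)) ->
  exists r, [/\ a < r, r < b & pairing w (f (x r)) = m].
Proof.
move=> ab xcl ha hb.
(* The slope of k is positive at b and negative at a. *)
pose k r := pairing w (x r) - m * r.
have kc : {within `[a, b], continuous k}.
  have mc : {within `[a, b], continuous (fun r : R => m * r)}.
    by apply: continuous_subspaceT => r; apply: cvgM; [exact: cvg_cst | exact: cvg_id].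
  have pc := pairing_within_continuous (w := w) (classical_continuous xcl).
  by move=> r; apply: cvgB; [exact: pc | exact: mc].
have [c cab kmin] := EVT_min (ltW ab) kc.
have cab' : `[a, b]%classic c by [].
move: cab; rewrite in_itv /= => /andP[ac cb].
pose v := pairing w (f (x c)).
have slope e : 0 < e -> exists2 eta : R, 0 < eta & forall s, a <= s -> s <= b ->
    `|s - c| < eta -> `|k s - k c - (s - c) * (v - m)| <= e * `|s - c|.
  move=> e0; have m1 : 0 < mass w + 1 by rewrite ltr_wpDl // mass_ge0.
  have /has_deriv_inP /(_ _ (divr_gt0 e0 m1))[eta eta0 H] := xcl c cab'.
  exists eta => // s as_ sb /(H s) h.
  have -> : k s - k c - (s - c) * (v - m) = pairing w (x s - x c - (s - c) *: f (x c)).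
    by rewrite !pairingB pairingZ /k /v; ring.
  apply: le_trans (pairing_le _ _) _.
  have {}h := h ltac:(by rewrite /= in_itv /= as_).
  apply: (@le_trans _ _ ((mass w + 1) * (e / (mass w + 1) * `|s - c|))).
    by apply: ler_pM => //; [exact: mass_ge0 | rewrite lerDl].
  by rewrite mulrA [_ * (e / _)]mulrC divfK ?gt_eqF.
have right : c < b -> m <= v.
  move=> cltb; rewrite leNgt; apply/negP => vm.
  have e0 : 0 < (m - v) / 2 by linear.
  have [eta eta0 H] := slope _ e0.
  pose d := Num.min (b - c) (eta / 2).
  have d0 : 0 < d by rewrite lt_min subr_gt0 cltb divr_gt0.
  have [db de] : d <= b - c /\ d <= eta / 2 by rewrite !ge_min !lexx !orbT.
  have E : c + d - c = d by ring.
  have := H (c + d); rewrite E (gtr0_norm d0) ler_norml => h.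
  have := kmin (c + d); rewrite in_itv /= => h'.
  have /andP[_ h1] := h ltac:(linear) ltac:(linear) ltac:(linear).
  have h2 := h' ltac:(linear).
  nonlinear.
have left : a < c -> v <= m.
  move=> altc; rewrite leNgt; apply/negP => vm.
  have e0 : 0 < (v - m) / 2 by linear.
  have [eta eta0 H] := slope _ e0.
  pose d := Num.min (c - a) (eta / 2).
  have d0 : 0 < d by rewrite lt_min subr_gt0 altc divr_gt0.
  have [db de] : d <= c - a /\ d <= eta / 2 by rewrite !ge_min !lexx !orbT.
  have E : c - d - c = - d by ring.
  have := H (c - d); rewrite E normrN (gtr0_norm d0) ler_norml => h.
  have := kmin (c - d); rewrite in_itv /= => h'.
  have /andP[_ h1] := h ltac:(linear) ltac:(linear) ltac:(linear).
  have h2 := h' ltac:(linear).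
  nonlinear.
exists c.
have ac' : a < c.
  move: ac; rewrite le_eqVlt => /orP[/eqP E|//].
  by have := right; rewrite /v -E => /(_ ab); linear.
have cb' : c < b.
  move: cb; rewrite le_eqVlt => /orP[/eqP E|//].
  by have := left; rewrite /v E => /(_ ab); linear.
by split=> //; apply/eqP; rewrite eq_le left // right.
Qed.

End darboux.

(** * The interaction graph along a classical solution *)

Section classical_graph.
Variables (R : realType) (n N : nat) (phi : 'I_N -> 'I_N -> R -> R).
Hypothesis phiP : interaction phi.
Local Notation V := 'M[R]_(N, n).
Local Notation f := (opinion_field phi).

Definition rdist (y : V) i j : R := enorm (row i y - row j y).

(** Close to X, pairs within range at X stay within range.  A pair at distance
    exactly 1 in X that comes within range lowers the scalar product of X and the
    field by a fixed amount, because phi is positive at 1; all the other terms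
    hardly vary.  So one number m tells whether there are new interactions. *)
Lemma near_interactions (X : V) : exists m : R, \forall y \near X,
  (forall i j, rdist X i j < 1 -> rdist y i j < 1) /\
  if `[< exists i j, 1 <= rdist X i j /\ rdist y i j < 1 >]
  then pairing X (f y) < m else m < pairing X (f y).
Proof.
have [L L0 HL] := interaction_bounds phiP.
pose T i j (y : V) := weight phi y i j * pairing (row i X - row j X) (row i y - row j y).
have fT y : pairing X (f y) *+ 2 = - \sum_i \sum_j T i j y.
  rewrite (pairing_field phiP) -sumrN; apply: eq_bigr => i _; rewrite -sumrN.
  by apply: eq_bigr => j _; rewrite -(opprB (row i y)) pairingNr mulrN.
have p1 i j : 0 < phi i j 1 by have [/andP[]] := HL i j 1 ltac:(by rewrite ler01 lexx).
(* A positive lower bound for all the phi i j at 1. *)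
pose b := (1 + \sum_(ij : 'I_N * 'I_N) (phi ij.1 ij.2 1)^-1)^-1.
have b0 : 0 < b.
  by rewrite invr_gt0 ltr_pwDl // sumr_ge0 // => ij _; rewrite invr_ge0 ltW.
have bp i j : b <= phi i j 1.
  rewrite -[leRHS]invrK lef_pV2 ?posrE ?invr_gt0 //; last first.
    by rewrite ltr_pwDl // sumr_ge0 // => ij _; rewrite invr_ge0 ltW.
  rewrite (bigD1 (i, j)) //= addrCA lerDl addr_ge0 // sumr_ge0 // => ij _.
  by rewrite invr_ge0 ltW.
pose e := b / 8 / (N * N).+1%:R.
have N0 : 0 < (N * N).+1%:R :> R by rewrite ltr0n.
have e0 : 0 < e by rewrite !divr_gt0.
exists (pairing X (f X) - b / 8).
have active_near (ij : 'I_N * 'I_N) : \forall y \near X,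
    (rdist X ij.1 ij.2 < 1 -> rdist y ij.1 ij.2 < 1 /\ `|T ij.1 ij.2 y - T ij.1 ij.2 X| < e) /\
    (1 <= rdist X ij.1 ij.2 -> rdist y ij.1 ij.2 < 1 -> b / 2 <= T ij.1 ij.2 y).
  case: ij => i j /=.
  have [d1|d1] := ltP (rdist X i j) 1; last first.
    have e1 : 0 < Num.min (1 / 4) (b / (4 * L)).
      by rewrite lt_min !divr_gt0 // mulr_gt0.
    have q0 : 0 < 1 / 4 :> R by rewrite divr_gt0.
    near=> y; split=> // _ y1.
    have : `|rdist y i j - rdist X i j| < Num.min (1 / 4) (b / (4 * L)).
      by near: y; exact: row_enorm_continuous.
    rewrite lt_min => /andP[_ h2].
    have : `|pairing (row i X - row j X) (row i y - row j y) - pairing (row i X - row j X) (row i X - row j X)| < 1 / 4.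
      by near: y; exact: row_pairing_continuous.
    rewrite -enorm_sqr -/(rdist X i j) => h3.
    have h4 : 3 / 4 <= pairing (row i X - row j X) (row i y - row j y).
      by move: h3; rewrite ltr_norml; nonlinear.
    have dX1 : 0 <= rdist y i j <= 1 by rewrite enorm_ge0 ltW.
    have [_ lip] := HL i j _ dX1; have := lip 1; rewrite ler01 lexx => /(_ isT) h5.
    have h6 : L * `|rdist y i j - 1| < b / 4.
      rewrite mulrC -ltr_pdivlMr // -mulrA -invfM.
      apply: le_lt_trans h2; rewrite !ler0_norm; linear.
    have := bp i j; move: h5; rewrite ler_norml => /andP[h5 _] h7.
    have h8 : 3 / 4 * b <= phi i j (rdist y i j) by linear.
    rewrite /T /weight /cutoff -/(rdist y i j) y1.
    nonlinear.
  have gc : pairing (row i X - row j X) (row i y - row j y) @[y --> X]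
      --> pairing (row i X - row j X) (row i X - row j X).
    apply/(@cvgrPdist_lt _ _ _ (nbhs X) (nbhs_filter X)) => e' e'0.
    by apply: filterS (row_pairing_continuous (row i X - row j X) i j X e'0) => y; rewrite distrC.
  have wc : weight phi y i j @[y --> X] --> weight phi X i j.
    apply/(@cvgrPdist_lt _ _ _ (nbhs X) (nbhs_filter X)) => e' e'0.
    have e1 : 0 < Num.min (1 - rdist X i j) (e' / L) by rewrite lt_min subr_gt0 d1 divr_gt0.
    apply: filterS (row_enorm_continuous i j X e1) => y.
    rewrite lt_min -!/(rdist _ i j) => /andP[h1 h2].
    have y1 : rdist y i j < 1 by move: h1; rewrite ltr_norml; linear.
    rewrite /weight /cutoff -!/(rdist _ i j) y1 d1.
    have dX1 : 0 <= rdist X i j <= 1 by rewrite enorm_ge0 ltW.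
    have [_ lip] := HL i j _ dX1.
    apply: le_lt_trans (lip (rdist y i j) _) _; first by rewrite enorm_ge0 ltW.
    by rewrite distrC mulrC -ltr_pdivlMr.
  have Tc : T i j y @[y --> X] --> T i j X by exact: (@cvgM _ _ (nbhs X) (nbhs_filter X) _ _ _ _ wc gc).
  have e1 : 0 < 1 - rdist X i j by rewrite subr_gt0.
  near=> y; split=> //.
  move=> _; split.
    have : `|rdist y i j - rdist X i j| < 1 - rdist X i j.
      by near: y; exact: row_enorm_continuous.
    by rewrite ltr_norml; linear.
  by rewrite distrC; near: y; exact: ((@cvgrPdist_lt _ _ _ (nbhs X) (nbhs_filter X) _ _).1 Tc e e0).
have := @filter_forall _ _ (fun ij y => (rdist X ij.1 ij.2 < 1 -> rdist y ij.1 ij.2 < 1 /\ `|T ij.1 ij.2 y - T ij.1 ij.2 X| < e) /\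
    (1 <= rdist X ij.1 ij.2 -> rdist y ij.1 ij.2 < 1 -> b / 2 <= T ij.1 ij.2 y)) _ (nbhs_filter X) active_near.
apply: filterS => y H; split=> [i j|].
  by have [/= h _] := H (i, j); move=> /h[].
have TX0 i j : 1 <= rdist X i j -> T i j X = 0.
  by move=> d1; rewrite /T /weight /cutoff -/(rdist X i j) ltNge d1 mul0r.
have Ty0 i j : 1 <= rdist y i j -> T i j y = 0.
  by move=> d1; rewrite /T /weight /cutoff -/(rdist y i j) ltNge d1 mul0r.
have Tlow i j : T i j X - e <= T i j y.
  have [/= h1 h2] := H (i, j).
  have [/h1[_]|d1] := ltP (rdist X i j) 1; first by rewrite ltr_norml; linear.
  rewrite TX0 //; have [/(h2 d1)|/Ty0 ->] := ltP (rdist y i j) 1; linear.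
have eN : (\sum_(i < N) \sum_(j < N) e) <= b / 8.
  rewrite !sumr_const !card_ord -mulrnA -[leLHS]mulr_natl.
  have : (N * N).+1%:R * e = b / 8 by rewrite mulrC divfK ?gt_eqF.
  by rewrite -natr1; linear.
have := fT y; have := fT X; rewrite !(mulr2n (pairing _ _)) => fX fy.
case: asboolP => [[i [j [Xij yij]]]|none].
  have : \sum_k \sum_l T k l X - \sum_(k < N) \sum_(l < N) e + b / 2 <= \sum_k \sum_l T k l y.
    rewrite -sumrB (bigD1 i) //= [leRHS](bigD1 i) //= addrAC lerD //; last first.
      by apply: ler_sum => k _; rewrite -sumrB; apply: ler_sum => l _.
    rewrite -sumrB (bigD1 j) //= [leRHS](bigD1 j) //= addrAC lerD //; last exact: ler_sum.
    by rewrite TX0 //; have [/= _ /(_ Xij yij)] := H (i, j); linear.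
  linear.
have : \sum_k \sum_l T k l y <= \sum_k \sum_l T k l X + \sum_(k < N) \sum_(l < N) e.
  rewrite -big_split; apply: ler_sum => k _; rewrite -big_split; apply: ler_sum => l _ /=.
  have [/= h1 h2] := H (k, l).
  have [/h1[_]|d1] := ltP (rdist X k l) 1; first by rewrite ltr_norml; linear.
  rewrite TX0 // Ty0; first by rewrite add0r ltW.
  rewrite leNgt; apply/negP => y1.
  by apply: none; exists k, l.
linear.
Unshelve. all: by end_near. Qed.

End classical_graph.

Lemma P3_of_uniqueness (R : realType) (n N : nat) (sol : (R -> 'M[R]_(N, n)) -> Prop) :
  (forall x y, sol x -> sol y -> x 0 = y 0 -> forall t, 0 <= t -> x t = y t) -> P3 sol.
Proof.
move=> uniq x y xoo yoo xs ys xy0 /tends_toP xl /tends_toP yl.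
apply/eqP; rewrite -subr_eq0 -normr_le0; apply/ler_addgt0Pr => e e0; rewrite add0r.
have e20 : 0 < e / 2 by rewrite divr_gt0.
have [T1 T10 H1] := xl _ e20; have [T2 T20 H2] := yl _ e20.
pose t := Num.max T1 T2.
have h1 := H1 t; have h2 := H2 t; rewrite !le_max !lexx ?orbT in h1 h2.
have {}h1 := h1 isT; have {}h2 := h2 isT.
have E : x t = y t by apply: uniq => //; rewrite le_max T10.
have -> : xoo - yoo = (y t - yoo) - (x t - xoo).
  by rewrite E; apply/matrixP => i j; rewrite !mxE; ring.
by apply: le_trans (ler_normB _ _) _; linear.
Qed.

(** * Uniqueness of classical solutions *)

Section classical_P3.
Variables (R : realType) (n N : nat) (phi : 'I_N -> 'I_N -> R -> R).
Hypothesis phiP : interaction phi.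
Local Notation V := 'M[R]_(N, n).
Local Notation f := (opinion_field phi : V -> V).

(** The scalar product of the fixed vector x t with x has a derivative that is
    above the number m of [near_interactions] at t, would be below it at a time with
    a new interaction, and is never equal to it.  This contradicts [darboux]. *)
Lemma graph_locally_constant x t : global (classical_sol f) x -> 0 <= t ->
  exists2 eta : R, 0 < eta & forall r, 0 <= r -> `|r - t| < eta ->
    forall i j, (rdist (x r) i j < 1) = (rdist (x t) i j < 1).
Proof.
move=> xP t0; have T0 : 0 < t + 1 by rewrite ltr_wpDl.
have xcl := xP _ T0; have xc := classical_continuous xcl.
have [m /nbhs_normP[d /= d0 near]] := near_interactions phiP (x t).
have tin : `[0, t + 1]%classic t by rewrite /= in_itv /= t0; linear.
have [e1 e10 He] := (within_continuousE _ _).1 xc t tin d d0.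
pose eta := Num.min 1 e1.
have eta0 : 0 < eta by rewrite lt_min ltr01.
have rin r : 0 <= r -> `|r - t| < eta -> `[0, t + 1]%classic r.
  by move=> r0; rewrite lt_min ltr_norml => /andP[rt _]; rewrite /= in_itv /=; linear.
have {}near r : 0 <= r -> `|r - t| < eta ->
    (forall i j, rdist (x t) i j < 1 -> rdist (x r) i j < 1) /\
    if `[< exists i j, 1 <= rdist (x t) i j /\ rdist (x r) i j < 1 >]
    then pairing (x t) (f (x r)) < m else m < pairing (x t) (f (x r)).
  move=> r0 rt; apply: near => /=; rewrite distrC; apply: He; first exact: rin.
  by move: rt; rewrite lt_min => /andP[].
have self : m < pairing (x t) (f (x t)).
  have [_] := near t t0 ltac:(by rewrite subrr normr0).
  by case: asboolP => [[i [j [h1 h2]]]|//]; move: h1; rewrite leNgt h2.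
exists eta => // r r0 rt; have [act] := near r r0 rt.
case: asboolP => [new below|none _ i j]; last first.
  apply/idP/idP; last exact: act.
  by move=> rij; apply: contrapT => /negP; rewrite -leNgt => tij; apply: none; exists i, j.
exfalso.
have gap s : 0 <= s -> `|s - t| < eta -> pairing (x t) (f (x s)) <> m.
  by move=> s0 st; have [_] := near s s0 st; case: ifP => _ + E; rewrite E ltxx.
have sub a b : 0 <= a -> b <= t + 1 -> `[a, b] `<=` `[0, t + 1].
  by move=> a0 b0 s; rewrite /= !in_itv /= ; linear.
have xclab a b : 0 <= a -> b <= t + 1 -> classical_on f `[a, b] x.
  by move=> a0 b0 s sab; apply: (has_deriv_in_sub (sub a b a0 b0)); apply: xcl; exact: sub sab.
have r1 : r <= t + 1 by have := rin r r0 rt; rewrite /= in_itv /= => /andP[].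
have [tr|rlt|E] := ltgtP t r; last by move: below; rewrite -E; linear.
- have [|||s [ts sr sm]] := @darboux R N n f t r (- m) x (- x t) tr.
  + exact: xclab.
  + by rewrite pairingNl ltrN2.
  + by rewrite pairingNl ltrN2.
  move: rt; rewrite gtr0_norm ?subr_gt0 // => rt.
  apply: (gap s); [linear | by rewrite gtr0_norm ?subr_gt0 //; linear |].
  by apply/oppr_inj; rewrite -pairingNl.
- have [|||s [rs st sm]] := @darboux R N n f r t m x (x t) rlt => //.
    by apply: xclab => //; linear.
  move: rt; rewrite ltr0_norm ?subr_lt0 // => rt.
  by apply: (gap s) sm; [linear | rewrite ltr0_norm ?subr_lt0 //; linear].
Qed.

Lemma graph_constant x t : global (classical_sol f) x -> 0 <= t ->
  forall i j, (rdist (x t) i j < 1) = (rdist (x 0) i j < 1).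
Proof.
move=> xP t0.
apply: (cousin (Q := fun s u => forall i j, (rdist (x u) i j < 1) = (rdist (x s) i j < 1)) t0).
  move=> r r0 rt; have [eta eta0 H] := graph_locally_constant xP r0.
  exists eta => // s u s0 sr ru ut us i j.
  rewrite (H u) ?(H s) //; [|linear|].
    by rewrite ler0_norm ?subr_le0 //; linear.
  by rewrite ger0_norm ?subr_ge0 //; linear.
by move=> s r u _ _ _ _ H1 H2 i j; rewrite H2 H1.
Qed.

Lemma field_lipschitz_on_graph : exists2 K : R, 0 <= K & forall y z : V,
  (forall i j, (rdist y i j < 1) = (rdist z i j < 1)) -> `|f y - f z| <= K * `|y - z|.
Proof.
have [L L0 HL] := interaction_bounds phiP.
pose k : R := L * 2 + L * ((1 * n)%:R * 2).
have k0 : 0 <= k by rewrite !(addr_ge0, mulr_ge0) // ltW.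
exists (N%:R * k) => [|y z yz]; first by rewrite mulr_ge0.
apply: norm_le_coord => [|i c]; first by rewrite !mulr_ge0.
have -> : (f y - f z) i c =
    \sum_j (weight phi y i j * (y j c - y i c) - weight phi z i j * (z j c - z i c)).
  by rewrite sumrB -!opinion_fieldE !mxE.
apply: le_trans (ler_norm_sum _ _ _) _.
apply: (@le_trans _ _ (\sum_(j < N) (k * `|y - z|))); last first.
  by rewrite sumr_const card_ord -mulrA mulr_natl.
apply: ler_sum => j _; rewrite /weight /cutoff -!/(rdist _ i j) (yz i j).
have [z1|_] := ltP (rdist z i j) 1; last first.
  by rewrite !mul0r subrr normr0 mulr_ge0.
have y1 : rdist y i j < 1 by rewrite yz.
have y01 : 0 <= rdist y i j <= 1 by rewrite enorm_ge0 ltW.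
have z01 : 0 <= rdist z i j <= 1 by rewrite enorm_ge0 ltW.
have [/andP[py pyL] lip] := HL i j _ y01; have {}lip := lip _ z01.
set a := phi i j (rdist y i j) in py pyL lip *; set b := phi i j (rdist z i j) in lip *.
have dd := row_diff_le i j z y.
have dc : `|(y j c - y i c) - (z j c - z i c)| <= 2 * `|y - z|.
  have -> : y j c - y i c - (z j c - z i c) = - (y i c - y j c - (z i c - z j c)) by ring.
  rewrite normrN; apply: le_trans dd.
  by have := coord_le_norm (row i y - row j y - (row i z - row j z)) 0 c; rewrite !mxE.
have zc : `|z j c - z i c| <= 1.
  have := coord_le_enorm (row j z - row i z) 0 c; rewrite row_distC !mxE.
  by move=> h; apply: le_trans h (ltW z1).
have dr : `|rdist y i j - rdist z i j| <= (1 * n)%:R * (2 * `|y - z|).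
  apply: le_trans (enorm_dist _ _) _; apply: le_trans (enorm_le_norm _) _.
  by rewrite ler_wpM2l.
have -> : a * (y j c - y i c) - b * (z j c - z i c) =
    a * ((y j c - y i c) - (z j c - z i c)) + (a - b) * (z j c - z i c) by ring.
apply: le_trans (ler_normD _ _) _; rewrite !normrM (gtr0_norm py) /k mulrDl.
apply: lerD.
  by rewrite -mulrA; apply: ler_pM => //; exact: ltW.
rewrite -[leRHS]mulr1; apply: ler_pM => //.
by apply: le_trans lip _; rewrite -!mulrA ler_wpM2l // ltW.
Qed.

Lemma classical_P3 : P3 (global (classical_sol f)).
Proof.
apply: P3_of_uniqueness => x y xP yP xy0 t t0.
have [K K0 fK] := field_lipschitz_on_graph.
have [C C0 fC] := opinion_field_bounded n phiP.
have T0 : 0 < t + 1 by rewrite ltr_wpDl.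
have sub : `]0, t + 1[ `<=` `[0, t + 1] by exact: subset_itv_oo_cc.
have clo z : global (classical_sol f) z -> classical_on f `]0, t + 1[ z.
  by move=> zP s st; apply: (has_deriv_in_sub sub); apply: zP => //; exact: sub.
apply: (classical_unique K0 fC (classical_continuous (xP _ T0))
  (classical_continuous (yP _ T0)) (clo _ xP) (clo _ yP) _ xy0 t0).
  by move=> r r0 _; apply: fK => i j; rewrite !graph_constant ?ltW // xy0.
by rewrite lerDl.
Qed.

End classical_P3.

(** * Affine and exponential maps are smooth *)

Section smooth_maps.
Variable R : realType.

Lemma Ck_on_ext (U W : normedModType R) k (A : set U) (g h : U -> W) : open A ->
  (forall x, A x -> g x = h x) -> Ck_on k A g -> Ck_on k A h.
Proof.
move=> oA; elim: k g h => [|k IH] g h gh.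
  move=> gC x Ax.
  have nx : \forall y \near x, g y = h y.
    by apply: filterS (open_nbhs_nbhs (conj oA Ax)) => y; exact: gh.
  rewrite /prop_for /continuous_at -(gh x Ax); apply: cvg_trans (gC x Ax).
  exact: near_eq_cvg nx.
move=> gC v; have [gd gD] := gC v; split.
  move=> x Ax; apply: near_eq_derivable (gd x Ax).
  by apply: filterS (open_nbhs_nbhs (conj oA Ax)) => y; exact: gh.
apply: IH gD => x Ax; apply: near_eq_derive.
by apply: filterS (open_nbhs_nbhs (conj oA Ax)) => y; exact: gh.
Qed.

Lemma affine_is_derive (U W : normedModType R) (g l : U -> W) :
  (forall h z v, g (h *: v + z) = h *: l v + g z) ->
  forall z v, is_derive z v g (l v).
Proof.
move=> gl z v.
have E : (fun h : R => h^-1 *: ((g \o shift z) (h *: v) - g z)) @ 0^' --> l v.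
  apply: (@cvg_trans _ ((fun=> l v) @ (0 : R)^')); last exact: cvg_cst.
  apply: near_eq_cvg; near=> h.
  have h0 : h != 0 by near: h; exact: nbhs_dnbhs_neq.
  by rewrite /= gl addrK scalerA mulVf // scale1r.
apply: DeriveDef; first exact: (cvgP (l v)).
by rewrite /derive; apply: cvg_lim.
Unshelve. all: by end_near. Qed.

(** The directional derivatives of an affine map are constant, hence affine
    again with zero linear part; the bound K replaces continuity of the linear
    part. *)
Lemma affine_smooth (U W : normedModType R) (A : set U) (g l : U -> W) K :
  (forall h z v, g (h *: v + z) = h *: l v + g z) ->
  (forall v, `|l v| <= K * `|v|) -> smooth_on A g.
Proof.
move=> gl lK k; elim: k g l K gl lK => [|k IH] g l K gl lK.
  move=> x _; apply/cvgrPdist_lt => e e0.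
  have K0 : 0 < `|K| + 1 by rewrite ltr_wpDl.
  apply/nbhs_normP; exists (e / (`|K| + 1)) => /=; first by rewrite divr_gt0.
  move=> y /=; rewrite ltr_pdivlMr // => xy.
  have -> : g x - g y = l (x - y).
    by have := gl 1 y (x - y); rewrite !scale1r subrK => ->; rewrite addrK.
  apply: le_lt_trans (lK _) _; apply: le_lt_trans xy.
  rewrite mulrC ler_wpM2l // (le_trans (ler_norm _)) // lerDl //.
move=> v; split=> [x _|]; first by have [] := affine_is_derive gl x v.
have -> : (fun x => 'D_v g x) = fun=> l v.
  by apply/funext => x; have [_ ->] := affine_is_derive gl x v.
apply: (IH _ (fun=> 0) 0) => [h z u|u]; first by rewrite scaler0 add0r.
by rewrite normr0 mul0r.
Qed.

Lemma has_deriv_is_derive (p q : nat) (x : R -> 'M[R]_(p, q)) (t : R) w :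
  has_deriv_in setT x t w -> forall v, is_derive t v x (v *: w).
Proof.
move=> /has_deriv_inP H v.
have E : (fun h : R => h^-1 *: ((x \o shift t) (h *: v) - x t)) @ 0^' --> v *: w.
  apply/cvgrPdist_le => e e0.
  have v1 : 0 < `|v| + 1 by rewrite ltr_wpDl.
  have [eta eta0 {}H] := H _ (divr_gt0 e0 v1).
  exists (eta / (`|v| + 1)) => /=; first by rewrite divr_gt0.
  move=> h /=; rewrite sub0r normrN => hv h0.
  have hv' : `|h * v| < eta.
    rewrite normrM; apply: (@le_lt_trans _ _ (`|h| * (`|v| + 1))).
      by rewrite ler_wpM2l ?lerDl.
    by rewrite -ltr_pdivlMr.
  have := H (h * v + t) I; rewrite addrK => /(_ hv') Hh.
  have -> : v *: w - h^-1 *: (x (h *: v + t) - x t) =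
      - (h^-1 *: (x (h * v + t) - x t - (h * v) *: w)).
    by rewrite [in RHS]scalerBr scalerA mulrA mulVf // mul1r opprB.
  rewrite normrN normrZ normfV ler_pdivrMl ?normr_gt0 //.
  apply: le_trans Hh _; rewrite normrM mulrCA ler_wpM2l //.
  by rewrite mulrAC ler_pdivrMr // ler_wpM2l ?lerDl // ltW.
apply: DeriveDef; first exact: (cvgP (v *: w)).
by rewrite /derive; apply: cvg_lim.
Qed.

Lemma exp_has_deriv (p q : nat) (A : set R) (k c t : R) (B : 'M[R]_(p, q)) :
  has_deriv_in A (fun r : R => (c * expR (k * r)) *: B) t ((k * c * expR (k * t)) *: B).
Proof.
apply/has_deriv_inP => e e0.
have [/cvgrPdist_le H dE] := is_derive_expR (k * t).
pose K := (`|k| + 1) * (`|c| + 1) * (`|B| + 1).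
have k1 : 0 < `|k| + 1 by rewrite ltr_wpDl.
have c1 : 0 < `|c| + 1 by rewrite ltr_wpDl.
have B1 : 0 < `|B| + 1 by rewrite ltr_wpDl.
have K0 : 0 < K by rewrite !mulr_gt0.
have [eta /= eta0 {}H] := H _ (divr_gt0 e0 K0).
exists (eta / (`|k| + 1)) => [|s _ st]; first by rewrite divr_gt0.
have sk : `|k * s - k * t| < eta.
  rewrite -mulrBr normrM; apply: (@le_lt_trans _ _ ((`|k| + 1) * `|s - t|)).
    by rewrite ler_wpM2r ?lerDl.
  by rewrite mulrC -ltr_pdivlMr.
have {H} : `|expR (k * s) - expR (k * t) - (k * s - k * t) * expR (k * t)| <=
    e / K * `|k * s - k * t|.
  have [->|sNt] := eqVneq (k * s) (k * t).
    by rewrite !subrr mul0r subr0 normr0 mulr0.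
  have st0 : k * s - k * t != 0 by rewrite subr_eq0.
  have := H (k * s - k * t); rewrite /= sub0r normrN => /(_ sk st0).
  rewrite -/('D_1 expR (k * t)) dE [_ *: 1]mulr1 subrK => h.
  have -> : expR (k * s) - expR (k * t) - (k * s - k * t) * expR (k * t) =
    - ((k * s - k * t) * (expR (k * t) - (k * s - k * t)^-1 * (expR (k * s) - expR (k * t)))).
    by field.
  by rewrite normrN normrM mulrC ler_wpM2r.
rewrite -mulrBr normrM => h.
have -> : (c * expR (k * s)) *: B - (c * expR (k * t)) *: B - (s - t) *: (k * c * expR (k * t) *: B) =
    (c * (expR (k * s) - expR (k * t) - k * (s - t) * expR (k * t))) *: B.
  by apply/matrixP => i j; rewrite !mxE; ring.
rewrite normrZ normrM.
apply: (@le_trans _ _ ((`|c| + 1) * (e / K * ((`|k| + 1) * `|s - t|)) * (`|B| + 1))).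
  apply: ler_pM; rewrite ?mulr_ge0 ?lerDl //.
  apply: ler_pM; rewrite ?lerDl //; apply: le_trans h _.
  rewrite ler_wpM2l //; first by rewrite divr_ge0 // ltW.
  by rewrite ler_wpM2r // lerDl.
suff -> : (`|c| + 1) * (e / K * ((`|k| + 1) * `|s - t|)) * (`|B| + 1) = e * `|s - t| by [].
by rewrite /K; field; rewrite !gt_eqF.
Qed.

Lemma exp_smooth (p q : nat) (A : set R) (k : R) (B : 'M[R]_(p, q)) :
  smooth_on A (fun r : R => expR (k * r) *: B).
Proof.
move=> m; have -> : (fun r : R => expR (k * r) *: B) = (fun r => (1 * expR (k * r)) *: B).
  by apply/funext => r; rewrite mul1r.
move: (1 : R) => c; elim: m c => [|m IH] c.
  move=> r _; apply/cvgrPdist_lt => e e0.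
  have [eta eta0 H] := has_deriv_in_continuous (@exp_has_deriv p q setT k c r B) e0.
  by exists eta => //= s /= rs; rewrite distrC; apply: H => //; rewrite distrC.
move=> v; split=> [r _|].
  by have [] := has_deriv_is_derive (@exp_has_deriv p q setT k c r B) v.
have -> : (fun r => 'D_v (fun r : R => (c * expR (k * r)) *: B) r) =
    fun r => ((v * (k * c)) * expR (k * r)) *: B.
  apply/funext => r; have [_ ->] := has_deriv_is_derive (@exp_has_deriv p q setT k c r B) v.
  by rewrite scalerA mulrA.
exact: IH.
Qed.

End smooth_maps.

(** * Two agents at distance one *)

Section two_agents.
Variable R : realType.
Local Notation V := 'M[R]_(2, 1).

Lemma constant_interaction N (c : R) : 0 < c ->
  interaction (fun _ _ : 'I_N => fun _ : R => c).
Proof.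
move=> c0 i j; split=> //.
exists 0; split=> // M M0 [r s] _ /=; rewrite subrr normr0.
by rewrite mulr_ge0 // ltW.
Qed.

Definition unit_phi (i j : 'I_2) (r : R) : R := 1.

Lemma unit_phiP : interaction unit_phi.
Proof. exact: constant_interaction ltr01. Qed.

Local Notation f := (opinion_field unit_phi : V -> V).

Definition gap (y : V) : R := y ord_max ord0 - y ord0 ord0.

Lemma enorm11 (v : 'M[R]_1) : enorm v = `|v ord0 ord0|.
Proof. by rewrite /enorm !big_ord1 sqrtr_sqr. Qed.

Lemma ord2E (i : 'I_2) : i = ord0 \/ i = ord_max.
Proof.
case: i => -[|[|k]] h //; [left|right]; exact: val_inj.
Qed.

(** The field of two agents within range. *)
Definition pull (y : V) : V := \matrix_(i, j) (y (rev_ord i) j - y i j).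

Lemma rdist2 (y : V) : rdist y ord0 ord_max = `|gap y|.
Proof. by rewrite /rdist enorm11 !mxE distrC. Qed.

Lemma two_fieldE y : f y = if `|gap y| < 1 then pull y else 0.
Proof.
have w01 : weight unit_phi y ord0 ord_max = (`|gap y| < 1)%R%:R.
  by rewrite /weight /cutoff -/(rdist _ _ _) rdist2; case: ifP.
have w10 : weight unit_phi y ord_max ord0 = (`|gap y| < 1)%R%:R.
  by rewrite (weightC unit_phiP) w01.
have r0 : rev_ord (ord0 : 'I_2) = ord_max by exact: val_inj.
have r1 : rev_ord (ord_max : 'I_2) = ord0 by exact: val_inj.
apply/matrixP => i j; rewrite opinion_fieldE big_ord_recl big_ord1.
have -> : lift ord0 ord0 = ord_max :> 'I_2 by exact: val_inj.
case: (ord2E i) => ->; rewrite subrr mulr0 ?addr0 ?add0r ?w01 ?w10;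
  by case: ifP => _; rewrite !mxE ?mul1r ?mul0r ?r0 ?r1.
Qed.

(** Two agents at distance exactly 1: there they do not interact, but they do
    after any small decrease of the distance. *)
Definition dipole : V := \matrix_(i, j) (if i == ord0 then - (1 / 2) else 1 / 2).

Lemma gapD (y z : V) : gap (y + z) = gap y + gap z.
Proof. by rewrite /gap !mxE; ring. Qed.

Lemma gapZ a (y : V) : gap (a *: y) = a * gap y.
Proof. by rewrite /gap !mxE; ring. Qed.

Lemma gap_dipole : gap dipole = 1.
Proof. by rewrite /gap !mxE /=; linear. Qed.

Lemma pull_dipole a : pull (a *: dipole) = (- 2 * a) *: dipole.
Proof.
apply/matrixP => i j; rewrite !mxE; case: (ord2E i) => -> /=; linear.
Qed.

Lemma pullD (y z : V) : pull (y + z) = pull y + pull z.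
Proof. by apply/matrixP => i j; rewrite !mxE; ring. Qed.

(** From the dipole, follows the attraction at all times, although it is
    switched off at time 0. *)
Definition merging (t : R) : V := expR (- 2 * t) *: dipole.

Lemma merging_deriv (A : set R) (t : R) :
  has_deriv_in A merging t (pull (merging t)).
Proof.
have := @exp_has_deriv R 2 1 A (- 2) 1 t dipole.
rewrite mulr1 /merging pull_dipole.
by under eq_fun do rewrite mul1r.
Qed.

Lemma gap_merging t : 0 < t -> `|gap (merging t)| < 1.
Proof.
move=> t0; rewrite gapZ gap_dipole mulr1 ger0_norm ?expR_ge0 //.
by rewrite expR_lt1; linear.
Qed.

Lemma merging_classical (A : set R) : (forall t, A t -> 0 < t) -> classical_on f A merging.
Proof.
by move=> A0 t At; rewrite two_fieldE gap_merging ?A0 //; exact: merging_deriv.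
Qed.

Lemma merging0 : merging 0 = dipole.
Proof. by rewrite /merging mulr0 expR0 scale1r. Qed.

Lemma merging_continuous (A : set R) : {within A, continuous merging}.
Proof.
by apply/within_continuousE => t At; exact: has_deriv_in_continuous (@merging_deriv A t).
Qed.

Lemma merging_lim : tends_to merging 0.
Proof.
apply/tends_toP => e e0; exists e^-1 => [|t te]; first by rewrite invr_ge0 ltW.
rewrite subr0 normrZ ger0_norm ?expR_ge0 //.
have : `|dipole| <= 1 / 2.
  by apply: norm_le_coord => [|i j]; rewrite ?mxE ?divr_ge0 //; case: ifP => _; rewrite ?normrN ger0_norm ?divr_ge0.
have E : 0 <= expR (- 2 * t) := expR_ge0 _.
have ti : 0 < e^-1 by rewrite invr_gt0.
have t0 := lt_le_trans ti te.
have H : expR (- 2 * t) < e.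
  rewrite mulNr expRN -[ltRHS]invrK ltf_pV2 ?posrE ?expR_gt0 //.
  apply: le_lt_trans te _; apply: lt_le_trans (expR_ge1Dx _); linear.
move=> h; have := normr_ge0 dipole; nonlinear.
Qed.

Lemma dipole_const_lim : tends_to (fun _ : R => dipole) dipole.
Proof. exact: cvg_cst. Qed.

Lemma dipole_neq0 : dipole <> 0.
Proof.
move=> E; have := gap_dipole; rewrite E /gap !mxE subrr => /eqP.
by rewrite eq_sym oner_eq0.
Qed.

Lemma cst_deriv (A : set R) t : has_deriv_in A (fun _ : R => dipole) t 0.
Proof.
apply/has_deriv_inP => e e0; exists 1 => // s _ _.
by rewrite subrr scaler0 subr0 normr0 mulr_ge0 // ltW.
Qed.

Lemma dipole_still : f dipole = 0.
Proof. by rewrite two_fieldE gap_dipole normr1 ltxx. Qed.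

Lemma dipole_classical (A : set R) : classical_on f A (fun=> dipole).
Proof. by move=> t At; rewrite dipole_still; exact: cst_deriv. Qed.

Lemma merging_abs_continuous T : abs_continuous_on `[0, T] merging.
Proof.
have [C C0 fC] := opinion_field_bounded 1 unit_phiP.
apply: (lipschitz_abs_continuous (ltW C0)) => s t; rewrite /= !in_itv /= => /andP[s0 sT] /andP[t0 tT] st.
apply: (classical_lipschitz (a := 0) (b := T) fC _ _ s0 st tT); first exact: merging_continuous.
by apply: merging_classical => r; rewrite /= in_itv /= => /andP[].
Qed.

Lemma cst_abs_continuous (A : set R) : abs_continuous_on A (fun=> dipole).
Proof.
apply: (lipschitz_abs_continuous (lexx 0)) => s t _ _ _.
by rewrite subrr normr0 mul0r.
Qed.

Lemma ae_nonzero (P : R -> Prop) : (forall t, t != 0 -> P t) ->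
  {ae (@lebesgue_measure R), forall t, P t}.
Proof.
move=> H; exists [set 0]; split=> //; first exact: lebesgue_measure_set1.
move=> t /= nP; apply: contrapT => t0; apply: nP; apply: H; exact/eqP.
Qed.

(** Rest at the dipole is a solution, and [merging] fails the equation at time
    0 only. *)
Lemma caratheodory_not_P3 : in_general_not_P3 (@caratheodory_sol R).
Proof.
exists 1%N, 2%N, unit_phi; split; first by split=> //; exact: unit_phiP.
exists (fun=> dipole), merging, dipole, 0; split; split=> //.
- move=> T T0; split; first exact: cst_abs_continuous.
  by apply: ae_nonzero => t _ _; rewrite dipole_still; exact: cst_deriv.
- move=> T T0; split; first exact: merging_abs_continuous.
  apply: ae_nonzero => t t0; rewrite in_itv /= => /andP[t1 _].
  have tpos : 0 < t by rewrite lt_neqAle eq_sym t0.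
  by rewrite two_fieldE gap_merging //; exact: merging_deriv.
- by rewrite merging0.
- exact: dipole_const_lim.
- exact: merging_lim.
- exact: dipole_neq0.
Qed.

End two_agents.

(** * Null sets have dense complement *)

Section null_sets.
Variable R : realType.
Local Notation V := 'M[R]_(2, 1).
Local Notation mu := (@lebesgue_measure R).
Local Notation mu2 := (mu \x mu)%E.

Lemma lebesgue_measure_segment (a b : R) : a <= b -> mu `[a, b] = (b - a)%:E.
Proof.
move=> ab; rewrite lebesgue_measure_itv /= lte_fin; case: ltP => // h.
have -> : b = a by apply/eqP; rewrite eq_le ab h.
by rewrite subrr.
Qed.

Lemma plane_segment (a b c d : R) : a <= b -> c <= d ->
  mu2 (`[a, b] `*` `[c, d]) = ((b - a) * (d - c))%:E.
Proof.
move=> ab cd; by rewrite product_measure1E // EFinM; congr (_ * _)%E; exact: lebesgue_measure_segment.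
Qed.

(** A null set contains no square: the rectangles of a countable cover have
    total area at least that of the square. *)
Lemma null_dense (Z : set V) z (r : R) : lebesgue_null Z -> 0 < r ->
  exists2 y, ~ Z y & `|y - z| < r.
Proof.
move=> Z0 r0; apply: contrapT => full.
pose h := r / 2; have h0 : 0 < h by rewrite divr_gt0.
have inZ y : `|y - z| <= h -> Z y.
  by move=> yz; apply: contrapT => nZ; apply: full; exists y => //; rewrite /h in yz; linear.
suff : ((r * r)%:E <= lebesgue_outer Z)%E by rewrite Z0 lee_fin; nonlinear.
apply/ereal_infP => _ [a [b [ab Zab ->]]].
pose z0 := z ord0 ord0; pose z1 := z ord_max ord0.
pose C : set (R * R) := `[z0 - h, z0 + h] `*` `[z1 - h, z1 + h].
pose F k : set (R * R) := `[a k ord0 ord0, b k ord0 ord0] `*` `[a k ord_max ord0, b k ord_max ord0].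
have FV k : mu2 (F k) = (box_volume (a k) (b k))%:E.
  rewrite plane_segment // /box_volume big_ord_recl !big_ord1.
  by have -> : lift ord0 ord0 = ord_max :> 'I_2 by exact: val_inj.
have <- : mu2 C = (r * r)%:E by rewrite plane_segment /h; [congr EFin; field | linear | linear].
have -> : (\sum_(0 <= k <oo) (box_volume (a k) (b k))%:E)%E = (\sum_(0 <= k <oo) mu2 (F k))%E.
  by apply: eq_eseriesr => k _; rewrite FV.
apply: measure_sigma_subadditive.
- by move=> k; apply: measurableX.
- exact: measurableX.
move=> [s t] [/=]; rewrite !in_itv /= => sz tz.
pose y : V := \matrix_(i, j) if i == ord0 then s else t.
have [|k _ yk] := Zab y.
  apply: inZ; apply: norm_le_coord => [|i j]; first exact: ltW.
  rewrite !mxE (ord1 j) ler_norml; case: (ord2E i) => -> /=; rewrite -/z0 -/z1;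
    move: sz tz => /andP[? ?] /andP[? ?]; linear.
exists k => //; have := yk ord0 ord0; have := yk ord_max ord0.
by rewrite /F !mxE /= !in_itv.
Qed.

End null_sets.

(** * Filippov solutions of the two agent system *)

Section filippov_example.
Variable R : realType.
Local Notation V := 'M[R]_(2, 1).
Local Notation f := (opinion_field (@unit_phi R) : V -> V).

Lemma gap_le (y : V) : `|gap y| <= 2 * `|y|.
Proof.
rewrite /gap; have := ler_normB (y ord_max ord0) (y ord0 ord0).
by have := coord_le_norm y ord_max ord0; have := coord_le_norm y ord0 ord0; linear.
Qed.

Lemma pull_le (y : V) : `|pull y| <= 2 * `|y|.
Proof.
apply: norm_le_coord => [|i j]; first by rewrite mulr_ge0.
rewrite mxE; have := ler_normB (y (rev_ord i) j) (y i j).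
by have := coord_le_norm y (rev_ord i) j; have := coord_le_norm y i j; linear.
Qed.

Lemma gapN (y : V) : gap (- y) = - gap y.
Proof. by rewrite -scaleN1r gapZ mulN1r. Qed.

Lemma pullN (y : V) : pull (- y) = - pull y.
Proof. by apply/matrixP => i j; rewrite !mxE; ring. Qed.

(** If, close to x, there are balls on which f is close to v, these balls are
    not exhausted by a null set. *)
Lemma filippov_limit (x v : V) : (forall d e : R, 0 < d -> 0 < e ->
    exists z r, [/\ 0 < r, `|z - x| + r <= d &
      forall y, `|y - z| < r -> `|f y - v| < e]) ->
  filippov f x v.
Proof.
move=> H d d0 Z Z0 C [[Ccl _] CfB]; apply: Ccl => B /nbhs_normP[e /= e0 eB].
have [z [r [r0 zx fz]]] := H (d / 3) e (divr_gt0 d0 (ltr0n _ 3)) e0.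
have [y nZ yz] := null_dense z Z0 r0.
exists (f y); split; last by apply: eB => /=; rewrite distrC; exact: fz.
apply: CfB; exists y => //; split=> //; rewrite /eball /=.
apply: le_lt_trans (enorm_le_norm _) _.
have := ler_normD (y - z) (z - x); rewrite addrA subrK muln1 => h.
have : `|y - x| < d / 3 by linear.
have := normr_ge0 (y - x); linear.
Qed.

Lemma filippov_dipole : filippov f (@dipole R) 0.
Proof.
apply: filippov_limit => d e d0 e0.
pose a := Num.min 1 (d / 2); have a0 : 0 < a by rewrite lt_min ltr01 divr_gt0.
have ad : a <= d / 2 by rewrite ge_min lexx orbT.
exists ((1 + a) *: @dipole R), (a / 4); split; first by rewrite divr_gt0.
  have -> : (1 + a) *: @dipole R - @dipole R = a *: @dipole R by rewrite scalerDl scale1r addrC addKr.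
  have : `|@dipole R| <= 1 / 2.
    by apply: norm_le_coord => [|i j]; rewrite ?mxE ?divr_ge0 //; case: ifP => _; rewrite ?normrN ger0_norm ?divr_ge0.
  rewrite normrZ gtr0_norm //; nonlinear.
move=> y yz; suff -> : f y = 0 by rewrite subrr normr0.
rewrite two_fieldE ifN // -leNgt.
have := gap_le (y - (1 + a) *: @dipole R).
rewrite gapD gapN gapZ gap_dipole mulr1 ler_norml => /andP[h _].
apply: le_trans (ler_norm _); linear.
Qed.

Lemma filippov_inside (x : V) : `|gap x| < 1 -> filippov f x (pull x).
Proof.
move=> x1; apply: filippov_limit => d e d0 e0.
pose r := Num.min d (Num.min (e / 2) ((1 - `|gap x|) / 2)).
have r0 : 0 < r by rewrite !lt_min d0 !divr_gt0 // subr_gt0.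
exists x, r; split=> //; first by rewrite subrr normr0 add0r ge_min lexx.
move=> y; rewrite !lt_min => /and3P[_ y1 y2].
have : `|gap y| < 1.
  have := gap_le (y - x); rewrite gapD gapN => h.
  have := ler_normD (gap y - gap x) (gap x); rewrite subrK; linear.
rewrite two_fieldE => ->; rewrite -pullN -pullD.
by apply: le_lt_trans (pull_le _) _; linear.
Qed.

Lemma filippov_not_P3 : in_general_not_P3 (@filippov_sol R).
Proof.
exists 1%N, 2%N, (@unit_phi R); split; first by split=> //; exact: unit_phiP.
exists (fun=> @dipole R), (@merging R), (@dipole R), 0; split; split=> //.
- move=> T T0; split; first exact: cst_abs_continuous.
  apply: ae_nonzero => t _ _; exists 0; first exact: cst_deriv.
  exact: filippov_dipole.
- move=> T T0; split; first exact: merging_abs_continuous.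
  apply: ae_nonzero => t t0; rewrite in_itv /= => /andP[t1 _].
  have tpos : 0 < t by rewrite lt_neqAle eq_sym t0.
  exists (pull (merging t)); first exact: merging_deriv.
  by apply: filippov_inside; exact: gap_merging.
- by rewrite merging0.
- exact: dipole_const_lim.
- exact: merging_lim.
- exact: dipole_neq0.
Qed.

Lemma krasovskii_not_P3 : in_general_not_P3 (@krasovskii_sol R).
Proof.
have [n [N [phi [[n0 N0 phiP] [x [y [xoo [yoo [[xs ys xy] lim]]]]]]]]] := filippov_not_P3.
exists n, N, phi; split=> //; exists x, y, xoo, yoo; split=> //; split=> // T T0.
  by apply: filippov_krasovskii => //; exact: xs.
by apply: filippov_krasovskii => //; exact: ys.
Qed.

End filippov_example.

(** * Manifolds and tangent vectors *)

Section cells.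
Variables (R : realType) (p q : nat).
Local Notation V := 'M[R]_(p, q).

Lemma open_manifold (M : set V) : open M -> C1_embedded_manifold (p * q) M.
Proof.
move=> oM; split=> // x Mx; exists M, M, id, id; split; first by split.
have smooth_id : smooth_on M (id : V -> V).
  by apply: (@affine_smooth R V V M id id 1) => [//|v]; rewrite mul1r.
split; [exact: (smooth_id 1%N) | exact: (smooth_id 1%N) | by [] | by [] |].
by move=> y My; split=> // _ k; rewrite leqNgt ltn_ord.
Qed.

Lemma tangent_line (M : set V) (x v : V) (e : R) : 0 < e ->
  (forall t, t \in `]- e, e[ -> M (x + t *: v)) -> tangent_space M x v.
Proof.
move=> e0 H; exists e => //; exists (fun t => x + t *: v).
have aff (h z u : R) : x + (h *: u + z) *: v = h *: (u *: v) + (x + z *: v).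
  by apply/matrixP => i j; rewrite !mxE /GRing.scale /=; ring.
split=> //.
- have sm : smooth_on `]- e, e[ (fun t : R => x + t *: v).
    by apply: (@affine_smooth R R V _ _ (fun u => u *: v) `|v|) => [//|u]; rewrite normrZ mulrC.
  exact: (sm 1%N).
- by rewrite scale0r addr0.
- by have := affine_is_derive aff 0 1; rewrite scale1r.
Qed.

Lemma tangent_zero (M : set V) (x : V) : M x -> tangent_space M x 0.
Proof. by move=> Mx; apply: (tangent_line ltr01) => t _; rewrite scaler0 addr0. Qed.

Lemma smooth_restriction_zero (M : set V) (f : V -> V) :
  (forall x, M x -> f x = 0) -> smooth_restriction M f.
Proof.
move=> f0 x Mx; exists setT, (fun=> 0); split=> //; first exact: openT.
  by apply: (@affine_smooth R V V _ _ (fun=> 0) 0) => [h z v|v]; rewrite ?scaler0 ?addr0 ?normr0 ?mul0r.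
by move=> y _ My; rewrite f0.
Qed.

End cells.

(** * Cells of the two agent system *)

Section two_agent_strata.
Variable R : realType.
Local Notation V := 'M[R]_(2, 1).

Definition inner_cell : set V := [set y | `|gap y| < 1].
Definition outer_cell : set V := [set y | 1 < `|gap y|].
Definition unit_cell : set V := [set y | `|gap y| = 1].

Lemma gap_near (y : V) (e : R) : 0 < e -> \forall z \near y, `|gap z - gap y| < e.
Proof.
move=> e0; apply/nbhs_normP; exists (e / 2) => /=; first by rewrite divr_gt0.
move=> z /=; rewrite distrC => yz; have := gap_le (z - y); rewrite gapD gapN; linear.
Qed.

Lemma inner_open : open inner_cell.
Proof.
rewrite openE => y; rewrite /inner_cell /interior /= => y1.
have e0 : 0 < 1 - `|gap y| by rewrite subr_gt0.
apply: filterS (gap_near y e0) => z /= h.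
have := ler_normD (gap z - gap y) (gap y); rewrite subrK /inner_cell /=; linear.
Qed.

Lemma outer_open : open outer_cell.
Proof.
rewrite openE => y; rewrite /outer_cell /interior /= => y1.
have e0 : 0 < `|gap y| - 1 by rewrite subr_gt0.
apply: filterS (gap_near y e0) => z /= h.
have := ler_normD (gap y - gap z) (gap z); rewrite subrK (distrC (gap y)) /outer_cell /=; linear.
Qed.

Lemma gap_scale_near (y : V) (c : R) (B : set V) : nbhs y B -> `|gap y| = 1 -> 0 < c ->
  exists2 a : R, 0 < a < c & B ((1 - a) *: y) /\ B ((1 + a) *: y).
Proof.
move=> /nbhs_normP[e /= e0 eB] y1 c0.
have y0 : 0 < `|y| + 1 by rewrite ltr_wpDl.
pose a := Num.min (c / 2) (e / 2 / (`|y| + 1)).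
have a0 : 0 < a by rewrite lt_min !divr_gt0.
have ac : a <= c / 2 by rewrite ge_min lexx.
have ae : a * (`|y| + 1) <= e / 2 by rewrite -ler_pdivlMr // ge_min lexx orbT.
have small : a * `|y| < e by have := normr_ge0 y; nonlinear.
exists a; first by rewrite a0 /=; linear.
have -> : (1 - a) *: y = y - a *: y by rewrite scalerBl scale1r.
have -> : (1 + a) *: y = y + a *: y by rewrite scalerDl scale1r.
by split; apply: eB => /=; [rewrite opprB addrC subrK | rewrite opprD addrA subrr add0r normrN];
  rewrite normrZ gtr0_norm.
Qed.

Lemma unit_boundary_inner : unit_cell `<=` boundary inner_cell.
Proof.
move=> y uy; have y1 : `|gap y| = 1 := uy; split; last by move=> /interior_subset; rewrite /inner_cell /= y1 ltxx.
move=> B yB; have [a /andP[a0 a1] [B1 _]] := gap_scale_near yB y1 ltr01.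
exists ((1 - a) *: y); split=> //; rewrite /inner_cell /= gapZ normrM y1 mulr1.
by rewrite ger0_norm; linear.
Qed.

Lemma unit_boundary_outer : unit_cell `<=` boundary outer_cell.
Proof.
move=> y uy; have y1 : `|gap y| = 1 := uy; split; last by move=> /interior_subset; rewrite /outer_cell /= y1 ltxx.
move=> B yB; have [a /andP[a0 a1] [_ B1]] := gap_scale_near yB y1 ltr01.
exists ((1 + a) *: y); split=> //; rewrite /outer_cell /= gapZ normrM y1 mulr1.
by rewrite ger0_norm; linear.
Qed.

Lemma inner_closure y : closure inner_cell y -> `|gap y| <= 1.
Proof.
move=> cy; rewrite leNgt; apply/negP => y1.
have e0 : 0 < `|gap y| - 1 by rewrite subr_gt0.
have [z [z1 zy]] := cy _ (gap_near y e0); rewrite /inner_cell /= in z1 zy.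
have := ler_normD (gap y - gap z) (gap z); rewrite subrK (distrC (gap y)); linear.
Qed.

Lemma outer_closure y : closure outer_cell y -> 1 <= `|gap y|.
Proof.
move=> cy; rewrite leNgt; apply/negP => y1.
have e0 : 0 < 1 - `|gap y| by rewrite subr_gt0.
have [z [z1 zy]] := cy _ (gap_near y e0); rewrite /outer_cell /= in z1 zy.
have := ler_normD (gap z - gap y) (gap y); rewrite subrK; linear.
Qed.

Lemma unit_closure y : closure unit_cell y -> `|gap y| = 1.
Proof.
move=> cy; apply/eqP/negPn/negP => y1.
have e0 : 0 < `| `|gap y| - 1| by rewrite normr_gt0 subr_eq0.
have [z [z1 zy]] := cy _ (gap_near y e0); rewrite /unit_cell /= in z1 zy.
have := ler_dist_dist (gap z) (gap y); rewrite z1 (distrC 1); linear.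
Qed.

(** A chart replaces the coordinate of one agent a by the gap, shifted by the
    gap of x: near x the gap keeps its sign, and the level set becomes a hyperplane.
    The agent a is the one of index 1, as the coordinates of index 1 and more are
    those that vanish on a flat curve. *)
Lemma unit_manifold : C1_embedded_manifold 1 unit_cell.
Proof.
split=> // x ux; have x1 : `|gap x| = 1 := ux.
have [a aE] : exists a : 'I_2, (mxvec_index a ord0 : 'I_(2 * 1)) = 1%N :> nat.
  pose k : 'I_(2 * 1) := Ordinal (isT : (1 < 2 * 1)%N).
  have E : nat_of_ord k = 1%N by [].
  by move: E; case/mxvec_indexP: k => a j; rewrite (ord1 j) => E; exists a.
pose b := rev_ord a; pose sg : R := if a == ord0 then - 1 else 1.
have ba : (b == a) = false by rewrite /b; case: (ord2E a) => ->.
have sg2 : sg * sg = 1 by rewrite /sg; case: ifP => _; ring.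
have sg1 : `|sg| = 1 by rewrite /sg; case: ifP => _; rewrite ?normrN normr1.
have gapE y : gap y = sg * (y a ord0 - y b ord0).
  have r0 : rev_ord (ord0 : 'I_2) = ord_max by exact: val_inj.
  have r1 : rev_ord (ord_max : 'I_2) = ord0 by exact: val_inj.
  by rewrite /gap /sg /b; case: (ord2E a) => ->; rewrite ?r0 ?r1 /=; ring.
pose l1 (v : V) : V := \matrix_(i, j) if i == a then gap v else v i j.
pose l2 (v : V) : V := \matrix_(i, j) if i == a then v b j + sg * v a j else v i j.
pose Phi (y : V) : V := l1 y - gap x *: delta_mx a ord0.
pose Psi (z : V) : V := l2 z + (sg * gap x) *: delta_mx a ord0.
have PhiE y i j : Phi y i j = if i == a then gap y - gap x else y i j.
  by rewrite !mxE (ord1 j); case: eqP => _; rewrite /= ?mulr1 ?mulr0 ?subr0.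
have PsiE z i j : Psi z i j = if i == a then z b j + sg * (z a j + gap x) else z i j.
  by rewrite !mxE (ord1 j) eqxx andbT; case: (i == a); rewrite /= ?mulr1 ?mulr0 ?addr0 //; ring.
have gapPsi z : gap (Psi z) = z a ord0 + gap x.
  rewrite gapE !PsiE eqxx ba addrAC subrr add0r mulrA sg2 mul1r //.
have smooth1 (A : set V) : smooth_on A Phi.
  apply: (@affine_smooth R V V A Phi l1 2) => [h z v|v].
    apply/matrixP => i j; rewrite /Phi !mxE; case: ifP => _; rewrite ?gapD ?gapZ; ring.
  apply: norm_le_coord => [|i j]; first by rewrite mulr_ge0.
  rewrite mxE; case: ifP => _; first exact: gap_le.
  have := coord_le_norm v i j; have := normr_ge0 v; linear.
have smooth2 (A : set V) : smooth_on A Psi.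
  apply: (@affine_smooth R V V A Psi l2 2) => [h z v|v].
    by apply/matrixP => i j; rewrite /Psi !mxE; case: ifP => _; ring.
  apply: norm_le_coord => [|i j]; first by rewrite mulr_ge0.
  rewrite mxE; case: ifP => _.
    have := ler_normD (v b j) (sg * v a j); rewrite normrM sg1 mul1r.
    have := coord_le_norm v a j; have := coord_le_norm v b j; linear.
  have := coord_le_norm v i j; have := normr_ge0 v; linear.
pose U : set V := [set y | `|gap y - gap x| < 1].
pose U' : set V := [set z | `|z a ord0| < 1].
have oU : open U.
  rewrite openE => y; rewrite /U /interior /= => y1.
  have e0 : 0 < 1 - `|gap y - gap x| by rewrite subr_gt0.
  apply: filterS (gap_near y e0) => z h; rewrite /=.
  have := ler_normD (gap z - gap y) (gap y - gap x); rewrite addrA subrK; linear.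
have oU' : open U'.
  rewrite openE => y; rewrite /U' /interior /= => y1.
  suff : \forall z \near (y : V), `|(z : V) a ord0| < 1 by [].
  apply/nbhs_normP; exists (1 - `|y a ord0|) => /=; first by rewrite subr_gt0.
  move=> z /=; have := coord_le_norm (y - z) a ord0; rewrite !mxE => h1 h2.
  have := ler_normD (y a ord0) (- (y a ord0 - z a ord0)); rewrite opprB addrC subrK (distrC (z a ord0)); linear.
have PP y : Psi (Phi y) = y.
  apply/matrixP => i j; rewrite PsiE !PhiE eqxx ba subrK gapE (ord1 j).
  by case: eqP => [->|//]; rewrite mulrA sg2 mul1r addrC subrK.
have PP' z : Phi (Psi z) = z.
  apply/matrixP => i j; rewrite PhiE gapPsi addrK PsiE (ord1 j).
  by case: eqP => [->|].
exists U, U', Phi, Psi; split; first by split=> //; rewrite /U /= subrr normr0.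
split.
- exact: (smooth1 U 1%N).
- exact: (smooth2 U' 1%N).
- by move=> y Uy; split; [rewrite /U' /= PhiE eqxx | exact: PP].
- by move=> z Uz; split; [rewrite /U /= gapPsi addrK | exact: PP'].
move=> y Uy; have {}Uy : `|gap y - gap x| < 1 := Uy; split=> [uy k k1|sl].
  have y1 : `|gap y| = 1 := uy.
  have E : k = mxvec_index a ord0.
    by apply/val_inj/eqP; rewrite [X in _ == X]aE eqn_leq k1 andbT -ltnS; exact: (ltn_ord k).
  rewrite E mxvecE PhiE eqxx.
  by move: Uy x1 y1; case: (ler0P (gap x)); case: (ler0P (gap y)); rewrite ltr_norml; linear.
have := sl (mxvec_index a ord0); rewrite aE => /(_ isT); rewrite mxvecE PhiE eqxx.
by move/eqP; rewrite subr_eq0 => /eqP yx; rewrite /unit_cell /= yx.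
Qed.

(** The field vanishes on the middle cell, where the distance is 1.  Its points
    may rest (type I, for b true) or be the starting points of curves into the
    inner cell (type II, for b false); the cells are the same in both cases. *)
Definition strata (b : bool) : stratification_data R 2 1 :=
  StratificationData (Some 3%N)
    (fun i => if i is 0 then inner_cell else if i is 1 then outer_cell else unit_cell)
    (fun i => if (i < 2)%N then 2%N else 1%N)
    [set i | (i < 2 + b)%N] [set i | (2 + b <= i < 3)%N] (fun=> 0%N).

Lemma cell_cases i : (i < 3)%N -> [\/ i = 0%N, i = 1%N | i = 2%N].
Proof. by case: i => [|[|[|]]] // _; [constructor 1|constructor 2|constructor 3]. Qed.

Lemma strata_stratified b : stratified_set (strata b).
Proof.
split.
- move=> i /cell_cases[] -> /=; [exact: open_manifold inner_open | exact: open_manifold outer_open|].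
  exact: unit_manifold.
- move=> K _; apply: (@sub_finite_set _ _ `I_3); last exact: finite_II.
  by move=> i [].
- move=> i j /cell_cases[] -> /cell_cases[] -> //= _; rewrite -subset0 => y [];
    rewrite /inner_cell /outer_cell /unit_cell /=; linear.
move=> i j /cell_cases[] -> /cell_cases[] -> //= _; rewrite /inner_cell /outer_cell => -[y [yi [yc _]]].
- by have := outer_closure yc; rewrite leNgt yi.
- by have := unit_closure yc; move: yi => /= h1 h2; rewrite h2 ltxx in h1.
- by have := inner_closure yc; rewrite leNgt yi.
- by have := unit_closure yc; move: yi => /= h1 h2; rewrite h2 ltxx in h1.
- by split=> //; exact: unit_boundary_inner.
- by split=> //; exact: unit_boundary_outer.
Qed.

End two_agent_strata.

Arguments inner_cell {R}.
Arguments outer_cell {R}.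
Arguments unit_cell {R}.

(** * Two stratifications of the two agent system *)

Section stratification_example.
Variable R : realType.
Local Notation V := 'M[R]_(2, 1).
Local Notation f := (opinion_field (@unit_phi R) : V -> V).

Lemma abs_continuous_continuous (p q : nat) (A : set R) (x : R -> 'M[R]_(p, q)) :
  abs_continuous_on A x -> {within A, continuous x}.
Proof.
move=> xac; apply/within_continuousE => t At e e0.
have [d d0 H] := xac e e0; exists d => // s As st.
have pair a b : A a -> A b -> a <= b -> b - a < d -> `|x b - x a| < e.
  move=> Aa Ab ab abd; have := H 1%N (fun=> a) (fun=> b).
  rewrite !big_ord1; apply=> // i j; by rewrite (ord1 i) (ord1 j).
have [ts|st'] := leP t s; first by apply: pair => //; rewrite -(ger0_norm (_ : 0 <= s - t)) ?subr_ge0.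
rewrite distrC; apply: pair => //; first exact: ltW.
by move: st; rewrite ltr0_norm ?subr_lt0 // opprB.
Qed.

Lemma inner_rdist (y : V) : inner_cell y -> forall i j, rdist y i j < 1.
Proof.
move=> y1 i j; have dd k : rdist y k k < 1 by rewrite /rdist subrr enorm11 mxE normr0.
have d01 : rdist y ord0 ord_max < 1 by rewrite rdist2.
case: (ord2E i) (ord2E j) => -> [] -> //.
by rewrite /rdist row_distC.
Qed.

(** The flow of the attraction: the centre is fixed and the gap is multiplied
    by exp(- 2 t). *)
Definition contracting (x : V) (t : R) : V :=
  (x - gap x *: @dipole R) + (gap x * expR (- 2 * t)) *: @dipole R.

Lemma gap_contracting x t : gap (contracting x t) = gap x * expR (- 2 * t).
Proof. by rewrite /contracting gapD gapD gapN !gapZ gap_dipole; ring. Qed.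

Lemma contracting0 x : contracting x 0 = x.
Proof. by rewrite /contracting mulr0 expR0 mulr1 subrK. Qed.

Lemma pull_contracting x t :
  pull (contracting x t) = (- 2 * gap x * expR (- 2 * t)) *: @dipole R.
Proof.
apply/matrixP => i j; rewrite !mxE (ord1 j) /gap; case: (ord2E i) => -> /=.
  have -> : rev_ord (ord0 : 'I_2) = ord_max by exact: val_inj.
  by rewrite /=; field.
have -> : rev_ord (ord_max : 'I_2) = ord0 by exact: val_inj.
by rewrite /=; field.
Qed.

Lemma contracting_deriv (A : set R) x t :
  has_deriv_in A (contracting x) t (pull (contracting x t)).
Proof.
rewrite pull_contracting; have /has_deriv_inP H := @exp_has_deriv R 2 1 A (- 2) (gap x) t (@dipole R).
apply/has_deriv_inP => e e0; have [eta eta0 {}H] := H e e0; exists eta => // s As st.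
have aux (a b c : V) : (a + b) - (a + c) = b - c by rewrite opprD addrACA subrr add0r.
by have := H s As st; rewrite /contracting aux mulrAC.
Qed.

Lemma contracting_inner x t : unit_cell x -> 0 < t -> inner_cell (contracting x t).
Proof.
move=> ux t0; have x1 : `|gap x| = 1 := ux.
rewrite /inner_cell /= gap_contracting normrM x1 mul1r ger0_norm ?expR_ge0 //.
by rewrite expR_lt1; linear.
Qed.

Lemma contracting_entering x : unit_cell x ->
  entering_curve f inner_cell x 1 (contracting x).
Proof.
move=> ux; have [C C0 fC] := opinion_field_bounded 1 (@unit_phiP R).
have cl (A : set R) : (forall t, A t -> 0 < t) -> classical_on f A (contracting x).
  move=> A0 t At; have t0 := A0 t At; rewrite two_fieldE (contracting_inner ux t0).
  exact: contracting_deriv.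
split.
- apply: (lipschitz_abs_continuous (ltW C0)) => s t; rewrite /= !in_itv /= => /andP[s0 sT] /andP[t0 tT] st.
  apply: (classical_lipschitz (a := 0) (b := 1) fC _ _ s0 st (ltW tT)).
    by apply/within_continuousE => r Ar; exact: has_deriv_in_continuous (@contracting_deriv `[0, 1] x r).
  by apply: cl => r; rewrite /= in_itv /= => /andP[].
- exact: contracting0.
- by move=> t; rewrite in_itv /= => /andP[t0 _]; exact: contracting_inner.
- by apply: cl => r; rewrite /= in_itv /= => /andP[].
Qed.

(** Inside the inner cell the interaction graph is complete, so the field is
    Lipschitz along both curves. *)
Lemma entering_unique x e' (eta : R -> V) : unit_cell x -> 0 < e' <= 1 ->
  entering_curve f inner_cell x e' eta ->
  forall t, t \in `[0, e'[ -> eta t = contracting x t.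
Proof.
move=> ux /andP[e0 e1] [ac eta0 etain etacl] t; rewrite in_itv /= => /andP[t0 te].
have [C C0 fC] := opinion_field_bounded 1 (@unit_phiP R).
have [K K0 fK] := field_lipschitz_on_graph 1 (@unit_phiP R).
have [acx x0 xin xcl] := contracting_entering ux.
have subc (b : R) : e' <= b -> `[0, t] `<=` `[0, b[.
  by move=> eb r; rewrite /= !in_itv /= ; linear.
have subo (b : R) : e' <= b -> `]0, t[ `<=` `]0, b[.
  by move=> eb r; rewrite /= !in_itv /= ; linear.
apply: (classical_unique (f := f) K0 fC
  (within_continuous_sub (subc _ (lexx _)) (abs_continuous_continuous ac))
  (within_continuous_sub (subc _ e1) (abs_continuous_continuous acx)) _ _ _ _ t0 (lexx t)).
- by move=> r rt; apply: (has_deriv_in_sub (subo _ (lexx _))); apply: etacl; exact: subo rt.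
- by move=> r rt; apply: (has_deriv_in_sub (subo _ e1)); apply: xcl; exact: subo rt.
- move=> r r0 rt; apply: fK => i j; rewrite !inner_rdist //.
    by apply: xin; rewrite in_itv /= r0; linear.
  by apply: etain; rewrite in_itv /= r0; linear.
- by rewrite eta0 x0.
Qed.

Lemma inner_field y : inner_cell y -> f y = pull y.
Proof. by move=> y1; rewrite two_fieldE ifT. Qed.

Lemma not_inner_field y : 1 <= `|gap y| -> f y = 0.
Proof. by move=> y1; rewrite two_fieldE ifN // -leNgt. Qed.

(** The field is linear on the inner cell and 0 on the two others. *)
Lemma strata_is_stratification b : is_stratification f (strata R b).
Proof.
split.
- exact: strata_stratified.
- rewrite -subTset => y _.
  have [y1|y1|y1] := ltgtP (`|gap y|) 1; [exists 0%N|exists 1%N|exists 2%N] => //.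
- split; apply/seteqP; split=> i /=; rewrite /cells /=.
  + by case=> [|/andP[] //]; case: b; lia.
  + by case: b; lia.
  + by case: b; lia.
  + by [].
- move=> i /= ib; have i3 : (i < 3)%N by case: b ib; lia.
  have zero (M : set V) : (forall y, M y -> 1 <= `|gap y|) ->
      (forall x, M x -> tangent_space M x (f x)) /\ smooth_restriction M f.
    move=> M1; split=> [x Mx|]; first by rewrite not_inner_field ?M1 //; exact: tangent_zero.
    by apply: smooth_restriction_zero => x Mx; apply: not_inner_field; exact: M1.
  case/cell_cases: i3 => -> /=; last 2 first.
  + by apply: zero => y /ltW.
  + by apply: zero => y; rewrite /unit_cell /= => ->.
  split=> x x1.
    have x0 : 0 < 2 * `|f x| + 1 by rewrite ltr_wpDl // mulr_ge0.
    have e0 : 0 < (1 - `|gap x|) / (2 * `|f x| + 1) by rewrite divr_gt0 // subr_gt0.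
    apply: (tangent_line e0) => t; rewrite in_itv /= -ltr_norml ltr_pdivlMr // => ht.
    rewrite /inner_cell /= gapD gapZ.
    have := ler_normD (gap x) (t * gap (f x)); rewrite normrM.
    have := gap_le (f x); have := normr_ge0 t; nonlinear.
  exists inner_cell, (@pull R); split=> //; first exact: inner_open.
    apply: (@affine_smooth R V V _ _ (@pull R) 2) => [h z v|v]; last exact: pull_le.
    by apply/matrixP => i' j; rewrite !mxE; ring.
  by move=> y y1 _; rewrite inner_field.
- move=> j /= jb; have -> : j = 2%N by case: b jb; lia.
  split; first by case: b jb.
  move=> x ux; exists 1, (contracting x); split=> //; first exact: contracting_entering.
  by move=> e' eta e'1 etaP t te; exact: entering_unique ux e'1 etaP t te.
Qed.

Lemma cst_smooth (A : set R) (y : V) : smooth_on A (fun _ : R => y).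
Proof.
by apply: (@affine_smooth R R V _ _ (fun=> 0) 0) => [h z v|v]; rewrite ?scaler0 ?add0r ?normr0 ?mul0r.
Qed.

(** From the dipole, one stratification commands rest and the other one
    [merging]. *)
Lemma stratification_dependence :
  exists (n N : nat) (phi : 'I_N -> 'I_N -> R -> R)
          (S S' : stratification_data R N n),
     [/\ (0 < n)%N, (0 < N)%N & interaction phi] /\
     [/\ is_stratification (opinion_field phi) S,
         is_stratification (opinion_field phi) S' &
         distinct_asymptotics (global (stratified_sol (opinion_field phi) S))
                              (global (stratified_sol (opinion_field phi) S'))].
Proof.
exists 1%N, 2%N, (@unit_phi R), (strata R true), (strata R false).
split; first by split=> //; exact: unit_phiP.
split; [exact: strata_is_stratification|exact: strata_is_stratification|].
exists (fun=> @dipole R), (@merging R), (@dipole R), 0; split; last first.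
  by split; [exact: dipole_const_lim | exact: merging_lim | exact: dipole_neq0].
split; last by rewrite merging0.
- move=> T T0; split.
  + by apply/within_continuousE => t _ e e0; exists 1 => // s _ _; rewrite subrr normr0.
  + exists 1%N, (fun k => if k is 0%N then 0 else T); split; first exact: grid_one.
    by move=> k _; exact: cst_smooth.
  + exists 1%N, (fun k => if k is 0%N then 0 else T), (fun=> 2%N); split; first exact: grid_one.
    move=> [|//] _; split=> // _; split=> [|s _]; first exact: dipole_classical.
    by rewrite /= /unit_cell /= gap_dipole normr1.
- move=> T T0; split; first exact: merging_continuous.
  + exists 1%N, (fun k => if k is 0%N then 0 else T); split; first exact: grid_one.
    by move=> k _; exact: exp_smooth.
  + exists 1%N, (fun k => if k is 0%N then 0 else T), (fun=> 2%N); split; first exact: grid_one.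
    move=> [|//] _; split=> // _; split.
    * by rewrite /= /unit_cell /= merging0 gap_dipole normr1.
    * by apply: merging_classical => t; rewrite /= in_itv /= => /andP[].
    * by move=> s; rewrite in_itv /= => /andP[s0 _]; rewrite /inner_cell /= gap_merging.
Qed.

End stratification_example.

(** * Euler polygons *)

Section euler_scheme.
Variables (R : realType) (p q : nat).
Local Notation V := 'M[R]_(p, q).
Variable f : V -> V.

Definition euler_step (h : R) (z : V) : V := z + h *: f z.

Definition euler_node (z0 : V) (h : R) (k : nat) : V := iter k (euler_step h) z0.

Definition euler_polygon (z0 : V) (h : R) (t : R) : V :=
  let k := Num.truncn (t / h) in
  euler_node z0 h k + (t - k%:R * h) *: f (euler_node z0 h k).

Section one_step_size.
Variables (z0 : V) (h : R).
Hypothesis h0 : 0 < h.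
Local Notation X := (euler_node z0 h).
Local Notation y := (euler_polygon z0 h).

Lemma euler_cell k t : k%:R * h <= t -> t <= k.+1%:R * h ->
  y t = X k + (t - k%:R * h) *: f (X k).
Proof.
move=> kt tk; move: tk; rewrite le_eqVlt => /orP[/eqP tk|tk].
  have E : Num.truncn (t / h) = k.+1.
    by apply: truncn_def; rewrite tk mulfK ?gt_eqF // lexx ltr_nat ltnSn.
  rewrite /euler_polygon E tk subrr scale0r addr0 /euler_node iterS -/(X k) /euler_step.
  by congr (_ + _ *: _); rewrite -natr1; ring.
have E : Num.truncn (t / h) = k.
  by apply: truncn_def; rewrite ler_pdivlMr // kt ltr_pdivrMr.
by rewrite /euler_polygon E.
Qed.

Lemma euler_polygon_node k : y (k%:R * h) = X k.
Proof.
rewrite (@euler_cell k) ?subrr ?scale0r ?addr0 //.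
by rewrite ler_wpM2r ?ler_nat // ltW.
Qed.

Lemma euler_find t : 0 <= t -> exists k, k%:R * h <= t /\ t < k.+1%:R * h.
Proof.
move=> t0; exists (Num.truncn (t / h)).
have /andP[h1 h2] := truncn_itv (divr_ge0 t0 (ltW h0)).
by rewrite -ler_pdivlMr // -ltr_pdivrMr.
Qed.

Lemma euler_lipschitz C : (forall z, `|f z| <= C) ->
  forall s t, 0 <= s -> s <= t -> `|y t - y s| <= C * (t - s).
Proof.
move=> fC.
have cell k s t : k%:R * h <= s -> s <= t -> t <= k.+1%:R * h -> `|y t - y s| <= C * (t - s).
  move=> ks st tk; rewrite !(@euler_cell k) //; [|exact: le_trans tk|exact: le_trans st].
  rewrite opprD addrACA subrr add0r -scalerBl opprB addrA subrK normrZ.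
  by rewrite ger0_norm ?subr_ge0 // mulrC ler_wpM2r // subr_ge0.
have upto k s t : 0 <= s -> s <= t -> t <= k%:R * h -> `|y t - y s| <= C * (t - s).
  elim: k s t => [|k IH] s t s0 st.
    rewrite mul0r => t0; have -> : t = s by apply/eqP; rewrite eq_le st (le_trans t0).
    by rewrite !subrr normr0 mulr0.
  move=> tk; have [tk'|/ltW kt] := leP t (k%:R * h); first exact: IH.
  have [ks|/ltW sk] := leP (k%:R * h) s; first exact: (cell k).
  have h1 := IH s _ s0 sk (lexx _); have h2 := cell k _ _ (lexx _) kt tk.
  have := ler_normD (y t - y (k%:R * h)) (y (k%:R * h) - y s).
  by rewrite addrA subrK; linear.
move=> s t s0 st; have [k [_ /ltW tk]] := euler_find (le_trans s0 st).
exact: upto tk.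
Qed.

Lemma euler_grid T : 0 < T -> exists m, grid T m (fun j => Num.min (j%:R * h) T).
Proof.
move=> T0; have ex : exists m, T <= m%:R * h.
  by have [k [_ /ltW tk]] := euler_find (ltW T0); exists k.+1.
case: (ex_minnP ex) => m Tm mmin; exists m.
split; [by rewrite mul0r min_l // ltW | by rewrite min_r |].
move=> k km; have kT : k%:R * h < T.
  by rewrite ltNge; apply/negP => /mmin; rewrite leqNgt km.
rewrite (min_l (ltW kT)) lt_min kT andbT ltr_pM2r // ltr_nat //.
Qed.

End one_step_size.

(** Convergence at the nodes suffices, since both the polygons and the limit
    are C-Lipschitz and move little between two nodes. *)
Lemma euler_clss (x : R -> V) (h : nat -> R) C : (forall z, `|f z| <= C) ->
  (forall nu, 0 < h nu) -> h @ \oo --> (0 : R) ->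
  (forall s t, 0 <= s -> s <= t -> `|x t - x s| <= C * (t - s)) ->
  (forall T e, 0 < T -> 0 < e -> exists n0, forall nu k, (n0 <= nu)%N ->
     k%:R * h nu <= T -> `|euler_node (x 0) (h nu) k - x (k%:R * h nu)| <= e) ->
  global (clss_sol f) x.
Proof.
move=> fC h0 hlim xlip conv T T0.
have C0 : 0 <= C by exact: le_trans (fC 0).
have /choice[m mP] : forall nu, exists m, grid T m (fun j => Num.min (j%:R * h nu) T).
  by move=> nu; exact: euler_grid.
pose y nu := euler_polygon (x 0) (h nu).
pose t nu j := Num.min (j%:R * h nu) T.
have lip_cont (z : R -> V) : (forall s t, 0 <= s -> s <= t -> `|z t - z s| <= C * (t - s)) ->
    {within `[0, T], continuous z}.
  move=> zlip; apply: abs_continuous_continuous; apply: (lipschitz_abs_continuous C0) => s r.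
  by rewrite /= !in_itv /= => /andP[s0 _] _; exact: zlip.
have on_cell nu j s : (j < m nu)%N -> t nu j <= s -> s <= t nu j.+1 ->
    y nu s = euler_node (x 0) (h nu) j + (s - j%:R * h nu) *: f (euler_node (x 0) (h nu) j).
  move=> jm js sj; apply: euler_cell => //; last by apply: le_trans sj _; rewrite ge_min lexx.
  apply: le_trans js; rewrite le_min lexx /=.
  have [_ tm /(_ j jm)] := mP nu; rewrite lt_min => /andP[_ h1]; apply: ltW.
  by move: h1; rewrite gt_min ltxx orbF.
have node nu j : (j < m nu)%N -> t nu j = j%:R * h nu.
  move=> jm; rewrite /t min_l //.
  have [_ tm /(_ j jm)] := mP nu; rewrite lt_min => /andP[_ h1]; apply: ltW.
  by move: h1; rewrite gt_min ltxx orbF.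
split; first exact: lip_cont.
exists y, m, t; split=> //.
- move=> nu; split.
  + by apply: lip_cont; exact: euler_lipschitz.
  + exists (m nu), (t nu); split=> // k km.
    pose P := euler_node (x 0) (h nu) k.
    move=> ck; apply: (@Ck_on_ext R R V ck _ (fun r => (P - (k%:R * h nu) *: f P) + r *: f P)) => //.
      by move=> s /=; rewrite in_itv /= => /andP[/ltW ks /ltW sk];
        rewrite (on_cell nu k s km ks sk) scalerBl addrA addrAC.
    have sm : smooth_on `]t nu k, t nu k.+1[ (fun r : R => (P - (k%:R * h nu) *: f P) + r *: f P).
      apply: (@affine_smooth R R V _ _ (fun u => u *: f P) `|f P|) => [a z v|u].
        by apply/matrixP => i j; rewrite !mxE /GRing.scale /=; ring.
      by rewrite normrZ mulrC.
    exact: sm.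
  + by have := euler_polygon_node (x 0) (h0 nu) 0; rewrite mul0r.
- move=> nu j jm s; rewrite in_itv /= => /andP[js sj]; apply/has_deriv_inP => e e0.
  exists 1 => // r; rewrite /= in_itv /= => /andP[jr rj] _.
  have tj : y nu (t nu j) = euler_node (x 0) (h nu) j by rewrite node // /y euler_polygon_node.
  rewrite tj !(on_cell nu j) //; [|exact: ltW..].
  rewrite opprD addrACA subrr add0r -!scalerBl.
  have -> : r - j%:R * h nu - (s - j%:R * h nu) - (r - s) = 0 by ring.
  by rewrite scale0r normr0 mulr_ge0 // ltW.
- apply/cvgrPdist_lt => e e0; have /cvgrPdist_lt /(_ e e0) := hlim.
  apply: filterS => nu; rewrite !sub0r !normrN (gtr0_norm (h0 nu)) => he.
  have mono : 0 <= \big[Num.max/0]_(j < m nu) (t nu j.+1 - t nu j) by exact: bigmax_ge_id.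
  rewrite (ger0_norm mono); apply: le_lt_trans he.
  apply/bigmax_leP; split=> [|j _]; first exact: ltW.
  rewrite (node nu j (ltn_ord j)) lerBlDl.
  apply: (@le_trans _ _ (j.+1%:R * h nu)); first by rewrite ge_min lexx.
  by rewrite -natr1; linear.
apply/uniform_cvgP => e e0.
have e3 : 0 < e / 4 by rewrite divr_gt0.
have [n0 H0] := conv T (e / 4) T0 e3.
have C1 : 0 < e / 4 / (C + 1) by rewrite divr_gt0 // ltr_wpDl.
have /cvgrPdist_lt /(_ _ C1)[n1 _ H1] := hlim.
exists (maxn n0 n1) => nu; rewrite geq_max => /andP[n0nu n1nu] s; rewrite /= in_itv /= => /andP[s0 sT].
have [k [ks sk]] := euler_find (h0 nu) s0.
have he : C * h nu <= e / 4.
  have := H1 nu n1nu; rewrite /= sub0r normrN (gtr0_norm (h0 nu)) ltr_pdivlMr ?ltr_wpDl // => /ltW hh.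
  by apply: le_trans hh; have := h0 nu; nonlinear.
have kh0 : 0 <= k%:R * h nu by rewrite mulr_ge0 // ltW.
have g1 := euler_lipschitz (x 0) (h0 nu) fC kh0 ks.
have g2 := xlip _ _ kh0 ks.
have g3 := H0 nu k n0nu (le_trans ks sT).
have g4 : C * (s - k%:R * h nu) <= C * h nu.
  rewrite ler_wpM2l //; move: sk; rewrite -natr1; linear.
rewrite euler_polygon_node // in g1.
have -> : y nu s - x s = (y nu s - euler_node (x 0) (h nu) k) +
    (euler_node (x 0) (h nu) k - x (k%:R * h nu)) - (x s - x (k%:R * h nu)).
  by apply/matrixP => i j; rewrite !mxE; ring.
have := ler_normB ((y nu s - euler_node (x 0) (h nu) k) +
    (euler_node (x 0) (h nu) k - x (k%:R * h nu))) (x s - x (k%:R * h nu)).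
have := ler_normD (y nu s - euler_node (x 0) (h nu) k) (euler_node (x 0) (h nu) k - x (k%:R * h nu)).
rewrite /y; linear.
Qed.

End euler_scheme.

(** * Four agents in the plane: the approach *)

Section four_agents.
Variable R : realType.
Local Notation V := 'M[R]_(4, 2).

(** For the pairs (0, 1) and (1, 3), the ones of index sums 1 and 4, the force
    r phi(r) does not depend on r >= 1/2: velocities are then constant and Euler
    polygons exact. *)
Definition four_phi (i j : 'I_4) (r : R) : R :=
  if (i + j == 1)%N then 1 / 12 / Num.max r (1 / 2)
  else if (i + j == 4)%N then 1 / 4 / Num.max r (1 / 2) else 1 / 2.

Lemma capped_inverse_lipschitz (c : R) (g : R -> R) : 0 < c <= 1 ->
  (forall r, g r = c / Num.max r (1 / 2)) -> [lipschitz g r | r in `[0, 1]%classic].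
Proof.
move=> /andP[c0 c1] gE; exists 4; split=> // M M4 [r s] _ /=; rewrite !gE.
have mpos (r' : R) : 1 / 2 <= Num.max r' (1 / 2) by rewrite le_max lexx orbT.
have mlip : `|Num.max r (1 / 2) - Num.max s (1 / 2)| <= `|r - s|.
  by case: (ltP r (1 / 2)) => h1; case: (ltP s (1 / 2)) => h2;
    rewrite ?subrr ?normr0 //; rewrite !ler_norml; apply/andP; split;
    case: (ger0P (r - s)) => h3; linear.
have := mpos r; have := mpos s.
set a := Num.max r _ in mlip *; set b := Num.max s _ in mlip * => hb ha.
have a0 : 0 < a by linear.
have b0 : 0 < b by linear.
have -> : c / a - c / b = c * (b - a) / (a * b) by field; rewrite !gt_eqF.
have ab0 : 0 < a * b by rewrite mulr_gt0.
rewrite normrM normfV (gtr0_norm ab0) ler_pdivrMr // normrM (gtr0_norm c0) distrC.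
have := normr_ge0 (r - s); have := normr_ge0 (a - b); move: mlip.
move: `|a - b| `|r - s| => X Y XY X0 Y0.
have : 1 / 4 <= a * b by nonlinear.
move=> ab; have Mab : 1 <= M * (a * b) by nonlinear.
apply: (@le_trans _ _ Y); first by nonlinear.
by rewrite -mulrA mulrCA ler_peMr.
Qed.

Lemma four_phiP : interaction four_phi.
Proof.
have mpos (r : R) : 0 < Num.max r (1 / 2) by apply: (@lt_le_trans _ _ (1 / 2)); rewrite ?le_max ?lexx ?orbT //; linear.
move=> i j; split.
- case E1 : (i + j == 1)%N.
    by apply: (@capped_inverse_lipschitz (1 / 12)) => [|r]; [linear | rewrite /four_phi E1].
  case E4 : (i + j == 4)%N.
    by apply: (@capped_inverse_lipschitz (1 / 4)) => [|r]; [linear | rewrite /four_phi E1 E4].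
  exists 0; split=> // M M0 [r s] _; rewrite /four_phi /= E1 E4 subrr normr0.
  by rewrite mulr_ge0 // ltW.
- move=> r _; rewrite /four_phi; case: ifP => _; first by rewrite !divr_gt0.
  by case: ifP => _; rewrite !divr_gt0.
- by move=> r _; rewrite /four_phi addnC.
Qed.

Local Notation f := (opinion_field four_phi : V -> V).

Definition o0 : 'I_4 := @Ordinal 4 0 isT.
Definition o1 : 'I_4 := @Ordinal 4 1 isT.
Definition o2 : 'I_4 := @Ordinal 4 2 isT.
Definition o3 : 'I_4 := @Ordinal 4 3 isT.

Lemma sum4 (F : 'I_4 -> R) : \sum_j F j = F o0 + F o1 + F o2 + F o3.
Proof.
rewrite !big_ord_recr big_ord0 /= add0r.
by congr (_ + _ + _ + _); congr F; exact: val_inj.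
Qed.

Lemma ord4P (P : 'I_4 -> Prop) : P o0 -> P o1 -> P o2 -> P o3 -> forall i, P i.
Proof.
move=> p0 p1 p2 p3 [[|[|[|[|k]]]] h] //.
- by rewrite (_ : Ordinal h = o0) //; exact: val_inj.
- by rewrite (_ : Ordinal h = o1) //; exact: val_inj.
- by rewrite (_ : Ordinal h = o2) //; exact: val_inj.
- by rewrite (_ : Ordinal h = o3) //; exact: val_inj.
Qed.

Definition sqdist (y : V) (i j : 'I_4) : R :=
  (y i ord0 - y j ord0) ^+ 2 + (y i ord_max - y j ord_max) ^+ 2.

Lemma rdist_sqr (y : V) i j : rdist y i j = Num.sqrt (sqdist y i j).
Proof.
rewrite /rdist /enorm big_ord1 big_ord_recr big_ord1 !mxE; congr Num.sqrt.
by rewrite /sqdist; congr ((_ - _) ^+ 2 + _); congr (y _ _); exact: val_inj.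
Qed.

Lemma weight_far (y : V) i j : 1 <= sqdist y i j -> weight four_phi y i j = 0.
Proof.
move=> d1; rewrite /weight /cutoff -/(rdist y i j) rdist_sqr ltNge.
by rewrite -{1}(@sqrtr1 R) ler_wsqrtr.
Qed.

Lemma weight_near (y : V) i j : sqdist y i j < 1 ->
  weight four_phi y i j = four_phi i j (Num.sqrt (sqdist y i j)).
Proof.
move=> d1; rewrite /weight /cutoff -/(rdist y i j) rdist_sqr.
by rewrite -{1}(@sqrtr1 R) ltr_sqrt // d1.
Qed.

(** Positions of the agents 0, 1, 2 and 3 in this order. *)
Definition place (a a' b b' c c' d d' : R) : V := \matrix_(i, j)
  nth 0 (nth [::] [:: [:: a; a']; [:: b; b']; [:: c; c']; [:: d; d']] i) j.

Lemma field_place (y : V) (w01 w02 w03 w12 w13 w23 : R) :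
  weight four_phi y o0 o1 = w01 -> weight four_phi y o0 o2 = w02 ->
  weight four_phi y o0 o3 = w03 -> weight four_phi y o1 o2 = w12 ->
  weight four_phi y o1 o3 = w13 -> weight four_phi y o2 o3 = w23 ->
  forall c, [/\
   f y o0 c = w01 * (y o1 c - y o0 c) + w02 * (y o2 c - y o0 c) + w03 * (y o3 c - y o0 c),
   f y o1 c = w01 * (y o0 c - y o1 c) + w12 * (y o2 c - y o1 c) + w13 * (y o3 c - y o1 c),
   f y o2 c = w02 * (y o0 c - y o2 c) + w12 * (y o1 c - y o2 c) + w23 * (y o3 c - y o2 c) &
   f y o3 c = w03 * (y o0 c - y o3 c) + w13 * (y o1 c - y o3 c) + w23 * (y o2 c - y o3 c)].
Proof.
have wC := weightC four_phiP y.
move=> e01 e02 e03 e12 e13 e23 c.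
by rewrite !opinion_fieldE !sum4 (wC o1 o0) (wC o2 o0) (wC o2 o1) (wC o3 o0) (wC o3 o1)
  (wC o3 o2) e01 e02 e03 e12 e13 e23 !subrr !mulr0 !add0r !addr0.
Qed.

(** With velocity [drift], at time 1/2 agents 0, 1 and 2 are at (0, 0), (1, 0)
    and (5/13, 12/13), and agent 3 is at (3/2, 0): at that time agent 0 is at distance
    1 from both agent 1 and agent 2. *)
Definition start : V :=
  place (- (1 / 24)) 0 (11 / 12) 0 (5 / 13) (12 / 13) (13 / 8) 0.
Definition drift : V := place (1 / 12) 0 (1 / 6) 0 0 0 (- (1 / 4)) 0.
Definition approach (t : R) : V := start + t *: drift.

Lemma approach_field t : 0 <= t -> t < 1 / 2 -> f (approach t) = drift.
Proof.
move=> t0 t2.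
have q01 : sqdist (approach t) o0 o1 = (23 / 24 + t / 12) ^+ 2.
  by rewrite /sqdist !mxE /=; field.
have q13 : sqdist (approach t) o1 o3 = (17 / 24 - t * 5 / 12) ^+ 2.
  by rewrite /sqdist !mxE /=; field.
have d01 : 1 / 2 <= 23 / 24 + t / 12 < 1 by linear.
have d13 : 1 / 2 <= 17 / 24 - t * 5 / 12 < 1 by linear.
have [a w01 aE] : exists2 w, weight four_phi (approach t) o0 o1 = w &
    w * (23 / 24 + t / 12) = 1 / 12.
  move: d01 q01; move: (_ + _ / 12) => r /andP[r2 r1] q01.
  have r0 : 0 < r by linear.
  exists (1 / 12 / r); last by rewrite divfK // gt_eqF.
  rewrite weight_near q01 ?sqrtr_sqr ?exprn_ilt1 ?ltW //.
  by rewrite ger0_norm ?ltW // /four_phi /= max_l.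
have [b w13 bE] : exists2 w, weight four_phi (approach t) o1 o3 = w &
    w * (17 / 24 - t * 5 / 12) = 1 / 4.
  move: d13 q13; move: (_ - _ / 12) => r /andP[r2 r1] q13.
  have r0 : 0 < r by linear.
  exists (1 / 4 / r); last by rewrite divfK // gt_eqF.
  rewrite weight_near q13 ?sqrtr_sqr ?exprn_ilt1 ?ltW //.
  by rewrite ger0_norm ?ltW // /four_phi /= max_l.
have w02 : weight four_phi (approach t) o0 o2 = 0.
  by apply: weight_far; rewrite /sqdist !mxE /=; clear -t0 t2; nra.
have w03 : weight four_phi (approach t) o0 o3 = 0.
  by apply: weight_far; rewrite /sqdist !mxE /=; clear -t0 t2; nra.
have w12 : weight four_phi (approach t) o1 o2 = 0.
  by apply: weight_far; rewrite /sqdist !mxE /=; clear -t0 t2; nra.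
have w23 : weight four_phi (approach t) o2 o3 = 0.
  by apply: weight_far; rewrite /sqdist !mxE /=; clear -t0 t2; nra.
apply/matrixP => i j; have [e0 e1 e2 e3] := field_place w01 w02 w03 w12 w13 w23 j.
elim/ord4P: i; rewrite ?e0 ?e1 ?e2 ?e3 !mxE; case: (ord2E j) => -> /=; clear -aE bE; lra.
Qed.

End four_agents.

(** * Four agents in the plane: after the encounter *)

Section settling.
Variable R : realType.
Local Notation V := 'M[R]_(4, 2).
Local Notation f := (opinion_field (@four_phi R) : V -> V).

(** The displacement that remains when agent 0 has passed the origin by d, at
    time 1/2 + 12 d: agents 1 and 3 meet midway, and so do agents 0 and 2 if s is 1.
    For s = 0 the latter two rest. *)
Definition spread (s d : R) : V :=
  place (s / 2 * (5 / 13 - d)) (s * 6 / 13) ((1 / 2 - 5 * d) / 2) 0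
        (- (s / 2 * (5 / 13 - d))) (- (s * 6 / 13)) (- ((1 / 2 - 5 * d) / 2)) 0.

(** The state at which the fraction p of the displacement is left. *)
Definition settle (s d p : R) : V := approach (1 / 2 + 12 * d) + (1 - p) *: spread s d.

(** At d = 0 agents 0 and 2 are at distance 1 and do not interact; as soon as
    d > 0 they do. *)
Definition admissible (s d : R) : Prop :=
  (s = 0 /\ d = 0) \/ (s = 1 /\ 0 < d <= 1 / 100).

Lemma settle_field s d p : admissible s d -> 0 <= p <= 1 ->
  f (settle s d p) = p *: spread s d.
Proof.
move=> sd /andP[p0 p1].
have d0 : 0 <= d <= 1 / 100 by case: sd => [[_ ->]|[_ /andP[/ltW -> ->]]] //; linear.
move: d0 => /andP[d0 d1].
have q13 : sqdist (settle s d p) o1 o3 = (p * (1 / 2 - 5 * d)) ^+ 2.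
  by rewrite /sqdist !mxE /=; clear; field.
have w13 : weight (@four_phi R) (settle s d p) o1 o3 = 1 / 2.
  move: q13; have : 0 <= p * (1 / 2 - 5 * d) <= 1 / 2 by nonlinear.
  move: (p * _) => r /andP[r0 r2] q13.
  rewrite weight_near q13 ?sqrtr_sqr; last by nonlinear.
  by rewrite ger0_norm // /four_phi /= max_r //; linear.
have w02 : weight (@four_phi R) (settle s d p) o0 o2 = s / 2.
  case: sd => [[s0 dd]|[s1 /andP[dpos _]]].
    by rewrite weight_far ?s0 ?mul0r // /sqdist !mxE /= dd; nonlinear.
  have q02 : sqdist (settle s d p) o0 o2 = p ^+ 2 * (1 - d * (10 / 13 - d)).
    by rewrite /sqdist !mxE /= s1; clear; field.
  rewrite weight_near ?q02 ?s1 //.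
  have : 0 < d * (10 / 13 - d) by rewrite mulr_gt0 //; linear.
  move: (d * _) => z z0; have : p ^+ 2 <= 1 by nonlinear.
  have : 0 <= p ^+ 2 by rewrite sqr_ge0.
  by nonlinear.
have w01 : weight (@four_phi R) (settle s d p) o0 o1 = 0.
  apply: weight_far; rewrite /sqdist !mxE /=.
  case: sd => [[-> ->]|[-> _]]; first by nonlinear.
  have : 1 <= 1 + d * (1 - 2 * (1 - p)) + 3 / 52 * (1 - p).
    have : 0 <= d * p by rewrite mulr_ge0.
    have : 0 <= (1 - p) * (3 / 52 - d) by clear -p1 d1; rewrite mulr_ge0; linear.
    by nonlinear.
  by nonlinear.
have w03 : weight (@four_phi R) (settle s d p) o0 o3 = 0.
  apply: weight_far; rewrite /sqdist !mxE /=.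
  by case: sd => [[-> ->]|[-> _]]; clear -p0 p1 d0 d1; nra.
have w12 : weight (@four_phi R) (settle s d p) o1 o2 = 0.
  apply: weight_far; rewrite /sqdist !mxE /=.
  by case: sd => [[-> ->]|[-> _]]; clear -p0 p1 d0 d1; nra.
have w23 : weight (@four_phi R) (settle s d p) o2 o3 = 0.
  apply: weight_far; rewrite /sqdist !mxE /=.
  by case: sd => [[-> ->]|[-> _]]; clear -p0 p1 d0 d1; nra.
apply/matrixP => i j; have [e0 e1 e2 e3] := field_place w01 w02 w03 w12 w13 w23 j.
case: sd => [[s0 _]|[s1 _]]; elim/ord4P: i; rewrite ?e0 ?e1 ?e2 ?e3 ?s0 ?s1 !mxE;
  by case: (ord2E j) => -> /=; clear; field.
Qed.

End settling.

(** * Two limits of Euler polygons *)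

Section clss_example.
Variable R : realType.
Local Notation V := 'M[R]_(4, 2).
Local Notation f := (opinion_field (@four_phi R) : V -> V).

(** The first K steps follow the approach; each of the next ones multiplies
    the remaining displacement by 1 - h. *)
Lemma euler_node_four (s d h : R) K : admissible s d -> 0 <= h <= 1 ->
  K%:R * h = 1 / 2 + 12 * d -> (forall k, (k < K)%N -> k%:R * h < 1 / 2) ->
  forall k, euler_node f (start R) h k =
    approach ((minn k K)%:R * h) + (1 - (1 - h) ^+ (k - K)) *: spread s d.
Proof.
move=> sd /andP[h0 h1] KE Klt; elim=> [|k IH].
  by rewrite min0n sub0n expr0 subrr scale0r addr0 mul0r /approach scale0r addr0.
rewrite /euler_node iterS -/(euler_node f (start R) h k) IH /euler_step.
have [kK|Kk] := ltnP k K.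
  have -> : minn k.+1 K = k.+1 by apply/minn_idPl.
  have -> : (k - K = 0)%N by apply/eqP; rewrite subn_eq0 ltnW.
  have -> : (k.+1 - K = 0)%N by apply/eqP; rewrite subn_eq0.
  rewrite expr0 subrr scale0r !addr0 approach_field ?Klt ?mulr_ge0 //.
  by rewrite /approach -addrA -scalerDl; congr (_ + _ *: _); rewrite -natr1; ring.
have -> : minn k.+1 K = K by apply/minn_idPr; exact: leqW.
rewrite KE -/(settle s d ((1 - h) ^+ (k - K))) settle_field //; last first.
  by rewrite exprn_ge0 ?exprn_ile1 //; linear.
rewrite subSn // exprS /settle -addrA scalerA -scalerDl; congr (_ + _ *: _); ring.
Qed.

Definition decay (t : R) : R := expR (- Num.max 0 (t - 1 / 2)).

(** The limit of the Euler polygons as the step tends to 0. *)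
Definition settling (s t : R) : V :=
  approach (Num.min t (1 / 2)) + (1 - decay t) *: spread s 0.

Lemma expRN_lipschitz (a b : R) : 0 <= a -> 0 <= b ->
  `|expR (- a) - expR (- b)| <= `|a - b|.
Proof.
move=> a0 b0; wlog ab : a b a0 b0 / a <= b.
  by move=> W; have [/W|/ltW /W] := leP a b; [exact | rewrite distrC (distrC a); exact].
have E : expR (- b) = expR (- a) * expR (- (b - a)) by rewrite -expRD; congr expR; ring.
have h1 := expR_ge1Dx (- (b - a)).
have h2 : expR (- a) <= 1 by rewrite -expR0 ler_expR; linear.
have h3 := expR_gt0 (- a).
have h4 : expR (- (b - a)) <= 1 by rewrite -expR0 ler_expR; linear.
rewrite distrC [leRHS]distrC ler0_norm; last by rewrite E; nonlinear.
rewrite ger0_norm ?subr_ge0 // E; nonlinear.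
Qed.

Lemma clip_lipschitz (s t c : R) :
  `|Num.min s c - Num.min t c| <= `|s - t| /\ `|Num.max 0 (s - c) - Num.max 0 (t - c)| <= `|s - t|.
Proof.
split.
  case: (leP s c) => h1; case: (leP t c) => h2; rewrite ?subrr ?normr0 // !ler_norml;
    apply/andP; split; case: (ger0P (s - t)) => h3; linear.
case: (leP 0 (s - c)) => h1; case: (leP 0 (t - c)) => h2; rewrite ?subrr ?normr0 // !ler_norml;
    apply/andP; split; case: (ger0P (s - t)) => h3; linear.
Qed.

Lemma decay_lipschitz s t : `|decay s - decay t| <= `|s - t|.
Proof.
apply: le_trans (expRN_lipschitz _ _) _; rewrite ?le_max ?lexx //.
by have [] := clip_lipschitz s t (1 / 2).
Qed.

Lemma settling_lipschitz s : exists2 C, 0 <= C & forall t u, 0 <= t -> t <= u ->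
  `|settling s u - settling s t| <= C * (u - t).
Proof.
exists (`|drift R| + `|spread s 0|) => [|t u t0 tu]; first by rewrite addr_ge0.
have -> : settling s u - settling s t =
    (Num.min u (1 / 2) - Num.min t (1 / 2)) *: drift R - (decay u - decay t) *: spread s 0.
  by rewrite /settling /approach; move: (drift R) (spread s 0) => A B; apply/matrixP => i j; rewrite !mxE; ring.
have [h1 _] := clip_lipschitz u t (1 / 2); have h2 := decay_lipschitz u t.
rewrite (ger0_norm (_ : 0 <= u - t)) ?subr_ge0 // in h1 h2.
apply: le_trans (ler_normB _ _) _; rewrite !normrZ mulrDl.
by rewrite lerD // mulrC ler_wpM2l.
Qed.

Lemma settling0 s : settling s 0 = start R.
Proof.
rewrite /settling /decay max_l; last by linear.
rewrite min_l; last by linear.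
by rewrite oppr0 expR0 subrr scale0r addr0 /approach scale0r addr0.
Qed.

Lemma expRN_small (e : R) : 0 < e -> forall u, e^-1 <= u -> expR (- u) < e.
Proof.
move=> e0 u eu; have i0 : 0 < e^-1 by rewrite invr_gt0.
rewrite expRN -[ltRHS]invrK ltf_pV2 ?posrE ?expR_gt0 //.
by apply: le_lt_trans eu _; apply: lt_le_trans (expR_ge1Dx _); linear.
Qed.

Lemma settling_lim s : tends_to (settling s) (approach (1 / 2) + spread s 0).
Proof.
apply/tends_toP => e e0.
have K0 : 0 < `|spread s 0| + 1 by rewrite ltr_wpDl.
pose e' := e / (`|spread s 0| + 1); have e'0 : 0 < e' by rewrite divr_gt0.
have i0 : 0 < e'^-1 by rewrite invr_gt0.
exists (1 / 2 + e'^-1) => [|t te]; first by linear.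
rewrite /settling min_r; last by linear.
have -> : approach (1 / 2) + (1 - decay t) *: spread s 0 - (approach (1 / 2) + spread s 0) =
    - (decay t *: spread s 0).
  by move: (approach _) (spread s 0) => A B; apply/matrixP => i j; rewrite !mxE; ring.
rewrite normrN normrZ ger0_norm ?expR_ge0 //.
have h : decay t < e'.
  by rewrite /decay max_r; [apply: expRN_small => //; linear | linear].
apply: (@le_lt_trans _ _ (decay t * (`|spread s 0| + 1))).
  by rewrite ler_wpM2l ?expR_ge0 // lerDl.
by rewrite -ltr_pdivlMr.
Qed.

(** The factors 1 - h and exp(- h) are at most 1 and differ by at most h^2. *)
Lemma geometric_exp (h : R) (m : nat) : 0 <= h <= 1 ->
  `|(1 - h) ^+ m - expR (- (m%:R * h))| <= m%:R * h * h.
Proof.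
move=> /andP[h0 h1]; elim: m => [|m IH].
  by rewrite !mul0r oppr0 expR0 expr0 subrr normr0.
have l1 := expR_ge1Dx (- h).
have l2 : expR (- h) <= 1 - h + h * h.
  have hp : 0 < 1 + h by linear.
  rewrite expRN; apply: (@le_trans _ _ (1 + h)^-1).
    by rewrite lef_pV2 ?posrE ?expR_gt0 // expR_ge1Dx.
  rewrite -[leLHS]mul1r ler_pdivrMr //; nonlinear.
have E : expR (- (m.+1%:R * h)) = expR (- h) * expR (- (m%:R * h)).
  by rewrite -expRD -natr1; congr expR; ring.
rewrite exprS E -natr1.
have x0 : 0 <= expR (- (m%:R * h)) := expR_ge0 _.
have x1 : expR (- (m%:R * h)) <= 1 by rewrite -expR0 ler_expR oppr_le0 mulr_ge0.
move: IH x0 x1 l1 l2; move: (expR (- (m%:R * h))) (expR (- h)) ((1 - h) ^+ m) => x y z.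
rewrite !ler_norml => /andP[a b] x0 x1 l1 l2.
have m0 : 0 <= m%:R * h * h by rewrite !mulr_ge0.
have -> : (1 - h) * z - y * x = (1 - h) * (z - x) - (y - (1 - h)) * x by ring.
have q1 : (1 - h) * (z - x) <= m%:R * h * h by nonlinear.
have q2 : - (m%:R * h * h) <= (1 - h) * (z - x) by nonlinear.
have q3 : 0 <= (y - (1 - h)) * x by rewrite mulr_ge0 //; linear.
have q4 : (y - (1 - h)) * x <= h * h by nonlinear.
by linear.
Qed.

Lemma spread_near (s d : R) : 0 <= s <= 1 -> 0 <= d -> `|spread s d - spread s 0| <= 3 * d.
Proof.
move=> /andP[s0 s1] d0; apply: norm_le_coord => [|i j]; first by linear.
have sd : 0 <= s * d <= d by apply/andP; split; nonlinear.
elim/ord4P: i; case: (ord2E j) => ->; rewrite !mxE /= ler_norml;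
  case/andP: sd => ? ?; linear.
Qed.

(** The three terms of the constant bound the errors on the time at which the
    approach ends, on the displacement and on the decay. *)
Lemma euler_error (s d h : R) K (T : R) k : admissible s d -> 0 < h <= 1 -> 24 * d <= h ->
  K%:R * h = 1 / 2 + 12 * d -> (forall k, (k < K)%N -> k%:R * h < 1 / 2) ->
  k%:R * h <= T ->
  `|euler_node f (start R) h k - settling s (k%:R * h)| <=
    (`|drift R| + 1 + (T + 1) * `|spread s 0|) * h.
Proof.
move=> sd /andP[h0 h1] dh KE Klt kT.
have h01 : 0 <= h <= 1 by rewrite ltW.
have d0 : 0 <= d by case: sd => [[_ ->]|[_ /andP[/ltW]]].
have s01 : 0 <= s <= 1 by case: sd => [[-> _]|[-> _]]; rewrite ?lexx ?ler01.
rewrite (euler_node_four sd h01 KE Klt).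
set m := (k - K)%N; set P := (1 - h) ^+ m; set t := k%:R * h.
have P01 : 0 <= P <= 1 by rewrite exprn_ge0 ?exprn_ile1 //; linear.
have hmono (a b : nat) : (a <= b)%N -> a%:R * h <= b%:R * h.
  by move=> ab; rewrite ler_pM2r // ler_nat.
have mh : m%:R * h = Num.max 0 (t - K%:R * h).
  rewrite /m /t; have [kK|/ltnW Kk] := leqP k K.
    have -> : (k - K = 0)%N by apply/eqP; rewrite subn_eq0.
    by rewrite mul0r max_l // subr_le0 hmono.
  by rewrite natrB // mulrBl max_r // subr_ge0 hmono.
have minE : (minn k K)%:R * h = Num.min t (K%:R * h).
  rewrite /t; have [kK|/ltnW Kk] := leqP k K; first by rewrite min_l // hmono.
  by rewrite min_r // hmono.
have t0 : 0 <= t by rewrite mulr_ge0 // ltW.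
have min_close : `|Num.min t (K%:R * h) - Num.min t (1 / 2)| <= h.
  rewrite KE; case: (leP t (1 / 2)) => a; case: (leP t (1 / 2 + 12 * d)) => b;
    rewrite ler_norml; linear.
have max_close : `|m%:R * h - Num.max 0 (t - 1 / 2)| <= h.
  rewrite mh KE; case: (leP 0 (t - 1 / 2)) => a; case: (leP 0 (t - (1 / 2 + 12 * d))) => b;
    rewrite ler_norml; linear.
have mhT : 0 <= m%:R * h <= T.
  by rewrite mh; case: (leP 0 (t - K%:R * h)) => a; apply/andP; split; rewrite /t in a t0 *; linear.
have decay_close : `|P - decay t| <= (T + 1) * h.
  have e1 := geometric_exp m h01.
  have mx0 : 0 <= Num.max 0 (t - 1 / 2) by rewrite le_max lexx.
  have e2 := expRN_lipschitz (proj1 (andP mhT)) mx0.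
  have := ler_normD (P - expR (- (m%:R * h))) (expR (- (m%:R * h)) - decay t).
  rewrite addrA subrK /decay; case/andP: mhT => _ mT.
  have : m%:R * h * h <= T * h by rewrite ler_wpM2r // ltW.
  rewrite mulrDl [1 * h]mul1r; rewrite -/P in e1; linear.
have -> : approach ((minn k K)%:R * h) + (1 - P) *: spread s d - settling s t =
   (Num.min t (K%:R * h) - Num.min t (1 / 2)) *: drift R +
   (1 - P) *: (spread s d - spread s 0) - (P - decay t) *: spread s 0.
  rewrite minE /settling /approach; move: (drift R) (spread s 0) (spread s d) => A B C.
  by apply/matrixP => i j; rewrite !mxE; ring.
have sn := spread_near s01 d0.
apply: le_trans (ler_normB _ _) _; rewrite mulrDl lerD //.
  apply: le_trans (ler_normD _ _) _; rewrite mulrDl [1 * h]mul1r lerD //.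
    by rewrite normrZ [leLHS]mulrC ler_wpM2l.
  rewrite normrZ ger0_norm; last by case/andP: P01; linear.
  case/andP: P01 => P0 P1; have := normr_ge0 (spread s d - spread s 0); nonlinear.
rewrite normrZ -mulrA [`|spread s 0| * h]mulrC mulrA ler_wpM2r //.
Qed.

Lemma settling_clss (s : R) (d h : nat -> R) (K : nat -> nat) :
  (forall nu, [/\ admissible s (d nu), 0 < h nu <= 1, 24 * d nu <= h nu,
     (K nu)%:R * h nu = 1 / 2 + 12 * d nu &
     forall k, (k < K nu)%N -> k%:R * h nu < 1 / 2]) ->
  h @ \oo --> (0 : R) ->
  global (clss_sol f) (settling s).
Proof.
move=> H hlim.
have [C1 C10 fC] := opinion_field_bounded 2 (@four_phiP R).
have [C2 C20 lip] := settling_lipschitz s.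
apply: (@euler_clss R 4 2 f (settling s) h (C1 + C2)) => //.
- by move=> z; apply: le_trans (fC z) _; rewrite lerDl.
- by move=> nu; have [_ /andP[]] := H nu.
- move=> t u t0 tu; apply: le_trans (lip t u t0 tu) _.
  by rewrite ler_wpM2r ?subr_ge0 // lerDr ltW.
move=> T e T0 e0.
pose c := `|drift R| + 1 + (T + 1) * `|spread s 0|.
have c0 : 0 < c.
  have : 0 <= (T + 1) * `|spread s 0| by rewrite mulr_ge0 //; linear.
  by have := normr_ge0 (drift R); rewrite /c; linear.
have /cvgrPdist_lt /(_ _ (divr_gt0 e0 c0))[n0 _ Hn] := hlim.
exists n0 => nu k nn kT; have [sd /andP[h0 h1] dh KE Klt] := H nu.
have := Hn nu nn; rewrite /= sub0r normrN (gtr0_norm h0) ltr_pdivlMr // => hc.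
rewrite settling0; apply: le_trans (euler_error sd _ dh KE Klt kT) _; first by rewrite h0.
by rewrite mulrC ltW.
Qed.

Lemma cvg0_le_harmonic (h : nat -> R) : (forall nu, 0 < h nu <= nu.+1%:R^-1) ->
  h @ \oo --> (0 : R).
Proof.
move=> hP; apply/cvgrPdist_lt => e e0.
exists (Num.truncn e^-1) => // nu /= nn; have /andP[h0 h1] := hP nu.
rewrite sub0r normrN gtr0_norm //; apply: le_lt_trans h1 _.
rewrite -[ltRHS]invrK ltf_pV2 ?posrE ?invr_gt0 ?ltr0n //.
have i0 : 0 <= e^-1 by rewrite invr_ge0 ltW.
have /andP[_ h2] := truncn_itv i0.
by apply: lt_le_trans h2 _; rewrite ler_nat ltnS.
Qed.

(** The steps 1 / (2 (nu + 1)) have a node at time 1/2.  The steps h = 1 / (2 nu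
    + 5) have none: the first node after 1/2 is at 1/2 + h / 2, and h / 2 = 12 d for
    d = h / 24. *)
Lemma clss_not_P3 : in_general_not_P3 (@clss_sol R).
Proof.
exists 2%N, 4%N, (@four_phi R); split; first by split=> //; exact: four_phiP.
exists (settling 0), (settling 1), (approach (1 / 2) + spread 0 0), (approach (1 / 2) + spread 1 0).
split; split; [| |by rewrite !settling0|exact: settling_lim|exact: settling_lim|].
- have n0 nu : 0 < nu.+1%:R :> R by rewrite ltr0n.
  apply: (@settling_clss 0 (fun=> 0) (fun nu => nu.+1%:R^-1 / 2) (fun nu => nu.+1)).
    move=> nu /=; have i0 : 0 < nu.+1%:R^-1 :> R by rewrite invr_gt0.
    have i1 : nu.+1%:R^-1 <= 1 :> R by rewrite invf_le1 // ler1n.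
    split; [by left | | | |].
    - by move: (_^-1) i0 i1 => z i0 i1; linear.
    - by move: (_^-1) i0 i1 => z i0 i1; linear.
    - by rewrite mulrA mulfV ?gt_eqF // mulr0 addr0.
    - move=> k kn; rewrite mulrA ltr_pM2r // ltr_pdivrMr // mul1r ltr_nat //.
  apply: cvg0_le_harmonic => nu /=; have i0 : 0 < nu.+1%:R^-1 :> R by rewrite invr_gt0.
  by move: (_^-1) i0 => z i0; linear.
- have n0 nu : 0 < (2 * nu + 5)%:R :> R by rewrite ltr0n addnC.
  apply: (@settling_clss 1 (fun nu => (2 * nu + 5)%:R^-1 / 24) (fun nu => (2 * nu + 5)%:R^-1)
    (fun nu => nu.+3)).
    move=> nu /=; have i0 : 0 < (2 * nu + 5)%:R^-1 :> R by rewrite invr_gt0.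
    have i1 : (2 * nu + 5)%:R^-1 <= 1 / 5 :> R.
      by rewrite div1r lef_pV2 ?posrE // ?ltr0n // ler_nat leq_addl.
    have n5 : (2 * nu + 5)%:R * (2 * nu + 5)%:R^-1 = 1 :> R by rewrite mulfV ?gt_eqF.
    have n3 : (2 * nu + 5)%:R = 2 * nu.+3%:R - 1 :> R by rewrite natrD natrM -!natr1; ring.
    have kK k : (k < nu.+3)%N -> k%:R <= nu.+3%:R - 1 :> R.
      by rewrite -(ler_nat R) -natr1; linear.
    move: n5 kK i0 i1; move: ((2 * nu + 5)%:R^-1 : R) => z; rewrite n3.
    move: (nu.+3%:R : R) => K n5 kK i0 i1.
    split.
    - by right; split=> //; linear.
    - by linear.
    - linear.
    - linear.
    - by move=> k kn; have := kK k kn; nonlinear.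
  apply: cvg0_le_harmonic => nu; rewrite invr_gt0 n0 /= lef_pV2 ?posrE ?n0 ?ltr0n // ler_nat; lia.
move=> /matrixP /(_ o0 ord0); rewrite !mxE /=; linear.
Qed.

End clss_example.

(** * P1 and P2 for each type of solution *)

Section positive_results.
Variable R : realType.

Lemma mean_value_P1_P2 (n N : nat) (phi : 'I_N -> 'I_N -> R -> R)
    (sol : (R -> 'M[R]_(N, n)) -> Prop) : interaction phi ->
  (forall x, sol x -> mean_value_sol (opinion_field phi) x) -> P1_P2 sol.
Proof.
move=> phiP H x /H xP; split; first exact: mean_value_P1 xP.
exact: mean_value_P2 xP.
Qed.

Lemma krasovskii_P1_P2 : always_P1_P2 (@krasovskii_sol R).
Proof.
by move=> n N phi _ _ phiP; apply: mean_value_P1_P2 => // x; exact: krasovskii_mean_value.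
Qed.

Lemma filippov_P1_P2 : always_P1_P2 (@filippov_sol R).
Proof.
move=> n N phi n0 N0 phiP x xP; apply: (krasovskii_P1_P2 n0 N0 phiP) => T T0.
exact: filippov_krasovskii (xP T T0).
Qed.

Lemma caratheodory_P1_P2 : always_P1_P2 (@caratheodory_sol R).
Proof.
move=> n N phi n0 N0 phiP x xP; apply: (krasovskii_P1_P2 n0 N0 phiP) => T T0.
exact: caratheodory_krasovskii (xP T T0).
Qed.

Lemma clss_P1_P2 : always_P1_P2 (@clss_sol R).
Proof.
move=> n N phi _ _ phiP; apply: mean_value_P1_P2 => // x.
by have [C _ fC] := opinion_field_bounded n phiP; exact: clss_mean_value fC.
Qed.

End positive_results.

Theorem theorem2 (R : realType) :
  (* (a) *)
  (forall (n N : nat) (phi : 'I_N -> 'I_N -> R -> R),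
     (0 < n)%N -> (0 < N)%N -> interaction phi ->
     P1_P2 (global (@classical_sol R N n (opinion_field phi))) /\
     P3 (global (@classical_sol R N n (opinion_field phi)))) /\
  (* (b) *)
  [/\ always_P1_P2 (@caratheodory_sol R) /\
        in_general_not_P3 (@caratheodory_sol R),
      always_P1_P2 (@filippov_sol R) /\ in_general_not_P3 (@filippov_sol R),
      always_P1_P2 (@krasovskii_sol R) /\ in_general_not_P3 (@krasovskii_sol R) &
      always_P1_P2 (@clss_sol R) /\ in_general_not_P3 (@clss_sol R)] /\
  (* (c) *)
  (forall (n N : nat) (phi : 'I_N -> 'I_N -> R -> R)
          (S : stratification_data R N n),
     (0 < n)%N -> (0 < N)%N -> interaction phi ->
     is_stratification (opinion_field phi) S ->
     P1_P2 (global (stratified_sol (opinion_field phi) S)) /\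
     P3 (global (stratified_sol (opinion_field phi) S))) /\
  (exists (n N : nat) (phi : 'I_N -> 'I_N -> R -> R)
          (S S' : stratification_data R N n),
     [/\ (0 < n)%N, (0 < N)%N & interaction phi] /\
     [/\ is_stratification (opinion_field phi) S,
         is_stratification (opinion_field phi) S' &
         distinct_asymptotics (global (stratified_sol (opinion_field phi) S))
                              (global (stratified_sol (opinion_field phi) S'))]).
Proof.
split.
  move=> n N phi _ _ phiP; split; last exact: classical_P3.
  apply: mean_value_P1_P2 => // x xP; apply: piecewise_classical_mean_value => T T0.
  by apply: classical_piecewise => //; exact: xP.
split.
  split; split.
  - exact: caratheodory_P1_P2.
  - exact: caratheodory_not_P3.
  - exact: filippov_P1_P2.
  - exact: filippov_not_P3.
  - exact: krasovskii_P1_P2.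
  - exact: krasovskii_not_P3.
  - exact: clss_P1_P2.
  - exact: clss_not_P3.
split; last exact: stratification_dependence.
move=> n N phi S _ _ phiP SP; split.
  apply: mean_value_P1_P2 => // x xP; apply: piecewise_classical_mean_value => T T0.
  by have [_ _ [UI _] _ _] := SP; apply: stratified_piecewise UI (xP T T0).
have [C _ fC] := opinion_field_bounded n phiP.
by apply: P3_of_uniqueness => x y xP yP; exact: (stratified_unique SP fC xP yP).
Qed.
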